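(* There exists a stably finite, nuclear, unital $C^*$-algebra $A$ such that the unitary group $\mathrm{U}(A)$ is not amenable in the norm topology.
   Context: For a topological group $G$, $\mathrm{RUCB}(G)$ is the space of bounded functions $f\colon G\to\mathbb{C}$ with $\lim_{x\to 1}\|f_x-f\|_\infty=0$, where $f_x(y)=f(xy)$. $G$ is amenable if there is $\mu\in \mathrm{RUCB}(G)^*$ with $\mu(1)=\|\mu\|=1$ and $\mu(f_x)=\mu(f)$ for all $x\in G$, $f\in\mathrm{RUCB}(G)$. *)

(* Defs.v *)
From HB Require Import structures.
From mathcomp Require Import all_boot all_order all_algebra.
From mathcomp Require Import complex.
From mathcomp Require Import all_classical all_reals all_analysis.

Set Implicit Arguments.
Unset Strict Implicit.
Unset Printing Implicit Defensive.

Import Order.TTheory GRing.Theory Num.Theory.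
Import Normc.

Local Open Scope classical_set_scope.
Local Open Scope ring_scope.

HB.mixin Record isTopologicalGroup G of Topological G & Group G := {
  mulg_continuous : continuous (fun x : G * G => (x.1 * x.2)%g);
  invg_continuous : continuous (fun x : G => (x^-1)%g)
}.

#[short(type="topologicalGroupType")]
HB.structure Definition TopologicalGroup :=
  { G of isTopologicalGroup G & Topological G & Group G }.

Section amenability.
Context (R : realType).

Definition supnorm (T : Type) (f : T -> R[i]) : \bar R :=
  ereal_sup (range (fun t => (normc (f t))%:E)).

Context (G : topologicalGroupType).

Definition translate (x : G) (f : G -> R[i]) : G -> R[i] :=
  fun y => f (x * y)%g.

Definition RUCB : set (G -> R[i]) :=
  [set f | (supnorm f < +oo)%E /\
    (supnorm (fun y => translate x f y - f y) @[x --> (1%g : G)] --> 0%E)].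

(* A functional on RUCB(G) is represented by a function on all of G -> R[i],
   whose values outside RUCB(G) are irrelevant. *)
Definition linear_on_RUCB (mu : (G -> R[i]) -> R[i]) : Prop :=
  forall (c : R[i]) (f g : G -> R[i]), RUCB f -> RUCB g ->
    mu (fun y => c * f y + g y) = c * mu f + mu g.

Definition dualnorm (mu : (G -> R[i]) -> R[i]) : \bar R :=
  ereal_sup [set (normc (mu f))%:E | f in
    [set f | RUCB f /\ (supnorm f <= 1)%E]].

Definition amenable : Prop :=
  exists mu : (G -> R[i]) -> R[i],
    [/\ linear_on_RUCB mu,
        mu (fun=> 1) = 1,
        dualnorm mu = 1%E &
        forall (x : G) (f : G -> R[i]), RUCB f -> mu (translate x f) = mu f].

End amenability.

HB.mixin Record hasStar A of GRing.PzRing A := {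
  star : A -> A;
  starK : involutive star;
  starD : {morph star : x y / x + y};
  starM : forall x y : A, star (x * y) = star y * star x
}.

#[short(type="starRingType")]
HB.structure Definition StarRing := { A of hasStar A & GRing.PzRing A }.

HB.instance Definition _ (R : realType) :=
  hasStar.Build R[i] (@conjcK R) (rmorphD _)
    (fun x y => etrans (rmorphM _ x y) (mulrC _ _)).

Section mxstar.
Context (A : starRingType) (n : nat).

Definition mxstar (M : 'M[A]_n) : 'M[A]_n := \matrix_(i, j) star (M j i).

Lemma star_sum (I : Type) (r : seq I) (F : I -> A) :
  star (\sum_(i <- r) F i) = \sum_(i <- r) star (F i).
Proof.
have star0 : star (0 : A) = 0.
  by apply: (@addrI _ (star 0)); rewrite -starD !addr0.
by elim/big_rec2: _ => [|i x y _ <-]; rewrite ?starD.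
Qed.

Lemma mxstarK : involutive mxstar.
Proof. by move=> M; apply/matrixP => i j; rewrite !mxE starK. Qed.

Lemma mxstarD : {morph mxstar : M N / M + N}.
Proof. by move=> M N; apply/matrixP => i j; rewrite !mxE starD. Qed.

Lemma mxstarM (M N : 'M[A]_n) : mxstar (M * N) = mxstar N * mxstar M.
Proof.
apply/matrixP => i j; rewrite !mxE star_sum.
by apply: eq_bigr => k _; rewrite !mxE starM.
Qed.

HB.instance Definition _ := hasStar.Build 'M[A]_n mxstarK mxstarD mxstarM.

End mxstar.

(* In a C*-algebra, in particular in M_k(A) and M_k(M_n(C)), the positive
   elements are those of the form y^* y. *)
Definition star_positive (A : starRingType) (x : A) : Prop :=
  exists y : A, x = star y * y.

Definition completely_positive (A B : starRingType) (f : A -> B) : Prop :=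
  forall (k : nat) (M : 'M[A]_k), star_positive M -> star_positive (map_mx f M).

(* 1 is a finite projection, i.e. every isometry is unitary. *)
Definition finite_star (A : starRingType) : Prop :=
  forall v : A, star v * v = 1 -> v * star v = 1.

Definition stably_finite (A : starRingType) : Prop :=
  forall n : nat, finite_star 'M[A]_n.

Definition unitary (A : starRingType) : pred A :=
  fun u => (star u * u == 1) && (u * star u == 1).

(* The library has no structure combining a ring with a norm having values
   outside that ring, hence the explicit norm and completeness axioms. [algType]
   includes 1 != 0, so the zero algebra is excluded. *)
HB.mixin Record isCStarAlgebra (R : realType) A
    of StarRing A & GRing.Algebra R[i] A := {
  starZ : forall (c : R[i]) (x : A), star (c *: x) = conjc c *: star x;
  cnorm : A -> R;
  ler_cnormD : forall x y : A, cnorm (x + y) <= cnorm x + cnorm y;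
  cnormZ : forall (c : R[i]) (x : A), cnorm (c *: x) = normc c * cnorm x;
  cnorm0_eq0 : forall x : A, cnorm x = 0 -> x = 0;
  cnorm_complete : forall u : nat -> A,
    (forall e : R, 0 < e -> exists N : nat, forall m n : nat,
      (N <= m)%N -> (N <= n)%N -> cnorm (u m - u n) < e) ->
    exists l : A, forall e : R, 0 < e -> exists N : nat, forall n : nat,
      (N <= n)%N -> cnorm (u n - l) < e;
  ler_cnormM : forall x y : A, cnorm (x * y) <= cnorm x * cnorm y;
  cstar_identity : forall x : A, cnorm (star x * x) = cnorm x ^+ 2
}.

#[short(type="cstarAlgType")]
HB.structure Definition CStarAlgebra (R : realType) :=
  { A of isCStarAlgebra R A & StarRing A & GRing.Algebra R[i] A }.

Section cnorm_theory.
Context (R : realType) (A : cstarAlgType R).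
Implicit Types x y : A.

Lemma cnorm0 : cnorm (0 : A) = 0.
Proof. by rewrite -(scale0r (0 : A)) cnormZ normc0 mul0r. Qed.

Lemma cnormN x : cnorm (- x) = cnorm x.
Proof. by rewrite -scaleN1r cnormZ normcN normc1 mul1r. Qed.

Lemma cnorm_distC x y : cnorm (x - y) = cnorm (y - x).
Proof. by rewrite -cnormN opprB. Qed.

Lemma cnorm_ge0 x : 0 <= cnorm x.
Proof.
by have := ler_cnormD x (- x); rewrite subrr cnorm0 cnormN -mulr2n pmulrn_lge0.
Qed.

Lemma cnorm_star x : cnorm (star x) = cnorm x.
Proof.
have le_star y : cnorm y <= cnorm (star y).
  have [y0|y0] := ltP 0 (cnorm y); last exact: le_trans y0 (cnorm_ge0 _).
  by rewrite -(ler_pM2r y0) -expr2 -cstar_identity ler_cnormM.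
by apply/eqP; rewrite eq_le le_star -{2}(starK x) le_star.
Qed.

Lemma cnorm_unitary x : star x * x = 1 -> cnorm x = 1.
Proof.
have norm1 y : star y * y = 1 -> cnorm y ^+ 2 = cnorm (1 : A).
  by move=> y1; rewrite -cstar_identity y1.
have c1 : cnorm (1 : A) = 1.
  have n1 : cnorm (1 : A) != 0.
    by apply: contra_neq (oner_neq0 A) => /cnorm0_eq0.
  have /norm1 : star (1 : A) * 1 = 1.
    by rewrite -[RHS]starK -[in RHS](mulr1 (star 1)) starM starK !mulr1.
  by rewrite expr2 => /(canRL (mulfK n1)); rewrite divff.
move=> /norm1; rewrite c1 => /eqP; rewrite sqrf_eq1 => /orP[/eqP//|/eqP xN1].
by have := cnorm_ge0 x; rewrite xN1 oppr_ge0 ler10.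
Qed.

End cnorm_theory.

(* The norm below is the C*-norm of M_n(C), not the entrywise maximum norm
   which the library puts on matrices. *)
Definition l2norm (R : realType) (n : nat) (v : 'cV[R[i]]_n) : R :=
  Num.sqrt (\sum_(i < n) normc (v i 0) ^+ 2).

Definition opnorm (R : realType) (n : nat) (M : 'M[R[i]]_n) : R :=
  sup [set l2norm (M *m v) | v in [set v : 'cV[R[i]]_n | l2norm v <= 1]].

(* The identity of A is a point-norm limit of maps factoring through matrix
   algebras by contractive completely positive maps. *)
Definition nuclear (R : realType) (A : cstarAlgType R) : Prop :=
  forall (F : seq A) (e : R), 0 < e ->
  exists (n : nat) (phi : {linear A -> 'M[R[i]]_n})
         (psi : {linear 'M[R[i]]_n -> A}),
    [/\ completely_positive phi /\ (forall a, opnorm (phi a) <= cnorm a),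
        completely_positive psi /\ (forall M, cnorm (psi M) <= opnorm M) &
        forall a, a \in F -> cnorm (psi (phi a) - a) < e].

Definition unitary_group (R : realType) (A : cstarAlgType R) : Type :=
  {u : A | unitary u}.

Section unitary_group.
Context (R : realType) (A : cstarAlgType R).
Local Notation U := (unitary_group A).

HB.instance Definition _ := SubChoice.on U.

Lemma unitary1 : unitary (1 : A).
Proof.
have star1 : star (1 : A) = 1.
  by rewrite -[RHS]starK -[in RHS](mulr1 (star 1)) starM starK mulr1.
by rewrite /unitary star1 mulr1 eqxx.
Qed.

Lemma unitaryV (u : A) : unitary u -> unitary (star u).
Proof. by rewrite /unitary starK andbC. Qed.

Lemma unitaryM (u v : A) : unitary u -> unitary v -> unitary (u * v).
Proof.
move=> /andP[/eqP u1 /eqP u2] /andP[/eqP v1 /eqP v2].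
rewrite /unitary starM -mulrA (mulrA (star u)) u1 mul1r v1 eqxx /=.
by rewrite -mulrA (mulrA v) v2 mul1r u2.
Qed.

Definition unitary_one : U := exist _ 1 unitary1.
Definition unitary_mul (u v : U) : U :=
  exist _ (val u * val v) (unitaryM (valP u) (valP v)).
Definition unitary_inv (u : U) : U :=
  exist _ (star (val u)) (unitaryV (valP u)).

Lemma unitary_mulA : associative unitary_mul.
Proof. by move=> u v w; apply: val_inj; rewrite /= mulrA. Qed.

Lemma unitary_mul1 : left_id unitary_one unitary_mul.
Proof. by move=> u; apply: val_inj; rewrite /= mul1r. Qed.

Lemma unitary_mulr1 : right_id unitary_one unitary_mul.
Proof. by move=> u; apply: val_inj; rewrite /= mulr1. Qed.

Lemma unitary_mulV : left_inverse unitary_one unitary_inv unitary_mul.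
Proof. by move=> u; apply: val_inj; case/andP: (valP u) => /eqP. Qed.

Lemma unitary_mulrV : right_inverse unitary_one unitary_inv unitary_mul.
Proof. by move=> u; apply: val_inj; case/andP: (valP u) => _ /eqP. Qed.

HB.instance Definition _ := isGroup.Build U unitary_mulA unitary_mul1
  unitary_mulr1 unitary_mulV unitary_mulrV.

Definition unitary_dist (u v : U) : R := cnorm (val u - val v).

Lemma unitary_distxx u : unitary_dist u u = 0.
Proof. by rewrite /unitary_dist subrr cnorm0. Qed.

Lemma unitary_dist0 u v : unitary_dist u v = 0 -> u = v.
Proof. by move=> /cnorm0_eq0 /subr0_eq /val_inj. Qed.

Lemma unitary_distC u v : unitary_dist u v = unitary_dist v u.
Proof. exact: cnorm_distC. Qed.

Lemma unitary_dist_triangle v u w :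
  unitary_dist u w <= unitary_dist u v + unitary_dist v w.
Proof.
by rewrite /unitary_dist -(subrKA (val v)); exact: ler_cnormD.
Qed.

HB.instance Definition _ := isMetric.Build R U unitary_distxx unitary_dist0
  unitary_distC unitary_dist_triangle.

Lemma unitary_mul_continuous : continuous (fun x : U * U => (x.1 * x.2)%g).
Proof.
move=> [u v]; apply/cvg_ballP => e e0; near=> w.
rewrite ballEmdist /= -[mdist _ _]/(cnorm (val u * val v - val w.1 * val w.2)).
have -> : val u * val v - val w.1 * val w.2 =
    (val u - val w.1) * val v + val w.1 * (val v - val w.2).
  by rewrite mulrBl mulrBr addrA subrK.
rewrite (splitr e) (le_lt_trans (ler_cnormD _ _)) // ltrD //.
- rewrite (le_lt_trans (ler_cnormM _ _)) // [cnorm (val v)]cnorm_unitary.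
    rewrite mulr1; suff : ball u (e / 2) w.1 by rewrite ballEmdist.
    near: w; apply: (@cvg_fst _ _ (nbhs u) (nbhs v) (nbhs_filter v)).
    by apply: nbhsx_ballx; rewrite divr_gt0.
  by case/andP: (valP v) => /eqP.
- rewrite (le_lt_trans (ler_cnormM _ _)) // [cnorm (val w.1)]cnorm_unitary.
    rewrite mul1r; suff : ball v (e / 2) w.2 by rewrite ballEmdist.
    near: w; apply: (@cvg_snd _ _ (nbhs u) (nbhs v) (nbhs_filter u)).
    by apply: nbhsx_ballx; rewrite divr_gt0.
  by case/andP: (valP w.1) => /eqP.
Unshelve. all: by end_near. Qed.

Lemma unitary_inv_continuous : continuous (fun x : U => (x^-1)%g).
Proof.
move=> u; apply/(@cvg_ballP _ _ _ _ (nbhs_filter u)) => e e0.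
apply: filterS (nbhsx_ballx u e e0) => w.
rewrite !ballEmdist /= -[mdist u w]/(cnorm (val u - val w)).
rewrite -[mdist _ _]/(cnorm (star (val u) - star (val w))).
suff -> : star (val u) - star (val w) = star (val u - val w).
  by rewrite cnorm_star.
by apply: (addIr (star (val w))); rewrite subrK -starD subrK.
Qed.

HB.instance Definition _ :=
  isTopologicalGroup.Build U unitary_mul_continuous unitary_inv_continuous.

End unitary_group.

(* Main.v *)
(* Let W_m be the set of words of length at most m over {0, 1}, so that
   l^2(W_m) is a truncated Fock space. The algebra A consists of the bounded
   sequences of matrices on these spaces that are asymptotically
   approximated in norm by linear combinations of 1 and of the operators
   sum_w f(|w|/m) e_(al w, be w), where f is uniformly continuous with
   support inside (0, 1) and al, be are fixed words. It is a C*-subalgebra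
   of a product of matrix algebras, hence stably finite.

   For nuclearity, a is compressed to its first n+1 blocks, and the block X at
   level n is stretched to the levels m > n by X |-> sum_j V_j^* X V_j. There
   V_v maps a word u = al v to al, weighted by the square root of the share of
   |al| in a window of length W ending at n|u|/m. Windows shifted by a bounded
   amount almost coincide when W is large, so that the stretch of a_n is close
   to a_m as soon as n is large compared to W.

   Near the level m/2 the two creation operators of A are isometries whose
   ranges are orthogonal with sum 1. Averaging a state supported there over the
   unitary group with an invariant mean would give a functional tau with
   tau (u^* a u) = tau a, hence a trace, for which 1 = tau 1 = 1 + 1. *)
Require Import Defs.
From HB Require Import structures.
From mathcomp Require Import all_boot all_order all_algebra.
From mathcomp Require Import complex ring lra zify.
From mathcomp Require Import all_classical all_reals all_analysis.

Set Implicit Arguments.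
Unset Strict Implicit.
Unset Printing Implicit Defensive.

Import Order.TTheory GRing.Theory Num.Theory.
Import Normc.
Import numFieldNormedType.Exports.

Local Open Scope classical_set_scope.
Local Open Scope ring_scope.

(** * Operator norm of matrices *)

Section hilbert.
Context (R : realType).
Local Notation C := R[i].

(** A stably finite algebra contains no two isometries with orthogonal ranges summing to 1, yet the
    trace argument wants such a pair, so the pair exists only locally. Modulo null sequences the
    algebra is a unitized suspension of the Cuntz algebra O_2, with |w|/m as suspension coordinate.
    Support inside (0, 1) cuts off the two ends where the Cuntz relations fail: the empty word and
    the truncation at length m. Uniform continuity makes f(|w|/m) commute asymptotically with adding
    or deleting a fixed number of letters, which closes the linear span under products up to null
    sequences. The same separation of scales serves twice more. Up to a small error an element moves
    the word in the middle by a number of letters negligible against m, so the averaged functional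
    sees only middle levels. And the window length W is large against such shifts but small against
    n. Near level 0 windows do not fit, and a stretch made of windows alone would lose the unit
    there; the missing mass is filled with the matrix entry at a word of full length n, which is
    zero for every band once n is large. *)

Definition adj (m n : nat) (M : 'M[C]_(m, n)) : 'M[C]_(n, m) :=
  \matrix_(i, j) conjc (M j i).

(** The real part of the inner product: a symmetric real bilinear form with the same norms, for
    which inequalities become real quadratic arithmetic. *)
Definition rdot (n : nat) (u v : 'cV[C]_n) : R :=
  \sum_(i < n) complex.Re (conjc (u i 0) * v i 0).

Lemma sqr_normcE (z : C) : normc z ^+ 2 = complex.Re z ^+ 2 + complex.Im z ^+ 2.
Proof.
by case: z => a b /=; rewrite sqr_sqrtr // addr_ge0 ?sqr_ge0.
Qed.

Lemma normc_ge0 (z : C) : 0 <= normc z.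
Proof. by case: z => a b; exact: sqrtr_ge0. Qed.

Lemma normc_conj (z : C) : normc (conjc z) = normc z.
Proof. by case: z => a b /=; rewrite sqrrN. Qed.

Lemma normc_real (x : R) : normc (x%:C%C) = `|x|.
Proof. by rewrite /= expr0n addr0 sqrtr_sqr. Qed.

Lemma ReM_le (x y : C) : complex.Re (conjc x * y) <= normc x * normc y.
Proof.
rewrite -(normc_conj x) -normcM; case: (conjc x * y) => a b /=.
by rewrite (le_trans (ler_norm a)) // -sqrtr_sqr ler_wsqrtr // lerDl sqr_ge0.
Qed.

Lemma adjK m n : cancel (@adj m n) (@adj n m).
Proof. by move=> M; apply/matrixP => i j; rewrite !mxE conjcK. Qed.

Lemma adjM m n p (M : 'M[C]_(m, n)) (N : 'M[C]_(n, p)) :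
  adj (M *m N) = adj N *m adj M.
Proof.
apply/matrixP => i j; rewrite !mxE rmorph_sum; apply: eq_bigr => k _.
by rewrite !mxE rmorphM mulrC.
Qed.

Lemma adj_is_zmod m n : zmod_morphism (@adj m n).
Proof. by move=> M N; apply/matrixP => i j; rewrite !mxE rmorphB. Qed.

HB.instance Definition _ m n :=
  GRing.isZmodMorphism.Build 'M[C]_(m, n) 'M[C]_(n, m) (@adj m n) (@adj_is_zmod m n).

Lemma adj_scale m n (c : C) (M : 'M[C]_(m, n)) : adj (c *: M) = conjc c *: adj M.
Proof. by apply/matrixP => i j; rewrite !mxE rmorphM. Qed.

Section rdot.
Context (n : nat).
Implicit Types u v w : 'cV[C]_n.

Lemma rdotC u v : rdot u v = rdot v u.
Proof.
apply: eq_bigr => i _; case: (u i 0) (v i 0) => a b [c d] /=.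
by rewrite !mulNr !opprK ![_ * c]mulrC ![_ * d]mulrC.
Qed.

Lemma rdotDl u v w : rdot (u + v) w = rdot u w + rdot v w.
Proof.
rewrite -big_split; apply: eq_bigr => i _.
by rewrite !mxE rmorphD mulrDl raddfD.
Qed.

Lemma rdotDr u v w : rdot w (u + v) = rdot w u + rdot w v.
Proof. by rewrite !(rdotC w) rdotDl. Qed.

Lemma rdotZl (r : R) u v : rdot (r%:C%C *: u) v = r * rdot u v.
Proof.
rewrite /rdot mulr_sumr; apply: eq_bigr => i _.
rewrite !mxE; case: (u i 0) (v i 0) => a b [c d] /=.
by rewrite !mul0r !mulrDr; ring.
Qed.

Lemma rdotZr (r : R) u v : rdot u (r%:C%C *: v) = r * rdot u v.
Proof. by rewrite rdotC rdotZl rdotC. Qed.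

Lemma rdotNl u v : rdot (- u) v = - rdot u v.
Proof.
by rewrite /rdot -sumrN; apply: eq_bigr => i _; rewrite !mxE rmorphN mulNr raddfN.
Qed.

Lemma rdotNr u v : rdot u (- v) = - rdot u v.
Proof. by rewrite rdotC rdotNl rdotC. Qed.

Lemma rdotvv v : rdot v v = l2norm v ^+ 2.
Proof.
rewrite /l2norm sqr_sqrtr ?sumr_ge0 // => [|i _]; last exact: sqr_ge0.
apply: eq_bigr => i _; rewrite sqr_normcE; case: (v i 0) => a b /=.
by rewrite mulNr opprK -!expr2.
Qed.

Lemma l2norm_ge0 v : 0 <= l2norm v.
Proof. exact: sqrtr_ge0. Qed.

Lemma l2norm0 : l2norm (0 : 'cV[C]_n) = 0.
Proof.
rewrite /l2norm big1 ?sqrtr0 // => i _.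
by rewrite mxE [normc _]normc0 expr0n.
Qed.

Lemma l2normZ (c : C) v : l2norm (c *: v) = normc c * l2norm v.
Proof.
rewrite /l2norm -[normc c in RHS]ger0_norm ?normc_ge0 // -sqrtr_sqr -sqrtrM ?sqr_ge0 //.
rewrite mulr_sumr; congr (Num.sqrt _); apply: eq_bigr => i _.
by rewrite mxE normcM exprMn.
Qed.

Lemma normc_le_l2norm v i : normc (v i 0) <= l2norm v.
Proof.
rewrite -(ger0_norm (normc_ge0 (v i 0))) -sqrtr_sqr ler_wsqrtr //.
by rewrite (bigD1 i) //= lerDl sumr_ge0 // => j _; exact: sqr_ge0.
Qed.

Lemma l2norm_eq0 v : l2norm v = 0 -> v = 0.
Proof.
move=> v0; apply/matrixP => i j; rewrite ord1 mxE; apply: eq0_normc.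
by apply/eqP; rewrite eq_le normc_ge0 -v0 normc_le_l2norm.
Qed.

Lemma rdot_le u v : rdot u v <= l2norm u * l2norm v.
Proof.
have [/eqP/l2norm_eq0 ->|u0] := boolP (l2norm u == 0).
  rewrite l2norm0 mul0r /rdot big1 // => i _.
  by rewrite mxE conjc0 mul0r.
have [/eqP/l2norm_eq0 ->|v0] := boolP (l2norm v == 0).
  by rewrite l2norm0 mulr0 /rdot big1 // => i _; rewrite mxE mulr0.
set a := l2norm u in u0 *; set b := l2norm v in v0 *.
have a0 : 0 < a by rewrite lt_def u0 l2norm_ge0.
have b0 : 0 < b by rewrite lt_def v0 l2norm_ge0.
have ab0 : 0 < a * b by rewrite mulr_gt0.
(* With a = |u| and b = |v|, the square of |b u - a v| expands to 2ab(ab - <u, v>). *)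
have : 0 <= rdot (b%:C%C *: u - a%:C%C *: v) (b%:C%C *: u - a%:C%C *: v).
  by rewrite rdotvv sqr_ge0.
rewrite rdotDl !rdotDr !rdotNl !rdotNr !rdotZl !rdotZr !rdotvv (rdotC v u).
rewrite -/a -/b => h.
have : 0 <= (a * b) * (a * b - rdot u v) by nra.
by rewrite pmulr_rge0 // subr_ge0.
Qed.

Lemma ler_l2normD u v : l2norm (u + v) <= l2norm u + l2norm v.
Proof.
rewrite -(@ler_pXn2r _ 2) ?nnegrE ?addr_ge0 ?l2norm_ge0 //.
rewrite -rdotvv rdotDl !rdotDr !rdotvv (rdotC v u).
have := rdot_le u v; nra.
Qed.

Lemma l2norm_sum (I : Type) (r : seq I) (F : I -> 'cV[C]_n) :
  l2norm (\sum_(i <- r) F i) <= \sum_(i <- r) l2norm (F i).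
Proof.
elim/big_rec2: _ => [|i y x _ yx]; first by rewrite l2norm0.
by rewrite (le_trans (ler_l2normD _ _)) // lerD2l.
Qed.

End rdot.

Lemma rdot_adj m n (M : 'M[C]_(m, n)) u v :
  rdot (M *m u) v = rdot u (adj M *m v).
Proof.
rewrite /rdot.
transitivity (\sum_i \sum_j complex.Re (conjc (M i j) * conjc (u j 0) * v i 0)).
  apply: eq_bigr => i _; rewrite mxE rmorph_sum mulr_suml raddf_sum.
  by apply: eq_bigr => j _; rewrite rmorphM.
rewrite exchange_big; apply: eq_bigr => j _ /=.
rewrite mxE mulr_sumr raddf_sum; apply: eq_bigr => i _; rewrite !mxE.
by rewrite mulrA (mulrC (conjc (u _ _))).
Qed.

Lemma rdot_suml n (I : Type) (r : seq I) (F : I -> 'cV[C]_n) v :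
  rdot (\sum_(i <- r) F i) v = \sum_(i <- r) rdot (F i) v.
Proof.
elim/big_rec2: _ => [|i y x _ <-]; last by rewrite rdotDl.
by rewrite /rdot big1 // => i _; rewrite mxE conjc0 mul0r.
Qed.

Lemma rdot_sumr n (I : Type) (r : seq I) (F : I -> 'cV[C]_n) v :
  rdot v (\sum_(i <- r) F i) = \sum_(i <- r) rdot v (F i).
Proof.
by rewrite rdotC rdot_suml; apply: eq_bigr => i _; rewrite rdotC.
Qed.

Section opnorm.
Context (n : nat).
Implicit Types M N : 'M[C]_n.

Let opset M := [set l2norm (M *m v) | v in [set v : 'cV[C]_n | l2norm v <= 1]].

(** Any bound, here the sum of the column norms, makes the supremum in [opnorm] a genuine one. *)
Let opset_bound M : exists2 B, 0 <= B & forall v, l2norm (M *m v) <= B * l2norm v.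
Proof.
exists (\sum_j l2norm (col j M)) => [|v]; first by rewrite sumr_ge0 // => j _; exact: l2norm_ge0.
have -> : M *m v = \sum_j v j 0 *: col j M.
  apply/matrixP => i j; rewrite ord1 mxE summxE; apply: eq_bigr => k _.
  by rewrite !mxE mulrC.
rewrite (le_trans (l2norm_sum _ _)) // mulr_suml ler_sum // => j _.
by rewrite l2normZ mulrC ler_wpM2l ?l2norm_ge0 ?normc_le_l2norm.
Qed.

Let opset0 M : opset M 0.
Proof. by exists 0; rewrite /= ?l2norm0 // mulmx0 l2norm0. Qed.

Let opset_sup M : has_sup (opset M).
Proof.
split; first by exists 0.
have [B B0 MB] := opset_bound M; exists B => _ [v /= v1 <-].
by rewrite (le_trans (MB v)) // ler_piMr.
Qed.

Lemma opnorm_ge0 M : 0 <= opnorm M.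
Proof. by apply: sup_upper_bound; [exact: opset_sup|exact: opset0]. Qed.

Lemma l2norm_mulmx M v : l2norm (M *m v) <= opnorm M * l2norm v.
Proof.
have [/eqP/l2norm_eq0 ->|v0] := boolP (l2norm v == 0).
  by rewrite mulmx0 l2norm0 mulr0.
have {}v0 : 0 < l2norm v by rewrite lt_def v0 l2norm_ge0.
have nv : normc ((l2norm v)^-1%:C%C) = (l2norm v)^-1.
  by rewrite normc_real ger0_norm // invr_ge0 ltW.
rewrite -ler_pdivrMr // mulrC -nv -l2normZ scalemxAr.
apply: sup_upper_bound; first exact: opset_sup.
exists ((l2norm v)^-1%:C%C *: v) => //=.
by rewrite l2normZ nv mulVf // gt_eqF.
Qed.

Lemma opnorm_le M c : 0 <= c ->
  (forall v, l2norm (M *m v) <= c * l2norm v) -> opnorm M <= c.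
Proof.
move=> c0 Mc; apply: ge_sup => [|_ [v /= v1 <-]]; first by exists 0; exact: opset0.
by rewrite (le_trans (Mc v)) // ler_piMr.
Qed.

Lemma ler_opnormD M N : opnorm (M + N) <= opnorm M + opnorm N.
Proof.
apply: opnorm_le => [|v]; first by rewrite addr_ge0 ?opnorm_ge0.
by rewrite mulmxDl (le_trans (ler_l2normD _ _)) // mulrDl lerD // l2norm_mulmx.
Qed.

Lemma opnorm0 : opnorm (0 : 'M[C]_n) = 0.
Proof.
apply/eqP; rewrite eq_le opnorm_ge0 andbT; apply: opnorm_le => // v.
by rewrite mul0mx l2norm0 mul0r.
Qed.

Lemma opnormZ_le (c : C) M : opnorm (c *: M) <= normc c * opnorm M.
Proof.
apply: opnorm_le => [|v]; first by rewrite mulr_ge0 ?opnorm_ge0 ?normc_ge0.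
by rewrite -scalemxAl l2normZ -mulrA ler_wpM2l ?normc_ge0 ?l2norm_mulmx.
Qed.

Lemma opnormZ (c : C) M : opnorm (c *: M) = normc c * opnorm M.
Proof.
have [->|c0] := eqVneq c 0; first by rewrite scale0r opnorm0 [normc _]normc0 mul0r.
apply/eqP; rewrite eq_le opnormZ_le /=.
have nc0 : 0 < normc c.
  by rewrite lt_def normc_ge0 andbT; apply: contra_neq c0 => /eq0_normc.
rewrite -ler_pdivlMl // -normcV.
by rewrite -{1}(scale1r M) -(mulVf c0) -scalerA opnormZ_le.
Qed.

Lemma opnormN M : opnorm (- M) = opnorm M.
Proof. by rewrite -scaleN1r opnormZ normcN [normc 1]normc1 mul1r. Qed.

Lemma opnorm_distC M N : opnorm (M - N) = opnorm (N - M).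
Proof. by rewrite -opnormN opprB. Qed.

Lemma ler_opnormM M N : opnorm (M *m N) <= opnorm M * opnorm N.
Proof.
apply: opnorm_le => [|v]; first by rewrite mulr_ge0 ?opnorm_ge0.
rewrite -mulmxA (le_trans (l2norm_mulmx _ _)) // -mulrA.
by rewrite ler_wpM2l ?opnorm_ge0 ?l2norm_mulmx.
Qed.

Lemma opnorm1_le : opnorm (1%:M : 'M[C]_n) <= 1.
Proof. by apply: opnorm_le => // v; rewrite mul1mx mul1r. Qed.

(** |Mv|^2 = <M^*M v, v>, to which Cauchy-Schwarz applies. This is the nontrivial half of the
    C*-identity; cancelling one factor in it also yields [opnorm_adj]. *)
Lemma sqr_opnorm_le M : opnorm M ^+ 2 <= opnorm (adj M *m M).
Proof.
rewrite -(@ler_psqrt _ _) ?nnegrE ?sqr_ge0 ?opnorm_ge0 //.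
rewrite sqrtr_sqr ger0_norm ?opnorm_ge0 //.
apply: opnorm_le => [|v]; first exact: sqrtr_ge0.
rewrite -(@ler_pXn2r _ 2) ?nnegrE ?mulr_ge0 ?sqrtr_ge0 ?l2norm_ge0 //.
rewrite exprMn (sqr_sqrtr (opnorm_ge0 _)) -rdotvv rdot_adj mulmxA.
rewrite (le_trans (rdot_le _ _)) // mulrC expr2 mulrA.
by rewrite ler_wpM2r ?l2norm_ge0 ?l2norm_mulmx.
Qed.

Lemma opnorm_adj M : opnorm (adj M) = opnorm M.
Proof.
have le_adj N : opnorm N <= opnorm (adj N).
  have [N0|N0] := ltP 0 (opnorm N); last exact: le_trans N0 (opnorm_ge0 _).
  have := le_trans (sqr_opnorm_le N) (ler_opnormM (adj N) N).
  by rewrite expr2 ler_pM2r.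
by apply/le_anti; rewrite (le_adj M) andbT; have := le_adj (adj M); rewrite adjK.
Qed.

Lemma opnorm_cstar M : opnorm (adj M *m M) = opnorm M ^+ 2.
Proof.
have := ler_opnormM (adj M) M; rewrite opnorm_adj -expr2 => MM.
by apply/le_anti; rewrite MM sqr_opnorm_le.
Qed.

Lemma normc_le_opnorm M i j : normc (M i j) <= opnorm M.
Proof.
have e1 : l2norm (delta_mx j 0 : 'cV[C]_n) = 1.
  rewrite /l2norm (bigD1 j) //= !mxE !eqxx [normc _]normc1 expr1n big1 ?addr0 ?sqrtr1 //.
  by move=> k kj; rewrite !mxE (negPf kj) [normc _]normc0 expr0n.
have := l2norm_mulmx M (delta_mx j 0); rewrite e1 mulr1; apply: le_trans.
by rewrite -colE (le_trans _ (normc_le_l2norm _ i)) // mxE.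
Qed.

Lemma opnorm_eq0 M : opnorm M = 0 -> M = 0.
Proof.
move=> M0; apply/matrixP => i j; rewrite mxE; apply: eq0_normc.
by apply/eqP; rewrite eq_le normc_ge0 -M0 normc_le_opnorm.
Qed.

(** Taking [w] parallel to [M *m v] and as long as [v] turns the mean of squares into the product of
    norms. The mean is the convenient side, because squares add up over blocks and over Kraus
    operators. *)
Lemma opnorm_le_form M c : 0 <= c ->
  (forall v w, rdot w (M *m v) <= c * ((l2norm v ^+ 2 + l2norm w ^+ 2) / 2)) ->
  opnorm M <= c.
Proof.
move=> c0 Mc; apply: opnorm_le => // v.
have [/eqP/l2norm_eq0 ->|v0] := boolP (l2norm v == 0).
  by rewrite mulmx0 l2norm0 mulr0.
have [/eqP ->|y0] := boolP (l2norm (M *m v) == 0).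
  by rewrite mulr_ge0 ?l2norm_ge0.
have := Mc v ((l2norm v / l2norm (M *m v))%:C%C *: (M *m v)).
rewrite rdotZl rdotvv l2normZ normc_real.
set a := l2norm v in v0 *; set b := l2norm (M *m v) in y0 *.
have a0 : 0 < a by rewrite lt_def v0 l2norm_ge0.
have b0 : 0 < b by rewrite lt_def y0 l2norm_ge0.
rewrite ger0_norm ?divr_ge0 ?l2norm_ge0 //.
have -> : a / b * b ^+ 2 = a * b by field.
have -> : (a ^+ 2 + (a / b * b) ^+ 2) / 2 = a * a by field.
by rewrite mulrCA ler_pM2l.
Qed.

(** The Schur test. Each product |w_i| |M_ij| |v_j| is split by the arithmetic-geometric mean; row
    sums then control [w] and column sums control [v]. *)
Lemma opnorm_le_schur M c : 0 <= c ->
  (forall i, \sum_j normc (M i j) <= c) ->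
  (forall j, \sum_i normc (M i j) <= c) -> opnorm M <= c.
Proof.
move=> c0 Mr Mc; apply: opnorm_le_form => // v w.
have -> : rdot w (M *m v) = \sum_i \sum_j complex.Re (conjc (w i 0) * (M i j * v j 0)).
  by apply: eq_bigr => i _; rewrite mxE mulr_sumr raddf_sum.
apply: (@le_trans _ _ (\sum_i \sum_j normc (M i j) * (normc (v j 0) ^+ 2 / 2)
   + \sum_i \sum_j normc (M i j) * (normc (w i 0) ^+ 2 / 2))).
  rewrite -big_split ler_sum //= => i _; rewrite -big_split ler_sum //= => j _.
  rewrite (le_trans (ReM_le _ _)) // normcM.
  have := sqr_ge0 (normc (w i 0) - normc (v j 0)).
  have := normc_ge0 (M i j).
  set x := normc _; set y := normc _; set z := normc _ => x0 yz.
  have : 0 <= x * (y - z) ^+ 2 by rewrite mulr_ge0.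
  nra.
rewrite exchange_big /= mulrDl mulrDr lerD //.
  rewrite -rdotvv rdotvv /l2norm sqr_sqrtr; last first.
    by rewrite sumr_ge0 // => i _; exact: sqr_ge0.
  rewrite mulr_suml mulr_sumr ler_sum // => j _.
  by rewrite -mulr_suml ler_wpM2r ?divr_ge0 ?sqr_ge0.
rewrite /l2norm sqr_sqrtr; last first.
  by rewrite sumr_ge0 // => i _; exact: sqr_ge0.
rewrite mulr_suml mulr_sumr ler_sum // => j _.
by rewrite -mulr_suml ler_wpM2r ?divr_ge0 ?sqr_ge0.
Qed.

End opnorm.

(** The columns of all V_j and of all W_j are contractions, and the sum is a block diagonal of
    copies of [x] placed between them. *)
Lemma opnorm_compress (n p : nat) (J : finType) (V W : J -> 'M[C]_(p, n))
    (x : 'M[C]_p) :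
  (forall v, \sum_j l2norm (V j *m v) ^+ 2 <= l2norm v ^+ 2) ->
  (forall v, \sum_j l2norm (W j *m v) ^+ 2 <= l2norm v ^+ 2) ->
  opnorm (\sum_j adj (W j) *m x *m V j) <= opnorm x.
Proof.
move=> V1 W1; apply: opnorm_le_form => [|v w]; first exact: opnorm_ge0.
rewrite mulmx_suml rdot_sumr.
apply: (@le_trans _ _ (\sum_j opnorm x *
    ((l2norm (V j *m v) ^+ 2 + l2norm (W j *m w) ^+ 2) / 2))).
  apply: ler_sum => j _.
  rewrite -!mulmxA rdotC rdot_adj adjK (rdotC _ (W j *m w)).
  rewrite (le_trans (rdot_le _ _)) //.
  have := l2norm_mulmx x (V j *m v); have := l2norm_ge0 (W j *m w).
  have := opnorm_ge0 x.
  set a := l2norm _; set b := opnorm _; set c := l2norm _; set d := l2norm _.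
  move=> b0 a0 cd.
  have : a * c <= a * (b * d) by rewrite ler_wpM2l.
  have : 0 <= b * (a - d) ^+ 2 by rewrite mulr_ge0 ?sqr_ge0.
  nra.
rewrite -mulr_sumr ler_wpM2l ?opnorm_ge0 // -mulr_suml ler_wpM2r //.
by rewrite big_split lerD.
Qed.

End hilbert.

(** * Block matrices, coordinate compressions, completeness of the scalars *)

Section blocks.
Context (R : realType).
Local Notation C := R[i].

Lemma rdotE n (u v : 'cV[C]_n) : rdot u v = complex.Re ((adj u *m v) 0 0).
Proof. by rewrite mxE raddf_sum; apply: eq_bigr => i _; rewrite mxE. Qed.

Lemma rdot_mxcol p (p_ : 'I_p -> nat) (u v : forall i, 'cV[C]_(p_ i)) :
  rdot (\mxcol_i u i) (\mxcol_i v i) = \sum_i rdot (u i) (v i).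
Proof.
have adj_col : adj (\mxcol_i u i) = \mxrow_i adj (u i).
  by apply/matrixP => i j; rewrite !mxE.
rewrite rdotE adj_col mul_mxrow_mxcol summxE raddf_sum.
by apply: eq_bigr => i _; rewrite rdotE.
Qed.

Lemma sqr_l2norm_mxcol p (p_ : 'I_p -> nat) (u : forall i, 'cV[C]_(p_ i)) :
  l2norm (\mxcol_i u i) ^+ 2 = \sum_i l2norm (u i) ^+ 2.
Proof. by rewrite -rdotvv rdot_mxcol; apply: eq_bigr => i _; rewrite rdotvv. Qed.

Lemma opnorm_mxdiag p (p_ : 'I_p -> nat) (D : forall i, 'M[C]_(p_ i)) (c : R) :
  0 <= c -> (forall i, opnorm (D i) <= c) -> opnorm (\mxdiag_i D i) <= c.
Proof.
move=> c0 Dc; apply: opnorm_le => // v.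
rewrite -(@ler_pXn2r _ 2) ?nnegrE ?mulr_ge0 ?l2norm_ge0 //.
rewrite -[v]submxcolK mul_mxdiag_mxcol exprMn !sqr_l2norm_mxcol mulr_sumr.
apply: ler_sum => i _; rewrite -exprMn ler_pXn2r ?nnegrE ?mulr_ge0 ?l2norm_ge0 //.
by rewrite (le_trans (l2norm_mulmx _ _)) // ler_wpM2r ?l2norm_ge0.
Qed.

Definition selmx n p (f : 'I_n -> 'I_p) : 'M[C]_(p, n) := \matrix_(i, j) (i == f j)%:R.

Lemma l2norm_selmx n p (f : 'I_n -> 'I_p) v :
  injective f -> l2norm (selmx f *m v) ^+ 2 = l2norm v ^+ 2.
Proof.
move=> f_inj; rewrite -!rdotvv rdot_adj mulmxA.
have -> : adj (selmx f) *m selmx f = 1%:M.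
  apply/matrixP => i j; rewrite !mxE (bigD1 (f i)) //= !mxE eqxx conjc1 mul1r.
  rewrite big1 ?addr0 ?(inj_eq f_inj) // => k ki.
  by rewrite !mxE (negPf ki) conjc0 mul0r.
by rewrite mul1mx.
Qed.

Lemma mxsub_selmx n p (f g : 'I_n -> 'I_p) (M : 'M[C]_p) :
  mxsub f g M = adj (selmx f) *m M *m selmx g.
Proof.
apply/matrixP => i j; rewrite !mxE.
rewrite (bigD1 (g j)) //= !mxE eqxx mulr1 [X in _ + X]big1 ?addr0 => [|k kj]; last first.
  by rewrite [selmx g _ _]mxE (negPf kj) mulr0.
rewrite (bigD1 (f i)) //= !mxE eqxx conjc1 mul1r big1 ?addr0 // => k ki.
by rewrite !mxE (negPf ki) conjc0 mul0r.
Qed.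

Lemma opnorm_mxsub n p (f g : 'I_n -> 'I_p) (M : 'M[C]_p) :
  injective f -> injective g -> opnorm (mxsub f g M) <= opnorm M.
Proof.
move=> f_inj g_inj; have -> : mxsub f g M = \sum_(j < 1) adj (selmx f) *m M *m selmx g.
  by rewrite big_ord1 mxsub_selmx.
by apply: opnorm_compress => v; rewrite big_ord1 l2norm_selmx.
Qed.

Lemma Rank_inj p (p_ : 'I_p -> nat) i : injective (@tagnat.Rank p p_ i).
Proof. exact: inc_inj (@tagnat.le_Rank _ _ i). Qed.

(** Crude, but enough to pass from entrywise to norm convergence inside one block. *)
Lemma opnorm_le_entries n (M : 'M[C]_n) :
  opnorm M <= \sum_i \sum_j normc (M i j).
Proof.
apply: opnorm_le_schur => [|i|j].
- by do 2!(rewrite sumr_ge0 // => ? _); exact: normc_ge0.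
- rewrite [leRHS](bigD1 i) //= lerDl sumr_ge0 // => k _.
  by rewrite sumr_ge0 // => l _; exact: normc_ge0.
- rewrite ler_sum // => i _; rewrite (bigD1 j) //= lerDl sumr_ge0 // => l _.
  exact: normc_ge0.
Qed.

Section flat.
Context (k d : nat).
Implicit Types X Y : 'M['M[C]_d]_k.

(** The identification of M_k(M_d) with matrices of size kd, where the norm and the positivity of a
    matrix of matrices are read off. *)
Definition flat X : 'M[C]_(\sum_(i < k) d) := \mxblock_(i, j) X i j.

Lemma flatD X Y : flat (X + Y) = flat X + flat Y.
Proof. by rewrite -mxblockD; apply: eq_mxblock => i j; rewrite mxE. Qed.

Lemma flatB X Y : flat (X - Y) = flat X - flat Y.
Proof. by rewrite -mxblockB; apply: eq_mxblock => i j; rewrite !mxE. Qed.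

Lemma flatM X Y : flat (X * Y) = flat X *m flat Y.
Proof. by rewrite /flat mul_mxblock; apply: eq_mxblock => i j; rewrite mxE. Qed.

Lemma flat1 : flat 1 = 1%:M.
Proof.
rewrite -(@mxdiagZ _ _ (fun=> d) 1); apply: eq_mxblock => i j.
by rewrite mxE; case: eqP => _ //; rewrite conform_mx_id.
Qed.

Lemma flat_star X : flat (star X) = adj (flat X).
Proof. by apply/matrixP => i j; rewrite !mxE. Qed.

Lemma flat_inj : injective flat.
Proof.
move=> X Y XY; apply/matrixP => i j.
by have := mxblockK X i j; rewrite -/(flat X) XY mxblockK.
Qed.

Lemma opnorm_entry X i j : opnorm (X i j) <= opnorm (flat X).
Proof.
rewrite -[X i j](@mxblockK _ _ _ (fun=> d) (fun=> d)).
by apply: opnorm_mxsub; exact: Rank_inj.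
Qed.

Lemma opnorm_flat X : opnorm (flat X) <= \sum_i \sum_j opnorm (X i j).
Proof.
apply: opnorm_le_form => [|v w].
  by do 2!(rewrite sumr_ge0 // => ? _); exact: opnorm_ge0.
rewrite -[v]submxcolK -[w]submxcolK mul_mxblock_mxrow rdot_mxcol.
rewrite mulr_suml ler_sum // => i _; rewrite rdot_sumr mulr_suml ler_sum // => j _.
rewrite !submxcolK.
have nle (u : 'cV[C]_(\sum_(i < k) d)) l : l2norm (submxcol u l) ^+ 2 <= l2norm u ^+ 2.
  rewrite -[u in leRHS]submxcolK sqr_l2norm_mxcol (bigD1 l) //= lerDl sumr_ge0 // => s _.
  exact: sqr_ge0.
rewrite (le_trans (rdot_le _ _)) //.
have := l2norm_mulmx (X i j) (submxcol v j).
have := nle v j; have := nle w i.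
have := l2norm_ge0 (submxcol w i); have := opnorm_ge0 (X i j).
set a := l2norm _; set b := l2norm _; set c := opnorm _; set e := l2norm _.
set f := l2norm _; set g := l2norm _ => c0 a0 wi vj h.
have : a * g <= a * (c * e) by rewrite ler_wpM2l.
have : 0 <= c * (a - e) ^+ 2 by rewrite mulr_ge0 ?sqr_ge0.
have : c * (e ^+ 2 + a ^+ 2) <= c * (f ^+ 2 + b ^+ 2) by rewrite ler_wpM2l // lerD.
nra.
Qed.

End flat.

Lemma cauchy_real (x : nat -> R) :
  (forall e : R, 0 < e -> exists N : nat, forall m n : nat,
    (N <= m)%N -> (N <= n)%N -> `|x m - x n| < e) ->
  exists l : R, forall e : R, 0 < e -> exists N : nat, forall n : nat,
    (N <= n)%N -> `|x n - l| < e.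
Proof.
move=> xC; have xc : cvg (x @ \oo).
  apply/cauchy_cvgP/cauchy_exP => e e0; have [N xN] := xC e e0.
  by exists (x N); exists N => // n /= Nn; apply: xN.
exists (limn x) => e e0; have /cvgrPdist_lt/(_ e e0)[N _ xN] := xc.
by exists N => n Nn; rewrite distrC; exact: xN.
Qed.

Lemma normc_le_ReIm (z : C) : normc z <= `|complex.Re z| + `|complex.Im z|.
Proof.
rewrite -(@ler_pXn2r _ 2) ?nnegrE ?normc_ge0 ?addr_ge0 // sqr_normcE sqrrD.
by rewrite !real_normK ?num_real // lerD2r lerDl mulrn_wge0 ?mulr_ge0.
Qed.

Lemma normRe_le (z : C) : `|complex.Re z| <= normc z.
Proof. by case: z => a b /=; rewrite -sqrtr_sqr ler_wsqrtr // lerDl sqr_ge0. Qed.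

Lemma normIm_le (z : C) : `|complex.Im z| <= normc z.
Proof. by case: z => a b /=; rewrite -sqrtr_sqr ler_wsqrtr // lerDr sqr_ge0. Qed.

Lemma cauchy_complex (x : nat -> C) :
  (forall e : R, 0 < e -> exists N : nat, forall m n : nat,
    (N <= m)%N -> (N <= n)%N -> normc (x m - x n) < e) ->
  exists l : C, forall e : R, 0 < e -> exists N : nat, forall n : nat,
    (N <= n)%N -> normc (x n - l) < e.
Proof.
move=> xC.
have [a ha] : exists l : R, forall e : R, 0 < e -> exists N : nat, forall n : nat,
    (N <= n)%N -> `|complex.Re (x n) - l| < e.
  apply: cauchy_real => e e0; have [N xN] := xC e e0; exists N => m n Nm Nn.
  by rewrite -raddfB (le_lt_trans (normRe_le _)) ?xN.
have [b hb] : exists l : R, forall e : R, 0 < e -> exists N : nat, forall n : nat,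
    (N <= n)%N -> `|complex.Im (x n) - l| < e.
  apply: cauchy_real => e e0; have [N xN] := xC e e0; exists N => m n Nm Nn.
  by rewrite -raddfB (le_lt_trans (normIm_le _)) ?xN.
exists (a +i* b)%C => e e0.
have e20 : 0 < e / 2 by rewrite divr_gt0.
have [N1 h1] := ha _ e20; have [N2 h2] := hb _ e20.
exists (maxn N1 N2) => n; rewrite geq_max => /andP[n1 n2].
rewrite (le_lt_trans (normc_le_ReIm _)) // (splitr e).
by move: (h1 n n1) (h2 n n2); case: (x n) => c d /= *; exact: ltrD.
Qed.

End blocks.

Section star_theory.
Context (A : starRingType).

Lemma star0 : star (0 : A) = 0.
Proof. by apply: (@addrI _ (star 0)); rewrite -starD !addr0. Qed.

Lemma starN (x : A) : star (- x) = - star x.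
Proof. by apply: (addIr (star x)); rewrite -starD !addNr star0. Qed.

Lemma starB (x y : A) : star (x - y) = star x - star y.
Proof. by rewrite starD starN. Qed.

Lemma star1 : star (1 : A) = 1.
Proof. by rewrite -[RHS]starK -[in RHS](mulr1 (star 1)) starM starK mulr1. Qed.

End star_theory.

(** A norm-closed unital *-subalgebra of the bounded product of matrix algebras, given by a
    predicate so that the C*-structure is built from closure properties alone. [sdim_gt0] provides 1
    != 0, and [spred_closed] is closedness in the supremum norm. *)
Record closed_subalg (R : realType) := ClosedSubalg {
  sdim : nat -> nat;
  spred : (forall m, 'M[R[i]]_(sdim m)) -> Prop;
  sdim_gt0 : (0 < sdim 0)%N;
  spred_bounded : forall a, spred a -> exists B, forall m, opnorm (a m) <= B;
  spred1 : spred (fun=> 1%:M);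
  spredD : forall a b, spred a -> spred b -> spred (fun m => a m + b m);
  spredZ : forall c a, spred a -> spred (fun m => c *: a m);
  spredM : forall a b, spred a -> spred b -> spred (fun m => a m *m b m);
  spred_star : forall a, spred a -> spred (fun m => adj (a m));
  spred_closed : forall a,
    (forall e : R, 0 < e ->
       exists2 b, spred b & forall m, opnorm (a m - b m) <= e) -> spred a
}.
Arguments spred {R} _ _.

(** * Subalgebras of products of matrix algebras *)

Section subalg.
Context (R : realType) (S : closed_subalg R).
Local Notation C := R[i].
Local Notation d := (sdim S).

Record subalg : Type := Subalg {
  slot : forall m, 'M[C]_(d m);
  slotP : spred S slot
}.
Implicit Types a b : subalg.

Lemma subalg_inj a b : (forall m, slot a m = slot b m) -> a = b.
Proof.
case: a b => [f fP] [g gP] /= fg.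
have {}fg : f = g by apply: functional_extensionality_dep.
by case: _ / fg in gP *; congr Subalg; exact: Prop_irrelevance.
Qed.

HB.instance Definition _ := gen_eqMixin subalg.
HB.instance Definition _ := gen_choiceMixin subalg.

Lemma spred0 : spred S (fun=> 0).
Proof.
have := spredZ 0 (spred1 S); congr spred.
by apply: functional_extensionality_dep => m; rewrite scale0r.
Qed.

Lemma spredN f : spred S f -> spred S (fun m => - f m).
Proof.
move=> /(spredZ (-1)); congr spred.
by apply: functional_extensionality_dep => m; rewrite scaleN1r.
Qed.

Definition sub0 := Subalg spred0.
Definition sub1 := Subalg (spred1 S).
Definition subD a b := Subalg (spredD (slotP a) (slotP b)).
Definition subN a := Subalg (spredN (slotP a)).
Definition subM a b := Subalg (spredM (slotP a) (slotP b)).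
Definition subZ c a := Subalg (spredZ c (slotP a)).
Definition substar a := Subalg (spred_star (slotP a)).

Fact subDA : associative subD.
Proof. by move=> a b c; apply: subalg_inj => m; rewrite /= addrA. Qed.
Fact subDC : commutative subD.
Proof. by move=> a b; apply: subalg_inj => m; rewrite /= addrC. Qed.
Fact sub0D : left_id sub0 subD.
Proof. by move=> a; apply: subalg_inj => m; rewrite /= add0r. Qed.
Fact subND : left_inverse sub0 subN subD.
Proof. by move=> a; apply: subalg_inj => m; rewrite /= addNr. Qed.

HB.instance Definition _ := GRing.isZmodule.Build subalg subDA subDC sub0D subND.

Fact subMA : associative subM.
Proof. by move=> a b c; apply: subalg_inj => m; rewrite /= mulmxA. Qed.
Fact sub1M : left_id sub1 subM.
Proof. by move=> a; apply: subalg_inj => m; rewrite /= mul1mx. Qed.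
Fact subM1 : right_id sub1 subM.
Proof. by move=> a; apply: subalg_inj => m; rewrite /= mulmx1. Qed.
Fact subMDl : left_distributive subM subD.
Proof. by move=> a b c; apply: subalg_inj => m; rewrite /= mulmxDl. Qed.
Fact subMDr : right_distributive subM subD.
Proof. by move=> a b c; apply: subalg_inj => m; rewrite /= mulmxDr. Qed.
Fact sub1_neq0 : sub1 != 0.
Proof.
apply/eqP => /(congr1 (fun a => slot a 0 (Ordinal (sdim_gt0 S)) (Ordinal (sdim_gt0 S)))).
by rewrite /= !mxE eqxx => /eqP; rewrite oner_eq0.
Qed.

HB.instance Definition _ := GRing.Zmodule_isNzRing.Build subalg
  subMA sub1M subM1 subMDl subMDr sub1_neq0.

Fact subZA (c e : C) a : subZ c (subZ e a) = subZ (c * e) a.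
Proof. by apply: subalg_inj => m; rewrite /= scalerA. Qed.
Fact sub1Z : left_id 1 subZ.
Proof. by move=> a; apply: subalg_inj => m; rewrite /= scale1r. Qed.
Fact subZDr : right_distributive subZ +%R.
Proof. by move=> c a b; apply: subalg_inj => m; rewrite /= scalerDr. Qed.
Fact subZDl a : {morph subZ^~ a : c e / c + e}.
Proof. by move=> c e; apply: subalg_inj => m; rewrite /= scalerDl. Qed.

HB.instance Definition _ := GRing.Zmodule_isLmodule.Build C subalg
  subZA sub1Z subZDr subZDl.

Fact subZAl (c : C) a b : c *: (a * b) = c *: a * b.
Proof. by apply: subalg_inj => m; rewrite /= scalemxAl. Qed.
Fact subZAr (c : C) a b : c *: (a * b) = a * (c *: b).
Proof. by apply: subalg_inj => m; rewrite /= scalemxAr. Qed.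

HB.instance Definition _ := GRing.Lmodule_isLalgebra.Build C subalg subZAl.
HB.instance Definition _ := GRing.Lalgebra_isAlgebra.Build C subalg subZAr.

Fact substarK : involutive substar.
Proof. by move=> a; apply: subalg_inj => m; rewrite /= adjK. Qed.
Fact substarD : {morph substar : a b / a + b}.
Proof. by move=> a b; apply: subalg_inj => m; rewrite /= raddfD. Qed.
Fact substarM a b : substar (a * b) = substar b * substar a.
Proof. by apply: subalg_inj => m; rewrite /= adjM. Qed.

HB.instance Definition _ := hasStar.Build subalg substarK substarD substarM.

Lemma slotB a b m : slot (a - b) m = slot a m - slot b m. Proof. by []. Qed.
Lemma slotM a b m : slot (a * b) m = slot a m *m slot b m. Proof. by []. Qed.
Lemma slot1 m : slot 1 m = 1%:M. Proof. by []. Qed.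
Lemma slot_star a m : slot (star a) m = adj (slot a m). Proof. by []. Qed.
Lemma slot_sum (I : Type) (r : seq I) (F : I -> subalg) m :
  slot (\sum_(i <- r) F i) m = \sum_(i <- r) slot (F i) m.
Proof. by elim/big_rec2: _ => [//|i x y _ <-]. Qed.

Definition subnorm a := sup (range (fun m => opnorm (slot a m))).

Lemma opnorm_le_subnorm a m : opnorm (slot a m) <= subnorm a.
Proof.
have [B aB] := spred_bounded (slotP a).
apply: sup_upper_bound; last by exists m.
by split; [exists (opnorm (slot a 0)); exists 0|exists B => _ [n _ <-]].
Qed.

Lemma subnorm_le a (c : R) : (forall m, opnorm (slot a m) <= c) -> subnorm a <= c.
Proof.
by move=> ac; apply: ge_sup => [|_ [m _ <-] //]; exists (opnorm (slot a 0)); exists 0.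
Qed.

Lemma subnorm_ge0 a : 0 <= subnorm a.
Proof. exact: le_trans (opnorm_ge0 _) (opnorm_le_subnorm a 0). Qed.

Fact substarZ (c : C) a : star (c *: a) = conjc c *: star a.
Proof. by apply: subalg_inj => m; rewrite /= adj_scale. Qed.

Fact ler_subnormD a b : subnorm (a + b) <= subnorm a + subnorm b.
Proof.
apply: subnorm_le => m; rewrite (le_trans (ler_opnormD _ _)) //.
by rewrite lerD // opnorm_le_subnorm.
Qed.

Fact subnormZ (c : C) a : subnorm (c *: a) = normc c * subnorm a.
Proof.
apply/eqP; rewrite eq_le; apply/andP; split.
  apply: subnorm_le => m; rewrite opnormZ ler_wpM2l ?normc_ge0 //.
  exact: opnorm_le_subnorm.
have [->|c0] := eqVneq c 0; first by rewrite [normc _]normc0 mul0r subnorm_ge0.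
have nc0 : 0 < normc c.
  by rewrite lt_def normc_ge0 andbT; apply: contra_neq c0 => /eq0_normc.
rewrite -ler_pdivlMl //; apply: subnorm_le => m.
rewrite ler_pdivlMl // -opnormZ; exact: opnorm_le_subnorm (c *: a) m.
Qed.

Fact subnorm_eq0 a : subnorm a = 0 -> a = 0.
Proof.
move=> a0; apply: subalg_inj => m; apply: opnorm_eq0.
by apply/eqP; rewrite eq_le opnorm_ge0 -a0 opnorm_le_subnorm.
Qed.

Fact ler_subnormM a b : subnorm (a * b) <= subnorm a * subnorm b.
Proof.
apply: subnorm_le => m; rewrite (le_trans (ler_opnormM _ _)) //.
by rewrite ler_pM ?opnorm_ge0 ?opnorm_le_subnorm.
Qed.

Fact subnorm_cstar a : subnorm (star a * a) = subnorm a ^+ 2.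
Proof.
apply/eqP; rewrite eq_le; apply/andP; split.
  apply: subnorm_le => m; rewrite slotM opnorm_cstar.
  by rewrite ler_pXn2r ?nnegrE ?opnorm_ge0 ?subnorm_ge0 ?opnorm_le_subnorm.
rewrite -(@ler_psqrt _ _) ?nnegrE ?sqr_ge0 ?subnorm_ge0 //.
rewrite sqrtr_sqr ger0_norm ?subnorm_ge0 //; apply: subnorm_le => m.
rewrite -(ger0_norm (opnorm_ge0 (slot a m))) -sqrtr_sqr ler_wsqrtr //.
by rewrite -opnorm_cstar; exact: opnorm_le_subnorm (star a * a) m.
Qed.

(** The limit is built entry by entry in each block. Once convergence is known to be uniform over
    the blocks, closedness puts the limit back into the subalgebra. *)
Fact subnorm_complete (u : nat -> subalg) :
  (forall e : R, 0 < e -> exists N : nat, forall m n : nat,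
    (N <= m)%N -> (N <= n)%N -> subnorm (u m - u n) < e) ->
  exists l : subalg, forall e : R, 0 < e -> exists N : nat, forall n : nat,
    (N <= n)%N -> subnorm (u n - l) < e.
Proof.
move=> uC.
have lim_ex m i j : exists l : C, forall e : R, 0 < e ->
    exists N : nat, forall n : nat, (N <= n)%N -> normc (slot (u n) m i j - l) < e.
  apply: cauchy_complex => e e0; have [N uN] := uC e e0; exists N => p q Np Nq.
  apply: le_lt_trans (uN p q Np Nq); rewrite (le_trans _ (opnorm_le_subnorm _ m)) //.
  by rewrite (le_trans _ (normc_le_opnorm _ i j)) // !mxE.
pose l m : 'M[C]_(d m) := \matrix_(i, j) sval (cid (lim_ex m i j)).
have lE m e : 0 < e -> exists N : nat, forall n : nat,
    (N <= n)%N -> opnorm (slot (u n) m - l m) <= e.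
  move=> e0; pose k := (d m * d m)%N.
  have ek0 : 0 < e / (k%:R + 1) by rewrite divr_gt0 // ltr_wpDl.
  have [N uN] : exists N : nat, forall n, (N <= n)%N -> forall i j,
      normc (slot (u n) m i j - l m i j) <= e / (k%:R + 1).
    have hN i j : exists N : nat, forall n, (N <= n)%N ->
        normc (slot (u n) m i j - l m i j) < e / (k%:R + 1).
      by rewrite mxE; exact: svalP (cid (lim_ex m i j)) _ ek0.
    pose N i j := sval (cid (hN i j)).
    exists (\max_i \max_j N i j) => n Nn i j.
    apply/ltW/(svalP (cid (hN i j))).
    apply: leq_trans Nn; rewrite (leq_trans _ (leq_bigmax i)) //.
    exact: (@leq_bigmax _ (fun j => N i j)).
  exists N => n Nn; rewrite (le_trans (opnorm_le_entries _)) //.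
  apply: (@le_trans _ _ (\sum_(i < d m) \sum_(j < d m) (e / (k%:R + 1)))).
    by do 2!(rewrite ler_sum // => ? _); rewrite mxE [(- l m) _ _]mxE uN.
  rewrite !big_const !card_ord !iter_addr_0 -mulrnA -/k.
  rewrite -[leLHS]mulr_natr mulrAC ler_pdivrMr; last by rewrite ltr_wpDl.
  by rewrite ler_wpM2l ?(ltW e0) // lerDl.
have uNl e : 0 < e -> exists N : nat, forall n : nat, (N <= n)%N ->
    forall m, opnorm (slot (u n) m - l m) <= e.
  move=> e0; have [N uN] := uC _ e0; exists N => n Nn m.
  apply/ler_addgt0Pr => e' e'0; have [N' lN] := lE m _ e'0.
  (* [p] depends on the block [m], but it disappears from the resulting bound on [u n], whose index
     [N] does not. *)
  pose p := maxn N N'.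
  rewrite -(subrKA (slot (u p) m)) (le_trans (ler_opnormD _ _)) // lerD //.
    apply: le_trans (ltW (uN n p Nn (leq_maxl _ _))).
    exact: opnorm_le_subnorm (u n - u p) m.
  exact/lN/leq_maxr.
have lP : spred S l.
  apply: spred_closed => e e0; have [N uN] := uNl _ e0.
  exists (slot (u N)); first exact: slotP.
  by move=> m; rewrite opnorm_distC uN.
exists (Subalg lP) => e e0.
have [N uN] := uNl _ (divr_gt0 e0 (ltr0n _ 2)); exists N => n Nn.
apply: le_lt_trans (_ : e / 2 < e); last by rewrite ltr_pdivrMr // ltr_pMr // ltr1n.
by apply: subnorm_le => m; rewrite slotB uN.
Qed.

HB.instance Definition _ := isCStarAlgebra.Build R subalg substarZ
  ler_subnormD subnormZ subnorm_eq0 subnorm_complete ler_subnormM subnorm_cstar.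

(** * Matrices over the subalgebra: square roots and positivity *)

Section matrices.
Context (k : nat).
Implicit Types X Y : 'M[subalg]_k.

Definition mcoord m X : 'M[C]_(\sum_(i < k) d m) :=
  flat (map_mx (fun a => slot a m) X).

Lemma mcoordD m X Y : mcoord m (X + Y) = mcoord m X + mcoord m Y.
Proof. by rewrite -flatD; congr flat; apply/matrixP => i j; rewrite !mxE. Qed.

Lemma mcoordB m X Y : mcoord m (X - Y) = mcoord m X - mcoord m Y.
Proof. by rewrite -flatB; congr flat; apply/matrixP => i j; rewrite !mxE. Qed.

Lemma mcoordM m X Y : mcoord m (X * Y) = mcoord m X *m mcoord m Y.
Proof.
rewrite -flatM; congr flat; apply/matrixP => i j; rewrite !mxE slot_sum.
by apply: eq_bigr => l _; rewrite !mxE.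
Qed.

Lemma mcoord1 m : mcoord m 1 = 1%:M.
Proof.
rewrite -flat1; congr flat; apply/matrixP => i j; rewrite !mxE.
by case: eqP.
Qed.

Lemma mcoord_star m X : mcoord m (star X) = adj (mcoord m X).
Proof. by rewrite -flat_star; congr flat; apply/matrixP => i j; rewrite !mxE. Qed.

Lemma mcoord_inj X Y : (forall m, mcoord m X = mcoord m Y) -> X = Y.
Proof.
move=> XY; apply/matrixP => i j; apply: subalg_inj => m.
by have /flat_inj/matrixP/(_ i j) := XY m; rewrite !mxE.
Qed.


Definition mscale (c : C) X : 'M[subalg]_k := map_mx ( *:%R c) X.

Lemma mcoord_scale m c X : mcoord m (mscale c X) = c *: mcoord m X.
Proof. by apply/matrixP => i j; rewrite !mxE /= ?mxE. Qed.

Lemma mcoord0 m : mcoord m 0 = 0.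
Proof. by have := mcoordB m 0 0; rewrite !subrr. Qed.

(** Takes the place of an inequality between C*-norms on M_k(A), where no norm is defined. *)
Definition mbounded X (c : R) := forall m, opnorm (mcoord m X) <= c.

Lemma mbounded0 : mbounded 0 0.
Proof. by move=> m; rewrite mcoord0 opnorm0. Qed.


Lemma mbounded_ex X : exists2 B, 0 <= B & mbounded X B.
Proof.
exists (\sum_i \sum_j cnorm (X i j)) => [|m].
  by do 2!(rewrite sumr_ge0 // => ? _); exact: cnorm_ge0.
rewrite (le_trans (opnorm_flat _)) //; do 2!(rewrite ler_sum // => ? _).
by rewrite mxE opnorm_le_subnorm.
Qed.

Lemma mboundedD X Y c e : mbounded X c -> mbounded Y e -> mbounded (X + Y) (c + e).
Proof.
by move=> Xc Ye m; rewrite mcoordD (le_trans (ler_opnormD _ _)) // lerD.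
Qed.

Lemma mboundedM X Y c e : mbounded X c -> mbounded Y e -> mbounded (X * Y) (c * e).
Proof.
move=> Xc Ye m; rewrite mcoordM (le_trans (ler_opnormM _ _)) //.
by rewrite ler_pM ?opnorm_ge0.
Qed.

Lemma mbounded_scale X c (s : R) :
  0 <= s -> mbounded X c -> mbounded (mscale s%:C%C X) (s * c).
Proof.
move=> s0 Xc m; rewrite mcoord_scale opnormZ normc_real ger0_norm //.
by rewrite ler_wpM2l.
Qed.

Lemma mbounded_eq X Y : (forall e, 0 < e -> mbounded (X - Y) e) -> X = Y.
Proof.
move=> XY; apply: mcoord_inj => m; apply/eqP; rewrite -subr_eq0 -mcoordB.
apply/eqP/opnorm_eq0/eqP; rewrite eq_le opnorm_ge0 andbT.
by apply/ler_addgt0Pr => e e0; rewrite add0r XY.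
Qed.

Lemma mscaleMl c X Y : mscale c (X * Y) = mscale c X * Y.
Proof. by apply: mcoord_inj => m; rewrite !(mcoord_scale, mcoordM) scalemxAl. Qed.

Lemma mscaleMr c X Y : mscale c (X * Y) = X * mscale c Y.
Proof. by apply: mcoord_inj => m; rewrite !(mcoord_scale, mcoordM) scalemxAr. Qed.

Lemma star_mscale c X : star (mscale c X) = mscale (conjc c) (star X).
Proof.
by apply: mcoord_inj => m; rewrite !(mcoord_star, mcoord_scale) adj_scale.
Qed.

Definition mconv (y : nat -> 'M[subalg]_k) Y :=
  forall e : R, 0 < e -> exists N : nat, forall n, (N <= n)%N -> mbounded (y n - Y) e.

Lemma mconv_unique y Y Z : mconv y Y -> mconv y Z -> Y = Z.
Proof.
move=> yY yZ; apply: mbounded_eq => e e0.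
have [N1 h1] := yY _ (divr_gt0 e0 (ltr0n _ 2)).
have [N2 h2] := yZ _ (divr_gt0 e0 (ltr0n _ 2)).
pose n := maxn N1 N2 => m; rewrite -(subrKA (y n)) mcoordD (splitr e).
rewrite (le_trans (ler_opnormD _ _)) // lerD //; last exact/h2/leq_maxr.
by rewrite mcoordB opnorm_distC -mcoordB; apply/h1/leq_maxl.
Qed.

Lemma mconv_shift y Y : mconv y Y -> mconv (fun n => y n.+1) Y.
Proof.
by move=> yY e e0; have [N h] := yY e e0; exists N => n Nn; apply/h/leqW.
Qed.

Lemma mconv_star y Y : mconv y Y -> mconv (fun n => star (y n)) (star Y).
Proof.
move=> yY e e0; have [N h] := yY e e0; exists N => n Nn m.
rewrite mcoordB !mcoord_star -raddfB opnorm_adj -mcoordB; exact: h.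
Qed.

Lemma mconv_mull X y Y : mconv y Y -> mconv (fun n => X * y n) (X * Y).
Proof.
move=> yY e e0; have [B B0 XB] := mbounded_ex X.
have [N h] := yY _ (divr_gt0 e0 (ltr_wpDl B0 ltr01)); exists N => n Nn m.
rewrite -mulrBr (le_trans (mboundedM XB (h n Nn) m)) //.
by rewrite mulrCA ger_pMr // ler_pdivrMr ?ltr_wpDl // mul1r lerDl.
Qed.

Lemma mconv_mulr X y Y : mconv y Y -> mconv (fun n => y n * X) (Y * X).
Proof.
move=> /mconv_star/(mconv_mull (star X))/mconv_star.
by rewrite -starM starK => + e e0 => /(_ e e0)[N h]; exists N => n /h;
  rewrite -starM starK.
Qed.

Lemma mconv_sqr_affine (s : R) X y Y : 0 <= s -> (forall n, mbounded (y n) 1) ->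
  mconv y Y -> mconv (fun n => mscale s%:C%C (X + y n * y n)) (mscale s%:C%C (X + Y * Y)).
Proof.
move=> s0 y1 yY e e0; have [B B0 YB] := mbounded_ex Y.
have BB : 0 < s * (B + 1) + 1 by rewrite ltr_wpDl // mulr_ge0 // addr_ge0.
have [N h] := yY _ (divr_gt0 e0 BB); exists N => n Nn m.
have -> : mscale s%:C%C (X + y n * y n) - mscale s%:C%C (X + Y * Y) =
    mscale s%:C%C ((y n - Y) * y n + Y * (y n - Y)).
  apply: mcoord_inj => p.
  rewrite !(mcoordB, mcoord_scale, mcoordD, mcoordM) -scalerBr; congr (_ *: _).
  by rewrite mulmxBl mulmxBr subrKA opprD addrACA subrr add0r.
apply: le_trans (mbounded_scale s0 (mboundedD (mboundedM (h n Nn) (y1 n))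
  (mboundedM YB (h n Nn))) m) _.
rewrite mulr1 -[X in X + _]mul1r -mulrDl mulrA mulrCA ger_pMr //.
by rewrite ler_pdivrMr // mul1r (addrC 1) lerDl.
Qed.

(** The scalar sequence [u] majorizes the increments, so its Cauchy property passes to every entry;
    finitely many convergent entries give convergence of the matrix. *)
Lemma mconv_ex (y : nat -> 'M[subalg]_k) (u : nat -> R) :
  (forall e, 0 < e -> exists N : nat, forall p q,
     (N <= p)%N -> (p <= q)%N -> u q - u p < e) ->
  (forall p q, (p <= q)%N -> mbounded (y q - y p) (u q - u p)) ->
  exists Y, mconv y Y.
Proof.
move=> uC yu.
have ex_lim i j : exists l : subalg, forall e : R, 0 < e ->
    exists N : nat, forall n : nat, (N <= n)%N -> cnorm (y n i j - l) < e.
  apply: cnorm_complete => e e0; have [N uN] := uC e e0; exists N => p q Np Nq.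
  wlog pq : p q Np Nq / (q <= p)%N.
    move=> h; have [qp|/ltnW pq] := leqP q p; first exact: h.
    by rewrite cnorm_distC h.
  rewrite (le_lt_trans _ (uN q p Nq pq)) //; apply: subnorm_le => m.
  have := opnorm_entry (map_mx (fun a => slot a m) (y p - y q)) i j.
  by rewrite !mxE => /le_trans; apply; exact: yu.
pose Y : 'M[subalg]_k := \matrix_(i, j) sval (cid (ex_lim i j)).
exists Y => e e0; pose c : R := (k * k)%:R + 1.
have c0 : 0 < c by rewrite ltr_wpDl.
have hN i j : exists N : nat, forall n, (N <= n)%N -> cnorm (y n i j - Y i j) < e / c.
  by rewrite mxE; exact: svalP (cid (ex_lim i j)) _ (divr_gt0 e0 c0).
pose N i j := sval (cid (hN i j)).
exists (\max_i \max_j N i j) => n Nn m.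
rewrite (le_trans (opnorm_flat _)) //.
apply: (@le_trans _ _ (\sum_(i < k) \sum_(j < k) (e / c))).
  rewrite ler_sum // => i _; rewrite ler_sum // => j _.
  rewrite mxE [in leLHS]mxE [(- Y) _ _]mxE (le_trans (opnorm_le_subnorm _ _)) // ltW //.
  apply/(svalP (cid (hN i j))).
  apply: leq_trans Nn; rewrite (leq_trans _ (leq_bigmax i)) //.
  exact: (@leq_bigmax _ (fun j => N i j)).
rewrite !big_const !card_ord !iter_addr_0 -mulrnA.
rewrite -[leLHS]mulr_natr mulrAC ler_pdivrMr //.
by rewrite ler_wpM2l ?(ltW e0) // lerDl.
Qed.

(* [1 - sqrt (1 - X)] is the limit of [y_(n+1) = (X + y_n^2) / 2]; the increments
   are dominated by those of the scalar recursion started at [X = 1]. *)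
Lemma msqrt X : mbounded X 1 -> star X = X ->
  exists Z, [/\ star Z = Z, Z * Z = 1 - X &
    forall W, W * X = X * W -> W * Z = Z * W].
Proof.
move=> X1 sX; pose h (Y : 'M[subalg]_k) := mscale (2^-1)%:C%C (X + Y * Y).
pose y n := iter n h 0; pose u n := iter n (fun t : R => (1 + t ^+ 2) / 2) 0.
have u_itv n : 0 <= u n <= 1.
  elim: n => [|n /andP[u0 u1]]; first by rewrite lexx ler01.
  by rewrite /u /= -/(u n); apply/andP; split; nra.
have u_incr n : u n <= u n.+1.
  by rewrite [u n.+1]/= -/(u n); have := sqr_ge0 (1 - u n); nra.
have u_nd p q : (p <= q)%N -> u p <= u q by exact/(homo_leq lexx le_trans).
have commy W n : W * X = X * W -> W * y n = y n * W.
  move=> WX; elim: n => [|n IHn]; first by rewrite mulr0 mul0r.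
  rewrite /y /= -/(y n) /h -mscaleMl -mscaleMr mulrDl mulrDr WX.
  by rewrite mulrA IHn -mulrA IHn mulrA.
have yy p q : y p * y q = y q * y p by apply/commy/esym/commy.
have half0 : 0 <= 2^-1 :> R by rewrite invr_ge0.
have y1 n : mbounded (y n) (u n).
  elim: n => [|n IHn].
    exact: mbounded0.
  move=> m; rewrite [u n.+1]/= -/(u n) mulrC expr2.
  exact: (mbounded_scale half0 (mboundedD X1 (mboundedM IHn IHn))).
have dy n : mbounded (y n.+1 - y n) (u n.+1 - u n).
  elim: n => [|n IHn].
    move=> m; have -> : u 1%N - u 0%N = 2^-1 * (1 + 0 * 0).
      by rewrite /u /= subr0 expr2 mulrC.
    rewrite subr0 [y 1%N]/(h 0) /h; apply: mbounded_scale => // p.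
    by rewrite mulr0 mul0r !addr0.
  (* The iterates are polynomials in [X], hence commute, and the difference of squares factors
     exactly as in the scalar recursion. *)
  have -> : y n.+2 - y n.+1 = mscale (2^-1)%:C%C ((y n.+1 - y n) * (y n.+1 + y n)).
    have -> : (y n.+1 - y n) * (y n.+1 + y n) = y n.+1 * y n.+1 - y n * y n.
      by rewrite mulrBl !mulrDr (yy n.+1 n) opprD addrA addrK.
    apply: mcoord_inj => p; rewrite [y n.+2]/(h (y n.+1)) [y n.+1 in X in _ - X]/(h (y n)).
    rewrite !(mcoordB, mcoord_scale, mcoordD) -scalerBr; congr (_ *: _).
    by rewrite opprD addrACA subrr add0r.
  have -> : u n.+2 - u n.+1 = 2^-1 * ((u n.+1 - u n) * (u n.+1 + u n)).
    by rewrite -subr_sqr /u /= -/(u n); field.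
  by apply: mbounded_scale => //; apply: mboundedM => //; exact: mboundedD.
have dypq p q : (p <= q)%N -> mbounded (y q - y p) (u q - u p).
  elim: q => [|q IHq]; first by rewrite leqn0 => /eqP ->; rewrite !subrr; exact: mbounded0.
  rewrite leq_eqVlt => /predU1P[->|pq] m.
    by rewrite !subrr mcoord0 opnorm0.
  by rewrite -(subrKA (y q)) -(subrKA (u q)); exact: (mboundedD (dy q) (IHq pq) m).
have uC e : 0 < e -> exists N : nat, forall p q,
    (N <= p)%N -> (p <= q)%N -> u q - u p < e.
  move=> e0; have ul : cvgn u.
    apply: nondecreasing_is_cvgn; first exact/nondecreasing_seqP.
    by exists 1 => _ [n _ <-]; case/andP: (u_itv n).
  have /cvgrPdist_lt/(_ _ (divr_gt0 e0 (ltr0n _ 2)))[N _ uN] := ul.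
  exists N => p q Np pq; have := uN p Np; have := uN q (leq_trans Np pq) => /=.
  rewrite !ltr_norml => /andP[q1 q2] /andP[p1 p2].
  lra.
have [Y yY] := mconv_ex uC dypq.
have y1' n : mbounded (y n) 1 by move=> m; apply: le_trans (y1 n m) _; case/andP: (u_itv n).
have YE : Y = h Y := mconv_unique (mconv_shift yY) (mconv_sqr_affine X half0 y1' yY).
have sy n : star (y n) = y n.
  elim: n => [|n IHn].
    by apply: mcoord_inj => m; rewrite mcoord_star mcoord0 raddf0.
  rewrite [y n.+1]/(h (y n)) /h star_mscale starD starM IHn sX.
  by rewrite conjc_real.
have sY : star Y = Y.
  apply: (mconv_unique _ yY) => e e0; have [N yN] := mconv_star yY e0.
  by exists N => n /yN; rewrite sy.
exists (1 - Y); split.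
- by rewrite starB star1 sY.
(* The fixed point equation 2Y = X + Y^2 is (1 - Y)^2 = 1 - X. *)
- have : Y + Y = X + Y * Y.
    rewrite [in LHS]YE; apply: mcoord_inj => m.
    rewrite mcoordD mcoord_scale -scalerDl -raddfD /=.
    by rewrite -[2^-1]mul1r -splitr scale1r.
  move=> YY; rewrite mulrBl !mulrBr !mul1r mulr1 opprB addrA addrAC -addrA.
  by rewrite -addrA; congr (_ + _); rewrite addrA -opprD YY opprD addrNK.
- move=> W WX; rewrite mulrBl mulrBr mulr1 mul1r; congr (_ - _).
  apply: (mconv_unique (mconv_mull W yY)) => e e0.
  have [N yN] := mconv_mulr W yY e0.
  by exists N => n /yN; rewrite commy.
Qed.

(** Roots taken separately in each block need not form an element of the algebra. After scaling to 0
    <= Q <= 1, the root of Q = 1 - (1 - Q) comes from [msqrt], whose iteration stays in M_k(A). *)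
Lemma star_positive_mcoord X : star X = X ->
  (forall m v, 0 <= rdot (mcoord m X *m v) v) -> star_positive X.
Proof.
move=> sX X0; have [B' B'0 XB'] := mbounded_ex X.
pose B := B' + 1; have B0 : 0 < B by rewrite ltr_wpDl.
have XB m : opnorm (mcoord m X) <= B by rewrite (le_trans (XB' m)) // lerDl.
pose Q := mscale (B^-1)%:C%C X.
have sQ : star Q = Q by rewrite star_mscale sX conjc_real.
have [||Z [sZ ZZ _]] := @msqrt (1 - Q).
- move=> m; rewrite mcoordB mcoord1; set T := mcoord m Q.
  have T0 v : 0 <= rdot (T *m v) v.
    by rewrite /T mcoord_scale -scalemxAl rdotZl mulr_ge0 ?invr_ge0 // ltW.
  have T1 v : l2norm (T *m v) <= l2norm v.
    rewrite (le_trans (l2norm_mulmx _ _)) // ler_piMl ?l2norm_ge0 //.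
    rewrite /T mcoord_scale opnormZ normc_real ger0_norm ?invr_ge0 ?(ltW B0) //.
    by rewrite ler_pdivrMl // mulr1.
  have sT : adj T = T by rewrite -mcoord_star sQ.
  (* Positivity at [v - T *m v] gives 2|Tv|^2 <= <Tv, v> + <TTv, Tv>, and the last term is at most
     |Tv|^2. Then |v - Tv|^2 <= |v|^2 - <Tv, v>. *)
  have TT v : l2norm (T *m v) ^+ 2 <= rdot (T *m v) v.
    have TTv : rdot (T *m (T *m v)) v = l2norm (T *m v) ^+ 2.
      by rewrite rdot_adj sT rdotvv.
    have := T0 (v - T *m v); rewrite mulmxBr rdotDl !rdotDr !rdotNl !rdotNr.
    rewrite TTv rdotvv.
    have := rdot_le (T *m (T *m v)) (T *m v).
    have := T1 (T *m v); have := l2norm_ge0 (T *m v).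
    set a := l2norm (T *m v); set b := l2norm (T *m (T *m v)).
    set r := rdot (T *m (T *m v)) (T *m v) => a0 ba rba.
    have : r <= a ^+ 2 by rewrite (le_trans rba) // expr2 ler_wpM2r.
    lra.
  apply: opnorm_le => // v; rewrite mul1r.
  rewrite -(@ler_pXn2r _ 2) ?nnegrE ?l2norm_ge0 // -!rdotvv mulmxBl mul1mx.
  rewrite rdotDl !rdotDr !rdotNl !rdotNr (rdotC v (T *m v)).
  by have := TT v; have := T0 v; rewrite -rdotvv; lra.
- by rewrite starB star1 sQ.
exists (mscale (Num.sqrt B)%:C%C Z); rewrite star_mscale conjc_real sZ.
rewrite -mscaleMl -mscaleMr ZZ; apply: mcoord_inj => m.
rewrite !mcoord_scale !mcoordB mcoord_scale opprB addrC subrK !scalerA.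
rewrite -!rmorphM /= -expr2 sqr_sqrtr ?(ltW B0) //.
by rewrite mulfV ?gt_eqF // scale1r.
Qed.

End matrices.

(** In each block a one-sided inverse of a square matrix is two-sided. *)
Lemma stably_finite_subalg : stably_finite subalg.
Proof.
move=> n v vv; apply: mcoord_inj => m.
by rewrite mcoordM mcoord1; apply: mulmx1C; rewrite -mcoordM vv mcoord1.
Qed.

End subalg.

(** * Operators on truncated Fock spaces *)

Section words.
Context (R : realType).
Local Notation C := R[i].
Local Notation W m := (bseq_of m bool).

Section operators.
Context (I J K : finType).

Definition opmx (I J : finType) (k : I -> J -> C) : 'M[C]_(#|I|, #|J|) :=
  \matrix_(i, j) k (enum_val i) (enum_val j).

Lemma opmxE (k : I -> J -> C) u v : opmx k (enum_rank u) (enum_rank v) = k u v.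
Proof. by rewrite mxE !enum_rankK. Qed.

Lemma opmxP (M N : 'M[C]_(#|I|, #|J|)) :
  (forall u v, M (enum_rank u) (enum_rank v) = N (enum_rank u) (enum_rank v)) -> M = N.
Proof.
by move=> MN; apply/matrixP => i j; rewrite -(enum_valK i) -(enum_valK j) MN.
Qed.

Lemma mulmx_enum (M : 'M[C]_(#|I|, #|J|)) (N : 'M[C]_(#|J|, #|K|)) i k :
  (M *m N) i k = \sum_(v : J) M i (enum_rank v) * N (enum_rank v) k.
Proof.
rewrite mxE [RHS](reindex (fun j : 'I_#|J| => enum_val j)) /=.
  by apply: eq_bigr => j _; rewrite enum_valK.
by exists enum_rank => ? _; rewrite ?enum_valK ?enum_rankK.
Qed.

Lemma eq_opmx (k l : I -> J -> C) : (forall u v, k u v = l u v) -> opmx k = opmx l.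
Proof. by move=> kl; apply/matrixP => i j; rewrite !mxE. Qed.

End operators.

Lemma sum_opmx (I : finType) (F : 'I_#|I| -> R) :
  \sum_i F i = \sum_(v : I) F (enum_rank v).
Proof.
rewrite [RHS](reindex (fun j : 'I_#|I| => enum_val j)) /=.
  by apply: eq_bigr => j _; rewrite enum_valK.
by exists enum_rank => ? _; rewrite ?enum_valK ?enum_rankK.
Qed.

Lemma sum_bseq1 (V : pzRingType) m (s : seq bool) (F : seq bool -> V) :
  \sum_(u : W m) (val u == s)%:R * F u = if (size s <= m)%N then F s else 0.
Proof.
case: leqP => sm.
  rewrite (bigD1 (Bseq sm)) //= eqxx mul1r big1 ?addr0 // => u us.
  by rewrite -(inj_eq val_inj) /= in us; rewrite (negPf us) mul0r.
rewrite big1 // => u _; case: eqP => [us|]; last by rewrite mul0r.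
by have := size_bseq u; rewrite us leqNgt sm.
Qed.

(* The kernel of the operator [\sum_w c w e_(al w, be w)] on words. *)
Definition band (al be : seq bool) (c : seq bool -> C) (u v : seq bool) : C :=
  if (u == al ++ drop (size al) u) && (v == be ++ drop (size al) u)
  then c (drop (size al) u) else 0.

Lemma band_cat al be c w v : band al be c (al ++ w) v = (v == be ++ w)%:R * c w.
Proof.
by rewrite /band drop_size_cat // eqxx /=; case: eqP; rewrite ?mul1r ?mul0r.
Qed.

Variant band_spec (al be : seq bool) (c : seq bool -> C) (u v : seq bool) : C -> Prop :=
| BandIn w of u = al ++ w & v = be ++ w : band_spec al be c u v (c w)
| BandOut of (forall w, ~ (u = al ++ w /\ v = be ++ w)) : band_spec al be c u v 0.

Lemma bandP al be c u v : band_spec al be c u v (band al be c u v).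
Proof.
rewrite /band; case: andP => [[/eqP uE /eqP vE]|uv]; first exact: BandIn.
apply: BandOut => w [uE vE]; apply: uv; by rewrite uE vE drop_size_cat // !eqxx.
Qed.

Definition bandmx m al be c : 'M[C]_#|{: W m}| :=
  opmx (fun u v : W m => band al be c u v).

Lemma bandC al be c u v : band al be c u v = band be al c v u.
Proof.
case: bandP => [w -> ->|uv]; first by rewrite band_cat eqxx mul1r.
by case: bandP => // w vE uE; case: (uv w).
Qed.


Lemma adj_bandmx m al be c :
  adj (bandmx m al be c) = bandmx m be al (fun w => conjc (c w)).
Proof.
apply/matrixP => i j; rewrite !mxE bandC.
case: bandP => [w -> ->|uv]; first by rewrite band_cat eqxx mul1r.
by rewrite conjc0; case: bandP => // w uE vE; case: (uv w).
Qed.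

Lemma bandmxD m al be c e :
  bandmx m al be c + bandmx m al be e = bandmx m al be (fun w => c w + e w).
Proof. by apply/matrixP => i j; rewrite !mxE /band; case: ifP; rewrite ?addr0. Qed.

Lemma bandmxB m al be c e :
  bandmx m al be c - bandmx m al be e = bandmx m al be (fun w => c w - e w).
Proof. by apply/matrixP => i j; rewrite !mxE /band; case: ifP; rewrite ?subr0. Qed.

Lemma bandmx1 m : bandmx m [::] [::] (fun=> 1) = 1%:M.
Proof.
apply: opmxP => u v; rewrite opmxE mxE (inj_eq enum_rank_inj).
rewrite -[val u]cat0s band_cat mulr1 /= -(inj_eq val_inj) /=.
by rewrite eq_sym.
Qed.

Lemma eq_bandmx m al be c e :
  (forall w, (size al + size w <= m)%N -> (size be + size w <= m)%N -> c w = e w) ->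
  bandmx m al be c = bandmx m al be e.
Proof.
move=> ce; apply: eq_opmx => u v.
case: bandP => [w uE vE|uv].
  by rewrite uE vE band_cat eqxx mul1r ce // -size_cat -?uE -?vE size_bseq.
by case: bandP => // w uE vE; case: (uv w).
Qed.

(** A band has at most one nonzero entry in each row and in each column, so the Schur test returns
    the largest coefficient. Columns are treated as rows of the adjoint. *)
Lemma opnorm_bandmx m al be c (B : R) : 0 <= B ->
  (forall w, (size al + size w <= m)%N -> (size be + size w <= m)%N ->
     normc (c w) <= B) ->
  opnorm (bandmx m al be c) <= B.
Proof.
move=> B0 cB.
have row_le ga de e : (forall w, (size ga + size w <= m)%N ->
    (size de + size w <= m)%N -> normc (e w) <= B) ->
    forall i, \sum_j normc (bandmx m ga de e i j) <= B.
  move=> eB i; rewrite -(enum_valK i) sum_opmx; set u := enum_val i.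
  under eq_bigr do rewrite opmxE.
  have [[w uE]|uN] := pselect (exists w, u = ga ++ w :> seq bool).
    rewrite uE.
    have -> : \sum_(v : W m) normc (band ga de e (ga ++ w) v) =
        \sum_(v : W m) (val v == de ++ w)%:R * normc (e w).
      apply: eq_bigr => v _; rewrite band_cat; case: eqP => _.
        by rewrite !mul1r.
      by rewrite !mul0r [normc _]normc0.
    rewrite (@sum_bseq1 _ m (de ++ w) (fun=> normc (e w))); case: ifP => // sm.
    by apply: eB; rewrite -size_cat // -uE size_bseq.
  rewrite big1 // => v _; case: bandP => [w uE|_]; last by rewrite [normc _]normc0.
  by case: uN; exists w.
apply: opnorm_le_schur => //; first exact: row_le.
move=> j; have := @row_le be al (fun w => conjc (c w)) _ j.
rewrite -adj_bandmx => h; apply: le_trans (h _).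
  by apply: ler_sum => i _; rewrite [adj _ _ _]mxE normc_conj.
by move=> w ? ?; rewrite normc_conj cB.
Qed.

(** The intermediate word is be ++ ga ++ w. If it is longer than [m], truncation kills the term even
    when both outer words fit, so [e] has to vanish there. *)
Lemma bandmx_mul m al be ga de c e :
  (forall w, (m < size be + size (ga ++ w))%N -> e w = 0) ->
  bandmx m al be c *m bandmx m (be ++ ga) de e =
  bandmx m (al ++ ga) de (fun w => c (ga ++ w) * e w).
Proof.
move=> e0; apply: opmxP => u v; rewrite mulmx_enum opmxE.
under eq_bigr do rewrite !opmxE.
have [[w uE]|uN] := pselect (exists w, u = al ++ w :> seq bool); last first.
  rewrite big1 => [|x _]; last first.
    by case: bandP => [w uE|_]; rewrite ?mul0r //; case: uN; exists w.
  case: bandP => // w uE; case: uN; exists (ga ++ w).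
  by rewrite catA.
rewrite uE; under eq_bigr do rewrite band_cat -mulrA.
rewrite (@sum_bseq1 _ m (be ++ w) (fun x => c w * band (be ++ ga) de e x v)).
case: bandP => [z|uv].
  rewrite -catA => /eqP; rewrite eqseq_cat // eqxx /= => /eqP -> ->.
  rewrite (catA al) band_cat eqxx mul1r; case: leqP => //.
  by rewrite size_cat => /e0 ->; rewrite mulr0.
rewrite mulr0 if_same; case: bandP => // z.
rewrite -catA => /eqP; rewrite eqseq_cat // eqxx /= => /eqP wE vE.
by case: (uv z); rewrite wE -catA vE.
Qed.

Lemma bandmx_mulr m al be ga de c e :
  (forall w, (m < size ga + size (be ++ w))%N -> c w = 0) ->
  bandmx m al (ga ++ be) c *m bandmx m ga de e =
  bandmx m al (de ++ be) (fun w => c w * e (be ++ w)).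
Proof.
move=> c0; rewrite -[LHS]adjK adjM !adj_bandmx bandmx_mul; last first.
  by move=> w /c0 ->; rewrite conjc0.
rewrite adj_bandmx; apply: eq_bandmx => w _ _.
by rewrite rmorphM /= !conjcK mulrC.
Qed.

(** Two prefixes of one intermediate word are comparable. *)
Lemma bandmx_mul0 m al be ga de c e : ~~ prefix be ga -> ~~ prefix ga be ->
  bandmx m al be c *m bandmx m ga de e = 0.
Proof.
move=> bg gb; apply: opmxP => u v; rewrite mulmx_enum mxE big1 // => x _.
rewrite !opmxE; case: bandP => [w _ xE|]; last by rewrite mul0r.
case: bandP => [z xE' _|]; last by rewrite mulr0.
have /orP[] : prefix be ga || prefix ga be.
  have : prefix be x by rewrite xE prefix_prefix.
  have : prefix ga x by rewrite xE' prefix_prefix.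
  rewrite !prefixE => /eqP gE /eqP bE.
  have /orP[sbg|sgb] := leq_total (size be) (size ga).
    by rewrite -gE take_takel // bE eqxx.
  by rewrite -bE take_takel // gE eqxx orbT.
- by rewrite (negPf bg).
- by rewrite (negPf gb).
Qed.

(** * Symbolic sequences and their asymptotic closure *)

Definition ucb (f : R -> R) : Prop :=
  (exists B, forall t, `|f t| <= B) /\
  forall e, 0 < e -> exists2 r, 0 < r & forall s t, `|s - t| < r -> `|f s - f t| < e.

Definition interior_supp (f : R -> R) : Prop :=
  exists2 r, 0 < r & forall t, (t <= r) || (1 - r <= t) -> f t = 0.

Lemma ucbM f g : ucb f -> ucb g -> ucb (fun t => f t * g t).
Proof.
move=> [[B fB] fc] [[D gD] gc]; split.
  by exists (B * D) => t; rewrite normrM ler_pM.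
move=> e e0.
have B0 : 0 <= B by apply: le_trans (fB 0).
have D0 : 0 <= D by apply: le_trans (gD 0).
have BD : 0 < B + D + 1 by rewrite ltr_wpDl // addr_ge0.
have [r r0 fr] := fc _ (divr_gt0 e0 BD).
have [q q0 gq] := gc _ (divr_gt0 e0 BD).
exists (Num.min r q); first by rewrite lt_min r0.
move=> s t; rewrite lt_min => /andP[/fr fst /gq gst].
have -> : f s * g s - f t * g t = f s * (g s - g t) + (f s - f t) * g t by ring.
rewrite (le_lt_trans (ler_normD _ _)) // !normrM.
apply: (@le_lt_trans _ _ (B * (e / (B + D + 1)) + (e / (B + D + 1)) * D)).
  by rewrite lerD // ler_pM // ltW.
rewrite [X in X + _]mulrC -mulrDr mulrAC ltr_pdivrMr // ltr_pM2l //.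
by rewrite ltrDl.
Qed.

Lemma interior_suppMl f g : interior_supp f -> interior_supp (fun t => f t * g t).
Proof. by move=> [r r0 fr]; exists r => // t /fr ->; rewrite mul0r. Qed.

Definition level (m : nat) (f : R -> R) (w : seq bool) : C :=
  (f ((size w)%:R / m%:R))%:C%C.

(** Linear combinations as an inductive predicate, so that closure properties go by induction. The
    coefficient is read at the length of the common tail [w], not of al w; asymptotically this makes
    no difference. *)
Inductive symbolic : (forall m, 'M[C]_#|{: W m}|) -> Prop :=
| Symbolic1 : symbolic (fun=> 1%:M)
| SymbolicBand al be f : ucb f -> interior_supp f ->
    symbolic (fun m => bandmx m al be (level m f))
| SymbolicD s t : symbolic s -> symbolic t -> symbolic (fun m => s m + t m)
| SymbolicZ c s : symbolic s -> symbolic (fun m => c *: s m).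

Definition asymp (a b : forall m, 'M[C]_#|{: W m}|) (e : R) :=
  exists N : nat, forall m, (N <= m)%N -> opnorm (a m - b m) <= e.

Definition bounded_seq (a : forall m, 'M[C]_#|{: W m}|) :=
  exists B : R, forall m, opnorm (a m) <= B.

(** Apart from boundedness only the tail of the sequence is constrained, so every null sequence
    belongs. This absorbs the errors of products of bands, which are symbolic only
    asymptotically. *)
Definition approximable (a : forall m, 'M[C]_#|{: W m}|) :=
  bounded_seq a /\ forall e, 0 < e -> exists2 s, symbolic s & asymp a s e.

Lemma symbolic_bounded s : symbolic s -> bounded_seq s.
Proof.
elim=> [|al be f [[B fB] _] _|{}s t _ [B sB] _ [D tD]|c {}s _ [B sB]].
- by exists 1 => m; exact: opnorm1_le.
- exists B => m; apply: opnorm_bandmx => [|w _ _]; first exact: le_trans (fB 0).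
  by rewrite normc_real fB.
- by exists (B + D) => m; rewrite (le_trans (ler_opnormD _ _)) // lerD.
- by exists (normc c * B) => m; rewrite opnormZ ler_wpM2l ?normc_ge0.
Qed.

Lemma symbolic_approx s : symbolic s -> approximable s.
Proof.
move=> ss; split=> [|e e0]; first exact: symbolic_bounded.
by exists s => //; exists 0%N => m _; rewrite subrr opnorm0 ltW.
Qed.

Lemma approxD a b : approximable a -> approximable b -> approximable (fun m => a m + b m).
Proof.
move=> [[B aB] ha] [[D bD] hb]; split.
  by exists (B + D) => m; rewrite (le_trans (ler_opnormD _ _)) // lerD.
move=> e e0; have e20 := divr_gt0 e0 (ltr0n _ 2).
have [s ss [N1 h1]] := ha _ e20; have [t st [N2 h2]] := hb _ e20.
exists (fun m => s m + t m); first exact: SymbolicD.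
exists (maxn N1 N2) => m; rewrite geq_max => /andP[m1 m2].
rewrite opprD addrACA (le_trans (ler_opnormD _ _)) // (splitr e).
by apply: lerD; [exact: h1|exact: h2].
Qed.

Lemma approxZ c a : approximable a -> approximable (fun m => c *: a m).
Proof.
move=> [[B aB] ha]; split.
  by exists (normc c * B) => m; rewrite opnormZ ler_wpM2l ?normc_ge0.
move=> e e0; have c0 : 0 < normc c + 1 by rewrite ltr_wpDl ?normc_ge0.
have [s ss [N h]] := ha _ (divr_gt0 e0 c0).
exists (fun m => c *: s m); first exact: SymbolicZ.
exists N => m /h{}h; rewrite -scalerBr opnormZ.
rewrite (le_trans (ler_wpM2l (normc_ge0 c) h)) // mulrCA ger_pMr //.
by rewrite ler_pdivrMr // mul1r lerDl.
Qed.

Lemma approx_closed a :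
  (forall e, 0 < e -> exists2 b, approximable b & asymp a b e) ->
  bounded_seq a -> approximable a.
Proof.
move=> ha aB; split=> // e e0; have e20 := divr_gt0 e0 (ltr0n _ 2).
have [b [_ hb] [N1 h1]] := ha _ e20; have [s ss [N2 h2]] := hb _ e20.
exists s => //; exists (maxn N1 N2) => m; rewrite geq_max => /andP[m1 m2].
rewrite -(subrKA (b m)) (le_trans (ler_opnormD _ _)) // (splitr e).
by apply: lerD; [exact: h1|exact: h2].
Qed.

Lemma approx_ext a b : (forall m, a m = b m) -> approximable a -> approximable b.
Proof. by move=> ab; congr approximable; apply: functional_extensionality_dep. Qed.

(** Words within [L] letters of the truncation have level above 1 - L/m, which is beyond 1 - r as
    soon as m > L/r. *)
Lemma interior_supp_tail f L : interior_supp f ->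
  exists N : nat, forall m k, (N <= m)%N -> (m < L + k)%N -> f (k%:R / m%:R) = 0.
Proof.
move=> [r r0 fr].
have [N hN] : exists N : nat, L%:R / r < N%:R.
  exists (Num.truncn (L%:R / r)).+1.
  by rewrite truncnS_gt ?num_real.
exists N.+1 => m k Nm mLk; apply: fr; apply/orP; right.
have m0 : 0 < m%:R :> R by rewrite ltr0n; apply: leq_trans Nm.
rewrite ler_pdivlMr // mulrBl mul1r lerBlDr.
have : L%:R <= r * m%:R.
  rewrite -ler_pdivrMl // mulrC (le_trans (ltW hN)) // ler_nat ltnW //.
have : m%:R <= L%:R + k%:R :> R by rewrite -natrD ler_nat ltnW.
lra.
Qed.

Lemma ucb_shift f L e : ucb f -> 0 < e ->
  exists N : nat, forall m k, (N <= m)%N ->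
    `|f ((L + k)%:R / m%:R) - f (k%:R / m%:R)| < e.
Proof.
move=> [_ fc] e0; have [r r0 fr] := fc _ e0.
have [N hN] : exists N : nat, L%:R / r < N%:R.
  exists (Num.truncn (L%:R / r)).+1.
  by rewrite truncnS_gt ?num_real.
exists N.+1 => m k Nm; apply: fr.
have m0 : 0 < m%:R :> R by rewrite ltr0n; apply: leq_trans Nm.
rewrite -mulrBl natrD addrK ger0_norm ?divr_ge0 //.
rewrite ltr_pdivrMr // mulrC -ltr_pdivrMr // (lt_le_trans hN) //.
by rewrite ler_nat ltnW.
Qed.

(** By comparison of [be] with [ga] the product is zero or, for large m, again a band. One of its
    two factors is read at a level shifted by finitely many letters, and replacing the coefficient
    by f g costs an error that uniform continuity sends to 0. *)
Lemma approx_bandM al be ga de f g : ucb f -> interior_supp f ->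
  ucb g -> interior_supp g ->
  approximable (fun m => bandmx m al be (level m f) *m bandmx m ga de (level m g)).
Proof.
move=> fu fi gu gi; apply: approx_closed; last first.
  have [B fB] := symbolic_bounded (SymbolicBand al be fu fi).
  have [D gD] := symbolic_bounded (SymbolicBand ga de gu gi).
  exists (B * D) => m; rewrite (le_trans (ler_opnormM _ _)) //.
  by rewrite ler_pM ?opnorm_ge0.
have [/prefixP[ga' gaE]|bg] := boolP (prefix be ga); last first.
  have [/prefixP[be' beE]|gb] := boolP (prefix ga be); last first.
    move=> e e0; exists (fun=> 0%:M).
      apply: approx_ext (approxZ 0 (symbolic_approx Symbolic1)) => m.
      by rewrite scale0r raddf0.
    by exists 0%N => m _; rewrite bandmx_mul0 // raddf0 subrr opnorm0 ltW.
  move=> e e0; exists (fun m => bandmx m al (de ++ be') (level m (fun t => f t * g t))).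
    apply/symbolic_approx/SymbolicBand; first exact: ucbM.
    exact: interior_suppMl.
  have [[B fB] _] := fu; have B0 : 0 <= B := le_trans (normr_ge0 _) (fB 0).
  have [N1 h1] := interior_supp_tail (size be) fi.
  have [N2 h2] := ucb_shift (size be') gu (divr_gt0 e0 (ltr_wpDl B0 ltr01)).
  exists (maxn N1 N2) => m; rewrite geq_max => /andP[m1 m2].
  rewrite beE bandmx_mulr; last first.
    move=> w; rewrite size_cat addnA -size_cat -beE => mw.
    by rewrite /level h1.
  rewrite bandmxB; apply: opnorm_bandmx => [|w _ _]; first exact: ltW.
  rewrite /level -rmorphM -rmorphB normc_real -mulrBr normrM size_cat.
  rewrite (le_trans (ler_pM _ _ (fB _) (ltW (h2 _ _ m2)))) //.
  by rewrite mulrCA ger_pMr // ler_pdivrMr ?ltr_wpDl // mul1r lerDl.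
move=> e e0; exists (fun m => bandmx m (al ++ ga') de (level m (fun t => f t * g t))).
  apply/symbolic_approx/SymbolicBand; first exact: ucbM.
  exact: interior_suppMl.
have [[B gB] _] := gu; have B0 : 0 <= B := le_trans (normr_ge0 _) (gB 0).
have [N1 h1] := interior_supp_tail (size ga) gi.
have [N2 h2] := ucb_shift (size ga') fu (divr_gt0 e0 (ltr_wpDl B0 ltr01)).
exists (maxn N1 N2) => m; rewrite geq_max => /andP[m1 m2].
rewrite gaE bandmx_mul; last first.
  move=> w; rewrite size_cat addnA -size_cat -gaE => mw.
  by rewrite /level h1.
rewrite bandmxB; apply: opnorm_bandmx => [|w _ _]; first exact: ltW.
rewrite /level -!rmorphM -rmorphB normc_real -mulrBl normrM size_cat mulrC.
rewrite (le_trans (ler_pM _ _ (gB _) (ltW (h2 _ _ m2)))) //.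
by rewrite mulrCA ger_pMr // ler_pdivrMr ?ltr_wpDl // mul1r lerDl.
Qed.

Lemma symbolicM s t : symbolic s -> symbolic t -> approximable (fun m => s m *m t m).
Proof.
move=> ss st; elim: ss => [|al be f fu fi|s1 s2 _ h1 _ h2|c s1 _ h1].
- by apply: approx_ext (symbolic_approx st) => m; rewrite mul1mx.
- elim: st => [|ga de g gu gi|t1 t2 _ h1 _ h2|c t1 _ h1].
  + apply: approx_ext (symbolic_approx (SymbolicBand al be fu fi)) => m.
    by rewrite mulmx1.
  + exact: approx_bandM.
  + by apply: approx_ext (approxD h1 h2) => m; rewrite mulmxDr.
  + by apply: approx_ext (approxZ c h1) => m; rewrite scalemxAr.
- by apply: approx_ext (approxD h1 h2) => m; rewrite mulmxDl.
- by apply: approx_ext (approxZ c h1) => m; rewrite scalemxAl.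
Qed.

Lemma approxM a b : approximable a -> approximable b -> approximable (fun m => a m *m b m).
Proof.
move=> [[B aB] ha] [[D bD] hb]; apply: approx_closed; last first.
  exists (B * D) => m; rewrite (le_trans (ler_opnormM _ _)) //.
  by rewrite ler_pM ?opnorm_ge0.
have D0 : 0 <= D := le_trans (opnorm_ge0 _) (bD 0%N).
move=> e e0; have e20 := divr_gt0 e0 (ltr0n _ 2).
have [s ss [N1 h1]] := ha _ (divr_gt0 e20 (ltr_wpDl D0 ltr01)).
have [E sE] := symbolic_bounded ss.
have E0 : 0 <= E := le_trans (opnorm_ge0 _) (sE 0%N).
have [t st [N2 h2]] := hb _ (divr_gt0 e20 (ltr_wpDl E0 ltr01)).
exists (fun m => s m *m t m); first exact: symbolicM.
exists (maxn N1 N2) => m; rewrite geq_max => /andP[m1 m2].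
have -> : a m *m b m - s m *m t m = (a m - s m) *m b m + s m *m (b m - t m).
  by rewrite mulmxBl mulmxBr subrKA.
rewrite (le_trans (ler_opnormD _ _)) // (splitr e) lerD //.
  rewrite (le_trans (ler_opnormM _ _)) //.
  rewrite (le_trans (ler_pM (opnorm_ge0 _) (opnorm_ge0 _) (h1 m m1) (bD m))) //.
  by rewrite mulrAC ler_pdivrMr ?ltr_wpDl // ler_wpM2l ?lerDl // ltW.
rewrite (le_trans (ler_opnormM _ _)) //.
rewrite (le_trans (ler_pM (opnorm_ge0 _) (opnorm_ge0 _) (sE m) (h2 m m2))) //.
by rewrite mulrC mulrAC ler_pdivrMr ?ltr_wpDl // ler_wpM2l ?lerDl // ltW.
Qed.

Lemma approx_star a : approximable a -> approximable (fun m => adj (a m)).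
Proof.
move=> [[B aB] ha]; apply: approx_closed; last first.
  by exists B => m; rewrite opnorm_adj.
move=> e e0; have [s ss [N h]] := ha _ e0.
exists (fun m => adj (s m)); last first.
  by exists N => m /h; rewrite -raddfB opnorm_adj.
elim: ss => [|al be f fu fi|s1 s2 _ h1 _ h2|c s1 _ h1].
- apply: approx_ext (symbolic_approx Symbolic1) => m.
  by rewrite -(bandmx1 m) adj_bandmx; apply: eq_bandmx => w _ _; rewrite conjc1.
- apply: approx_ext (symbolic_approx (SymbolicBand be al fu fi)) => m.
  by rewrite adj_bandmx; apply: eq_bandmx => w _ _; rewrite conjc_real.
- by apply: approx_ext (approxD h1 h2) => m; rewrite raddfD.
- by apply: approx_ext (approxZ (conjc c) h1) => m; rewrite adj_scale.
Qed.

Lemma approx_uniform_closed a :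
  (forall e, 0 < e -> exists2 b, approximable b & forall m, opnorm (a m - b m) <= e) ->
  approximable a.
Proof.
move=> ha; apply: approx_closed => [e /ha[b hb ab]|].
  by exists b => //; exists 0%N.
have [b [[B bB] _] ab] := ha 1 ltr01; exists (1 + B) => m.
by rewrite -(subrK (b m) (a m)) (le_trans (ler_opnormD _ _)) // lerD.
Qed.

Fact fock_dim_gt0 : (0 < #|{: W 0}|)%N.
Proof. by apply/card_gt0P; exists [bseq]. Qed.

Definition fock : closed_subalg R :=
  @ClosedSubalg R (fun m => #|{: W m}|) approximable fock_dim_gt0
    (fun a h => h.1) (symbolic_approx Symbolic1)
    approxD approxZ approxM approx_star approx_uniform_closed.

End words.

(** * Cut-off functions *)

Section windows.
Context (R : realType).

Definition clamp (x : R) : R := Num.max 0 (Num.min 1 x).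

Lemma clamp_ge0 x : 0 <= clamp x.
Proof. by rewrite /clamp le_max lexx. Qed.

Lemma clamp_le1 x : clamp x <= 1.
Proof. by rewrite /clamp ge_max ler01 ge_min lexx. Qed.

Lemma clamp_id x : 0 <= x <= 1 -> clamp x = x.
Proof. by case/andP=> x0 x1; rewrite /clamp min_r // max_r. Qed.

Lemma clamp_eq0 x : x <= 0 -> clamp x = 0.
Proof. by move=> x0; rewrite /clamp max_l // ge_min x0 orbT. Qed.

Lemma clamp_eq1 x : 1 <= x -> clamp x = 1.
Proof. by move=> x1; rewrite /clamp min_l // max_r. Qed.

Lemma clampP x : [\/ x <= 0 /\ clamp x = 0, 1 <= x /\ clamp x = 1 |
  [/\ 0 <= x, x <= 1 & clamp x = x]].
Proof.
have [x0|/ltW x0] := leP x 0; first by apply: Or31; rewrite clamp_eq0.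
have [x1|/ltW x1] := leP 1 x; first by apply: Or32; rewrite clamp_eq1.
by apply: Or33; rewrite clamp_id ?x0.
Qed.

Lemma clamp_lip x y : `|clamp x - clamp y| <= `|x - y|.
Proof.
wlog xy : x y / x <= y.
  by move=> h; have [/h//|/ltW/h] := leP x y; rewrite distrC (distrC y).
rewrite distrC (distrC x) [leRHS]ger0_norm ?subr_ge0 //.
by rewrite ler_norml; case: (clampP x) => [[? ->]|[? ->]|[? ? ->]];
  case: (clampP y) => [[? ->]|[? ->]|[? ? ->]]; apply/andP; split; lra.
Qed.

Lemma le_clamp x y : x <= y -> clamp x <= clamp y.
Proof.
move=> xy; case: (clampP x) => [[? ->]|[? ->]|[? ? ->]];
  case: (clampP y) => [[? ->]|[? ->]|[? ? ->]]; lra.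
Qed.

(** With Q(z) = min(clamp z, 1 - c) = max(clamp(z + c), c) - c, both truncations can only shrink
    increments of a monotone function. Hence one increment of Q lies below the increments of [clamp]
    at two places a distance [c] apart. *)
Lemma clamp_shift A B c : 0 <= c <= 1 -> 0 <= B ->
  Num.min (clamp (A + B)) (1 - c) - Num.min (clamp A) (1 - c) <=
  Num.min (clamp (A + B) - clamp A) (clamp (A + B + c) - clamp (A + c)).
Proof.
move=> /andP[c0 c1] B0.
have minB (u v k : R) : u <= v -> Num.min v k - Num.min u k <= v - u.
  by move=> uv; have [vk|/ltW kv] := leP v k; have [uk|/ltW ku] := leP u k; lra.
have maxB (u v k : R) : u <= v -> Num.max v k - Num.max u k <= v - u.
  by move=> uv; have [vk|/ltW kv] := leP v k; have [uk|/ltW ku] := leP u k; lra.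
have minE z : Num.min (clamp z) (1 - c) = Num.max (clamp (z + c)) c - c.
  have [? | /ltW ?] := leP (clamp z) (1 - c); have [? | /ltW ?] := leP (clamp (z + c)) c;
  case: (clampP z) => [[? ?]|[? ?]|[? ? ?]];
  case: (clampP (z + c)) => [[? ?]|[? ?]|[? ? ?]]; lra.
rewrite le_min; apply/andP; split; first by rewrite minB // le_clamp // lerDl.
rewrite !minE opprB addrA subrK; apply: maxB.
by rewrite le_clamp // lerD2r lerDl.
Qed.

Lemma ucb_lip f (B L : R) : (forall t, `|f t| <= B) ->
  (forall s t, `|f s - f t| <= L * `|s - t|) -> ucb f.
Proof.
move=> fB fL; split; first by exists B.
move=> e e0; have L0 : 0 < `|L| + 1 by rewrite ltr_wpDl.
exists (e / (`|L| + 1)); first exact: divr_gt0.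
move=> s t; rewrite ltr_pdivlMr // mulrC => st.
apply: le_lt_trans st; apply: le_trans (fL s t) _.
by rewrite ler_wpM2r // (le_trans (ler_norm L)) // lerDl.
Qed.

Lemma sqrtr_dist (x y : R) : 0 <= x -> 0 <= y ->
  `|Num.sqrt x - Num.sqrt y| ^+ 2 <= `|x - y|.
Proof.
move=> x0 y0; wlog xy : x y x0 y0 / x <= y.
  by move=> h; have [/h|/ltW/h] := leP x y; rewrite ?(distrC _ (Num.sqrt x)) ?(distrC x); apply.
rewrite distrC (distrC x) !ger0_norm ?subr_ge0 ?ler_wsqrtr //.
have := sqr_sqrtr x0; have := sqr_sqrtr y0.
have := ler_wsqrtr xy; have := sqrtr_ge0 x.
set a := Num.sqrt x; set b := Num.sqrt y => a0 ab <- <-; nra.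
Qed.

Lemma ucb_sqrt (f : R -> R) : ucb f -> (forall t, 0 <= f t) -> ucb (fun t => Num.sqrt (f t)).
Proof.
move=> [[B fB] fc] f0; split.
  exists (Num.sqrt B) => t; rewrite ger0_norm ?sqrtr_ge0 // ler_wsqrtr //.
  by rewrite (le_trans (ler_norm _)).
move=> e e0; have [r r0 fr] := fc (e ^+ 2) (exprn_gt0 _ e0).
exists r => // s t /fr fst; rewrite -(@ltr_pXn2r _ 2) ?nnegrE ?(ltW e0) //.
by rewrite (le_lt_trans (sqrtr_dist _ _)).
Qed.

(** Rises from 0 at -W to 1 at 0; windows are its unit increments, so that their sums telescope. *)
Definition ramp (W z : R) : R := clamp (z / W + 1).

Lemma le_ramp W x y : 0 < W -> x <= y -> ramp W x <= ramp W y.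
Proof. by move=> W0 xy; rewrite le_clamp // lerD2r ler_pM2r ?invr_gt0. Qed.

Lemma ramp_eq1 W z : 0 < W -> 0 <= z -> ramp W z = 1.
Proof. by move=> W0 z0; rewrite /ramp clamp_eq1 // lerDr divr_ge0 // ltW. Qed.

Lemma ramp_eq0 W z : 0 < W -> z <= - W -> ramp W z = 0.
Proof.
move=> W0 zW; rewrite /ramp clamp_eq0 //.
by rewrite -lerBrDr sub0r ler_pdivrMr // mulN1r.
Qed.

(* The share of the unit interval [k, k+1] in the window [t n - W, t n]
   of length [W]. *)
Definition win (W : R) (n k : nat) (t : R) : R :=
  ramp W (k.+1%:R - t * n%:R) - ramp W (k%:R - t * n%:R).

Section win.
Context (W : R) (n : nat).
Hypothesis W0 : 0 < W.

Lemma win_ge0 k t : 0 <= win W n k t.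
Proof. by rewrite subr_ge0 le_ramp // lerD2r ler_nat. Qed.

Lemma win_le1 k t : win W n k t <= 1.
Proof. by rewrite lerBlDr (le_trans (clamp_le1 _)) // lerDl clamp_ge0. Qed.

Lemma win_hi k t : t * n%:R <= k%:R -> win W n k t = 0.
Proof.
move=> tk; rewrite /win !ramp_eq1 ?subrr // ?subr_ge0 //.
by rewrite (le_trans tk) // ler_nat.
Qed.

Lemma win_lo k t : k.+1%:R <= t * n%:R - W -> win W n k t = 0.
Proof.
move=> tk; rewrite /win !ramp_eq0 ?subrr //; last by rewrite lerBlDr addrC.
by rewrite lerBlDr addrC (le_trans _ tk) // ler_nat.
Qed.

Lemma sum_win a N t : \sum_(i < N) win W n (a + i) t =
  ramp W ((a + N)%:R - t * n%:R) - ramp W (a%:R - t * n%:R).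
Proof.
rewrite -[in X in _ - X](addn0 a).
rewrite -(telescope_sumr (fun i => ramp W ((a + i)%:R - t * n%:R)) (leq0n N)).
by rewrite big_mkord; apply: eq_bigr => i _; rewrite /win addnS.
Qed.

Lemma sum_win_le1 a N t : \sum_(i < N) win W n (a + i) t <= 1.
Proof. by rewrite sum_win lerBlDr (le_trans (clamp_le1 _)) // lerDl clamp_ge0. Qed.

Lemma ucb_win k : ucb (win W n k).
Proof.
apply: (@ucb_lip _ 1 (2 * (n%:R / W))) => [t|s t].
  by rewrite ger0_norm ?win_ge0 ?win_le1.
have ramp_lip (j : nat) : `|ramp W (j%:R - s * n%:R) - ramp W (j%:R - t * n%:R)|
    <= n%:R / W * `|s - t|.
  rewrite (le_trans (clamp_lip _ _)) //.
  have -> : (j%:R - s * n%:R) / W + 1 - ((j%:R - t * n%:R) / W + 1) =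
     (n%:R / W) * (t - s) by field; rewrite gt_eqF.
  by rewrite normrM (distrC t) ger0_norm // divr_ge0 // ltW.
have -> : win W n k s - win W n k t =
   (ramp W (k.+1%:R - s * n%:R) - ramp W (k.+1%:R - t * n%:R)) -
   (ramp W (k%:R - s * n%:R) - ramp W (k%:R - t * n%:R)) by rewrite /win; ring.
rewrite (le_trans (ler_normB _ _)) //.
by have := ramp_lip k; have := ramp_lip k.+1; lra.
Qed.

Lemma overlap_le1 a b N t t' :
  \sum_(i < N) Num.sqrt (win W n (a + i) t) * Num.sqrt (win W n (b + i) t') <= 1.
Proof.
apply: (@le_trans _ _ (\sum_(i < N) (win W n (a + i) t / 2 + win W n (b + i) t' / 2))).
  apply: ler_sum => i _.
  have := sqr_sqrtr (win_ge0 (a + i) t); have := sqr_sqrtr (win_ge0 (b + i) t').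
  set x := Num.sqrt _; set y := Num.sqrt _ => <- <-.
  by have := sqr_ge0 (x - y); lra.
rewrite big_split /= -!mulr_suml.
by have := sum_win_le1 a N t; have := sum_win_le1 b N t'; lra.
Qed.

(** sqrt(p q) >= min(p, q), and by [clamp_shift] the minimum dominates the increments of a single
    function [q], which telescope to 1 minus the relative offset of the two windows. The hypotheses
    place both windows inside the summation range. *)
Lemma overlap_ge a b t t' s : 0 <= t <= 1 -> 0 <= t' <= 1 ->
  W + a%:R <= t * n%:R -> W + b%:R <= t' * n%:R ->
  `|(a%:R - t * n%:R) - (b%:R - t' * n%:R)| <= s -> s <= W ->
  1 - s / W <=
  \sum_(i < n.+1) Num.sqrt (win W n (a + i) t) * Num.sqrt (win W n (b + i) t').
Proof.
wlog xy : a b t t' / a%:R - t * n%:R <= b%:R - t' * n%:R.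
  move=> h t1 t'1 Wa Wb xys sW.
  have [xy|/ltW xy] := leP (a%:R - t * n%:R) (b%:R - t' * n%:R); first exact: h.
  have := h b a t' t xy t'1 t1 Wb Wa; rewrite distrC => /(_ xys sW).
  by move=> /le_trans; apply; apply: ler_sum => i _; rewrite mulrC.
move=> /andP[t0 t1] /andP[t'0 t'1] Wa Wb; set x := a%:R - _ in xy *; set y := b%:R - _ in xy *.
rewrite distrC ger0_norm ?subr_ge0 // => ys sW.
pose q z := Num.min (ramp W z) (1 - (y - x) / W).
have WW : W / W = 1 by rewrite divff ?gt_eqF.
have yxW : 0 <= (y - x) / W <= 1.
  rewrite divr_ge0 ?subr_ge0 ?(ltW W0) //= ler_pdivrMr // mul1r.
  exact: le_trans ys sW.
have q_le z : q (z + 1) - q z <= Num.min (ramp W (z + 1) - ramp W z)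
    (ramp W (z + 1 + (y - x)) - ramp W (z + (y - x))).
  have i0 : 0 <= W^-1 by rewrite invr_ge0 ltW.
  have -> : ramp W (z + 1) = clamp (z / W + 1 + W^-1).
    by rewrite /ramp mulrDl mul1r addrAC.
  have -> : ramp W (z + 1 + (y - x)) = clamp (z / W + 1 + W^-1 + (y - x) / W).
    by congr clamp; field; rewrite gt_eqF.
  have -> : ramp W (z + (y - x)) = clamp (z / W + 1 + (y - x) / W).
    by rewrite /ramp mulrDl addrAC.
  rewrite /q; have -> : ramp W (z + 1) = clamp (z / W + 1 + W^-1).
    by rewrite /ramp mulrDl mul1r addrAC.
  exact: clamp_shift.
have term (i : 'I_n.+1) : q (x + i.+1%:R) - q (x + i%:R) <=
    Num.sqrt (win W n (a + i) t) * Num.sqrt (win W n (b + i) t').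
  have := q_le (x + i%:R); rewrite -[x + _ + 1]addrA natr1 le_min => /andP[h1 h2].
  have h1' : q (x + i.+1%:R) - q (x + i%:R) <= win W n (a + i) t.
    apply: le_trans h1 _; rewrite /win.
    have E j : x + j%:R = (a + j)%:R - t * n%:R by rewrite /x natrD; ring.
    by rewrite !E addnS.
  have h2' : q (x + i.+1%:R) - q (x + i%:R) <= win W n (b + i) t'.
    apply: le_trans h2 _; rewrite /win.
    have E j : x + j%:R + (y - x) = (b + j)%:R - t' * n%:R.
      by rewrite /y natrD; ring.
    by rewrite !E addnS.
  have [d0|d0] := leP (q (x + i.+1%:R) - q (x + i%:R)) 0.
    by rewrite (le_trans d0) // mulr_ge0 ?sqrtr_ge0.
  rewrite -sqrtrM ?win_ge0 // -[leLHS]ger0_norm ?(ltW d0) // -sqrtr_sqr ler_wsqrtr //.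
  by rewrite expr2 ler_pM ?(ltW d0).
apply: le_trans (ler_sum _ (fun i _ => term i)).
rewrite -(big_mkord xpredT (fun i => q (x + i.+1%:R) - q (x + i%:R))).
rewrite (telescope_sumr (fun i => q (x + i%:R))) // addr0 /q.
(* Because t <= 1, adding n + 1 to [x] reaches past 0, where the ramp is 1; [x] itself is at most
   -W, where it is 0. *)
rewrite ramp_eq1 //; last first.
  rewrite -natr1 /x; have : 0 <= a%:R :> R by [].
  have : t * n%:R <= n%:R :> R by rewrite ler_piMl.
  lra.
rewrite (ramp_eq0 W0) ?/x; last lra.
case/andP: yxW => c0 c1; rewrite min_r; last by rewrite gerBl.
rewrite min_l ?subr_ge0 // subr0 lerD2l lerN2 ler_pM2r ?invr_gt0 //.
Qed.

End win.

Definition plateau (d t : R) : R :=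
  clamp (Num.min (2 * t / d - 1) (2 * (1 - t) / d - 1)).

Lemma plateau_itv d t : 0 <= plateau d t <= 1.
Proof. by rewrite clamp_ge0 clamp_le1. Qed.

Lemma plateau_eq1 d t : 0 < d -> d <= t <= 1 - d -> plateau d t = 1.
Proof.
move=> d0 /andP[dt td]; rewrite /plateau clamp_eq1 // le_min !lerBrDr.
by rewrite !ler_pdivlMr //; apply/andP; split; lra.
Qed.

Lemma plateau_eq0 d t : 0 < d -> (t <= d / 2) || (1 - d / 2 <= t) -> plateau d t = 0.
Proof.
move=> d0 /orP[td|td]; rewrite /plateau clamp_eq0 // ge_min; apply/orP; [left|right];
  rewrite subr_le0 ler_pdivrMr //; lra.
Qed.

Lemma interior_supp_plateau d : 0 < d -> interior_supp (plateau d).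
Proof.
by move=> d0; exists (d / 2) => [|t]; [rewrite divr_gt0|exact: plateau_eq0].
Qed.

Lemma ucb_plateau d : 0 < d -> ucb (plateau d).
Proof.
move=> d0; apply: (@ucb_lip _ 1 (2 / d)) => [t|s t].
  by rewrite ger0_norm; case/andP: (plateau_itv d t).
rewrite (le_trans (clamp_lip _ _)) //.
have i0 : 0 < 2 / d by rewrite divr_gt0.
rewrite ![2 * _ / d]mulrAC; set K := 2 / d in i0 *.
wlog st : s t / t <= s.
  by move=> h; have [/h|/ltW/h//] := leP s t; rewrite distrC (distrC s).
rewrite (ger0_norm (_ : 0 <= s - t)) ?subr_ge0 //.
have : 0 <= K * (s - t) by rewrite mulr_ge0 ?subr_ge0 // ltW.
rewrite ler_norml /Num.min !mulrBr !mulr1; do 2 case: ifPn; rewrite -?leNgt => *;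
  by apply/andP; split; lra.
Qed.

End windows.

(** * Nuclearity *)

Section kraus.
Context (R : realType).
Local Notation C := R[i].

(** Completely positive contractions in Kraus form: the inequality says that the sum of V_j^* V_j is
    at most 1. An arbitrary finite index type lets a composition be indexed by pairs. *)
Definition kraus (N d : nat) (T : 'M[C]_N -> 'M[C]_d) : Prop :=
  exists (J : finType) (V : J -> 'M[C]_(N, d)),
    (forall v, \sum_j l2norm (V j *m v) ^+ 2 <= l2norm v ^+ 2) /\
    forall X, T X = \sum_j adj (V j) *m X *m V j.

Section theory.
Context (N d : nat) (T : 'M[C]_N -> 'M[C]_d).
Hypothesis T_kraus : kraus T.

Lemma kraus_opnorm X : opnorm (T X) <= opnorm X.
Proof. by have [J [V [V1 ->]]] := T_kraus; exact: opnorm_compress. Qed.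

Lemma kraus_linear c X Y : T (c *: X + Y) = c *: T X + T Y.
Proof.
have [J [V [_ TE]]] := T_kraus; rewrite !TE scaler_sumr -big_split.
by apply: eq_bigr => j _; rewrite mulmxDr mulmxDl -scalemxAr -scalemxAl.
Qed.

Lemma krausB X Y : T (X - Y) = T X - T Y.
Proof. by rewrite addrC -scaleN1r kraus_linear scaleN1r addrC. Qed.

Lemma kraus0 : T 0 = 0.
Proof. by rewrite -{1}(subrr 0) krausB subrr. Qed.

Lemma krausZ c X : T (c *: X) = c *: T X.
Proof. by rewrite -[c *: X]addr0 kraus_linear kraus0 addr0. Qed.

Lemma krausD X Y : T (X + Y) = T X + T Y.
Proof. by rewrite -[X]scale1r kraus_linear !scale1r. Qed.

Lemma kraus_adj X : T (adj X) = adj (T X).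
Proof.
have [J [V [_ TE]]] := T_kraus; rewrite !TE raddf_sum; apply: eq_bigr => j _.
by rewrite /= !adjM adjK mulmxA.
Qed.

(** The form of the amplified map at [v] is the sum over [j] of the forms of Y^* Y at the vectors
    with components V_j v_s. *)
Lemma kraus_pos k (Y : 'M['M[C]_N]_k) v :
  0 <= rdot (flat (map_mx T (star Y * Y)) *m v) v.
Proof.
have [J [V [_ TE]]] := T_kraus; set M := star Y * Y.
pose u j := \mxcol_(s < k) (V j *m submxcol v s).
have -> : rdot (flat (map_mx T M) *m v) v = \sum_j rdot (flat M *m u j) (u j).
  rewrite -[v]submxcolK mul_mxblock_mxrow rdot_mxcol.
  under [RHS]eq_bigr do rewrite /u mul_mxblock_mxrow rdot_mxcol.
  rewrite [RHS]exchange_big; apply: eq_bigr => r _ /=.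
  under [RHS]eq_bigr do rewrite rdot_suml.
  rewrite rdot_suml [RHS]exchange_big; apply: eq_bigr => s _ /=.
  rewrite mxE TE mulmx_suml rdot_suml; apply: eq_bigr => j _.
  by rewrite -!mulmxA rdot_adj adjK.
apply: sumr_ge0 => j _; rewrite /M flatM flat_star -mulmxA rdot_adj adjK rdotvv.
exact: sqr_ge0.
Qed.

End theory.

Lemma kraus_comp N d p (T : 'M[C]_N -> 'M[C]_d) (T' : 'M[C]_d -> 'M[C]_p) :
  kraus T -> kraus T' -> kraus (fun X => T' (T X)).
Proof.
move=> [J [V [V1 TE]]] [J' [V' [V'1 TE']]].
exists (J' * J)%type, (fun j => V j.2 *m V' j.1); split=> [v|X].
  rewrite -(pair_bigA _ (fun j' j => l2norm (V j *m V' j' *m v) ^+ 2)) /=.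
  apply: le_trans (V'1 v); apply: ler_sum => j' _.
  by under eq_bigr do rewrite -mulmxA; exact: V1.
rewrite TE' -(pair_bigA _ (fun j' j => adj (V j *m V' j') *m X *m (V j *m V' j'))) /=.
apply: eq_bigr => j' _; rewrite TE mulmx_sumr mulmx_suml; apply: eq_bigr => j _.
by rewrite adjM !mulmxA.
Qed.

Lemma kraus_mxsub n p (f : 'I_n -> 'I_p) : injective f ->
  kraus (mxsub f f : 'M[C]_p -> 'M[C]_n).
Proof.
move=> f_inj; exists 'I_1, (fun=> selmx R f); split=> [v|X].
  by rewrite big_ord1 l2norm_selmx.
by rewrite big_ord1 mxsub_selmx.
Qed.

End kraus.

(** * The stretching map and its action on bands *)

Section stretch.
Context (R : realType).
Local Notation C := R[i].
Local Notation W m := (bseq_of m bool).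

Lemma band_sum n al be (c : seq bool -> C) (u v : W n) :
  band al be c u v =
  \sum_(w : W n) (val w == drop (size al) u)%:R *
    ((val u == al ++ w)%:R * (val v == be ++ w)%:R * c w).
Proof.
rewrite (@sum_bseq1 _ n (drop (size al) u)
  (fun w => (val u == al ++ w)%:R * (val v == be ++ w)%:R * c w)).
have -> : (size (drop (size al) u) <= n)%N.
  by rewrite size_drop (leq_trans (leq_subr _ _)) ?size_bseq.
by rewrite /band; do 2 case: eqP => _ /=; rewrite ?mul1r ?mul0r ?mulr0 ?mul0r.
Qed.

Lemma band_sum' n al be (c : seq bool -> C) (u v : W n) :
  band al be c u v =
  \sum_(w : W n) (val u == al ++ w)%:R * (val v == be ++ w)%:R * c w.
Proof.
rewrite band_sum; apply: eq_bigr => w _.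
have [uE|_] := eqVneq (val u) (al ++ w); last by rewrite !mul0r mulr0.
by rewrite uE drop_size_cat // eqxx !mul1r.
Qed.

(** A splitting w = x ++ v is determined by the length of [x], so a sum over pairs of words
    collapses to a sum over lengths. *)
Lemma sum_factorizations (n m : nat) (w : seq bool) (G : nat -> C) :
  (size w <= m)%N ->
  \sum_(v : W m) \sum_(x : W n) (w == x ++ v)%:R * G (size x) =
  \sum_(i < n.+1) (i <= size w)%N%:R * G i.
Proof.
move=> wm.
have E (v : W m) (x : W n) : (w == x ++ v)%:R * G (size x) =
    \sum_(i < n.+1) (val x == take i w)%:R * ((val v == drop i w)%:R *
      ((i <= size w)%N%:R * G i)).
  have [wE|wN] := eqVneq w (x ++ v); last first.
    rewrite mul0r big1 // => i _; case: eqP => [xE|]; last by rewrite mul0r.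
    case: eqP => [vE|]; last by rewrite mul0r mulr0.
    by rewrite xE vE cat_take_drop eqxx in wN.
  have xn : (size x < n.+1)%N by rewrite ltnS size_bseq.
  rewrite (bigD1 (Ordinal xn)) //= wE take_size_cat // drop_size_cat // !eqxx.
  rewrite size_cat leq_addr !mul1r big1 ?addr0 // => i.
  rewrite -(inj_eq val_inj) /= => ix.
  case: eqP => [xE|]; last by rewrite mul0r.
  case: leqP => [ixv|]; last by rewrite !mul0r !mulr0.
  by move: ix; rewrite xE size_take_min size_cat (minn_idPl ixv) eqxx.
under eq_bigr do under eq_bigr do rewrite E.
under eq_bigr do rewrite exchange_big.
rewrite exchange_big; apply: eq_bigr => i _ /=.
under eq_bigr => v _.
  rewrite (@sum_bseq1 _ n (take i w) (fun=> (val v == drop i w)%:R *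
      ((i <= size w)%N%:R * G i))).
  have -> : (size (take i w) <= n)%N.
    by rewrite size_take_min (leq_trans (geq_minl _ _)) // -ltnS.
  over.
rewrite (@sum_bseq1 _ m (drop i w) (fun=> (i <= size w)%N%:R * G i)).
by rewrite size_drop (leq_trans (leq_subr _ _)).
Qed.

Section def.
Context (n m : nat) (h : nat -> R -> R) (chi : R -> R).

(** Zero for k > n, as no word of such a length indexes the block being stretched; formulas can then
    sum over all lengths. *)
Definition wt (k l : nat) : C :=
  if (k <= n)%N then (h k (l%:R / m%:R))%:C%C else 0.

Definition top_bseq : W n := Bseq (eq_leq (size_nseq n false)).

(** The first family strips a tail [v] from a word. The second restores the mass that the first
    leaves out: it copies the entry of [X] at [top_bseq] along the diagonal with weight [chi]. *)
Definition stretchV (j : W m + W m) : 'M[C]_(#|{: W n}|, #|{: W m}|) :=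
  match j with
  | inl v => opmx (fun (al : W n) (u : W m) =>
      (val u == al ++ v)%:R * wt (size al) (size u))
  | inr x => opmx (fun (al : W n) (u : W m) =>
      ((al == top_bseq) && (u == x))%:R * level m (fun t => Num.sqrt (chi t)) u)
  end.

Definition stretch (X : 'M[C]_#|{: W n}|) : 'M[C]_#|{: W m}| :=
  \sum_j adj (stretchV j) *m X *m stretchV j.

Lemma conj_wt k l : conjc (wt k l) = wt k l.
Proof. by rewrite /wt; case: ifP => _; rewrite ?conjc_real ?conjc0. Qed.

Lemma mulmx_enum3 (I J : finType) (V : 'M[C]_(#|J|, #|I|)) (X : 'M[C]_#|J|) u u' :
  (adj V *m X *m V) (enum_rank u) (enum_rank u') =
  \sum_(be : J) \sum_(al : J) conjc (V (enum_rank al) (enum_rank u)) *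
    X (enum_rank al) (enum_rank be) * V (enum_rank be) (enum_rank u').
Proof.
rewrite mulmx_enum; apply: eq_bigr => be _; rewrite mulmx_enum mulr_suml.
by apply: eq_bigr => al _; rewrite mxE.
Qed.

Lemma stretch_inr X (u u' : W m) : (forall t, 0 <= chi t) ->
  (\sum_(x : W m) adj (stretchV (inr x)) *m X *m stretchV (inr x))
     (enum_rank u) (enum_rank u') =
  (u == u')%:R * level m chi u * X (enum_rank top_bseq) (enum_rank top_bseq).
Proof.
move=> chi0; rewrite summxE.
under eq_bigr do rewrite mulmx_enum3.
rewrite (bigD1 u) //= [X in _ + X]big1 ?addr0 => [|x xu]; last first.
  rewrite big1 // => be _; rewrite big1 // => al _.
  by rewrite !opmxE [u == x]eq_sym (negPf xu) andbF mul0r conjc0 !mul0r.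
rewrite (bigD1 top_bseq) //= [X in _ + X]big1 ?addr0 => [|be bt]; last first.
  by rewrite big1 // => al _; rewrite !opmxE (negPf bt) mul0r mulr0.
rewrite (bigD1 top_bseq) //= [X in _ + X]big1 ?addr0 => [|al at_]; last first.
  by rewrite !opmxE (negPf at_) mul0r conjc0 !mul0r.
rewrite !opmxE !eqxx andTb !mul1r [u' == u]eq_sym /level conjc_real.
case: eqP => [->|]; last by rewrite !mul0r mulr0.
by rewrite !mul1r mulrAC -rmorphM -expr2 /= sqr_sqrtr.
Qed.

(** Stripping a tail from both words and restoring it leaves [al] and [be] in place, so a band stays
    a band and only its coefficient is averaged, over the splittings of [w]. *)
Lemma stretch_bandmx al be (g : nat -> C) : (forall t, 0 <= chi t) ->
  stretch (bandmx n al be (fun w => g (size w))) =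
  bandmx m al be (fun w => \sum_(i < n.+1) (i <= size w)%N%:R *
     (g i * wt (size al + i) (size al + size w) * wt (size be + i) (size be + size w)))
  + band al be (fun w => g (size w)) top_bseq top_bseq *: bandmx m [::] [::] (level m chi).
Proof.
move=> chi0; apply: opmxP => u u'; rewrite /stretch big_sumType [LHS]mxE [RHS]mxE; congr (_ + _).
  rewrite summxE opmxE.
  have -> : \sum_(v : W m) (adj (stretchV (inl v)) *m
        bandmx n al be (fun w => g (size w)) *m stretchV (inl v)) (enum_rank u) (enum_rank u') =
      \sum_(v : W m) \sum_(x : W n) ((val u == al ++ (x ++ v))%:R * (val u' == be ++ (x ++ v))%:R)
        * (g (size x) * wt (size al + size x) (size u) * wt (size be + size x) (size u')).
    apply: eq_bigr => v _; rewrite mulmx_enum3.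
    transitivity (\sum_(b : W n) \sum_(a : W n) \sum_(x : W n)
        (val a == al ++ x)%:R * ((val b == be ++ x)%:R *
       ((val u == a ++ v)%:R * wt (size a) (size u) * g (size x) *
       ((val u' == b ++ v)%:R * wt (size b) (size u'))))).
      apply: eq_bigr => b _; apply: eq_bigr => a _; rewrite !opmxE band_sum'.
      rewrite rmorphM rmorph_nat /= conj_wt mulr_sumr mulr_suml; apply: eq_bigr => x _.
      by ring.
    under eq_bigr do rewrite exchange_big.
    rewrite exchange_big; apply: eq_bigr => x _ /=.
    under eq_bigr => b _.
      rewrite (@sum_bseq1 _ n (al ++ x) (fun a => (val b == be ++ x)%:R *
       ((val u == a ++ v)%:R * wt (size a) (size u) * g (size x) *
       ((val u' == b ++ v)%:R * wt (size b) (size u'))))).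
      over.
    case: leqP => axn; last first.
      rewrite big1 // [wt (size al + _) _]/wt -(size_cat al) leqNgt axn /=.
      by rewrite !(mulr0, mul0r).
    rewrite (@sum_bseq1 _ n (be ++ x) (fun b =>
       ((val u == (al ++ x) ++ v)%:R * wt (size (al ++ x)) (size u) * g (size x) *
       ((val u' == b ++ v)%:R * wt (size b) (size u'))))).
    case: leqP => bxn; last first.
      by rewrite [wt (size be + _) _]/wt -(size_cat be) leqNgt bxn /= !(mulr0, mul0r).
    by rewrite -!catA !size_cat; ring.
  case: bandP => [w uE u'E|uN]; last first.
    rewrite big1 // => v _; rewrite big1 // => x _.
    case: eqP => [uE|]; last by rewrite !mul0r.
    case: eqP => [u'E|]; last by rewrite mulr0 mul0r.
    by case: (uN (x ++ v)).
  rewrite -(@sum_factorizations n m w (fun i => g i *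
     wt (size al + i) (size al + size w) * wt (size be + i) (size be + size w))).
    apply: eq_bigr => v _; apply: eq_bigr => x _.
    rewrite /= uE u'E !eqseq_cat // !eqxx /= -natrM mulnb andbb.
    by rewrite !size_cat.
  by apply: leq_trans (size_bseq u); rewrite uE size_cat leq_addl.
rewrite stretch_inr // opmxE [RHS]mxE opmxE.
rewrite (band_cat [::] [::] (level m chi) (val u) (val u')) /=.
by rewrite (inj_eq val_inj) [u' == u]eq_sym mulrC.
Qed.

End def.
End stretch.

(** * Stretched matrices lie in the algebra and recover its elements *)

Section nuclearity.
Context (R : realType).
Local Notation C := R[i].
Local Notation W m := (bseq_of m bool).

(** The squared window weights sum to at most 1. The plateau discards the levels near 0, where
    windows do not fit, and makes the profile vanish near both ends, as coefficients of symbolic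
    bands must. *)
Definition profile (d Wd : R) (n k : nat) (t : R) : R :=
  plateau d t * Num.sqrt (win Wd n k t).

Definition coplateau (d t : R) : R := 1 - plateau d t ^+ 2.

Local Notation str d Wd n m := (@stretch R n m (profile d Wd n) (coplateau d)).

Lemma coplateau_ge0 d t : 0 <= coplateau d t.
Proof. by case/andP: (plateau_itv d t) => c0 c1; rewrite /coplateau subr_ge0 expr_le1. Qed.

Section fixed.
Context (d Wd : R).
Hypotheses (d0 : 0 < d) (Wd0 : 0 < Wd).

Lemma ucb_profile n k : ucb (profile d Wd n k).
Proof.
apply: ucbM; first exact: ucb_plateau.
by apply: ucb_sqrt; [exact: ucb_win|move=> t; exact: win_ge0].
Qed.

Lemma interior_supp_profile n k : interior_supp (profile d Wd n k).
Proof. exact/interior_suppMl/interior_supp_plateau. Qed.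

Lemma stretch1 n m : str d Wd n m 1%:M =
  bandmx m [::] [::] (fun w => (\sum_(i < n.+1) (i <= size w)%N%:R *
     profile d Wd n i ((size w)%:R / m%:R) ^+ 2 + coplateau d ((size w)%:R / m%:R))%:C%C).
Proof.
rewrite -(bandmx1 R n) (@stretch_bandmx R n m _ _ [::] [::] (fun=> 1)); last exact: coplateau_ge0.
rewrite (band_cat [::] [::]) eqxx mul1r scale1r bandmxD.
apply: eq_bandmx => w _ _; rewrite rmorphD; congr (_ + _).
rewrite rmorph_sum; apply: eq_bigr => i _.
rewrite !add0n /wt -[(i <= n)%N]ltnS ltn_ord mul1r.
by rewrite [RHS]rmorphM rmorph_nat expr2 [in RHS]rmorphM.
Qed.

Lemma sum_profile_le n t : 0 <= \sum_(i < n.+1) profile d Wd n i t ^+ 2 <= plateau d t ^+ 2.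
Proof.
rewrite sumr_ge0 => [|i _]; last exact: sqr_ge0.
under eq_bigr do rewrite exprMn sqr_sqrtr ?win_ge0 //.
rewrite -mulr_sumr ler_piMr ?sqr_ge0 //.
exact: (sum_win_le1 Wd n 0 n.+1 t).
Qed.

Lemma opnorm_stretch1 n m : opnorm (str d Wd n m 1%:M) <= 1.
Proof.
rewrite stretch1; apply: opnorm_bandmx => // w _ _.
rewrite normc_real; set t := _ / _; have /andP[s0 s1] := sum_profile_le n t.
set S := \sum_(i < _) _.
have S0 : 0 <= S by apply: sumr_ge0 => i _; rewrite mulr_ge0 ?sqr_ge0.
have Sle : S <= \sum_(i < n.+1) profile d Wd n i t ^+ 2.
  by apply: ler_sum => i _; rewrite ler_piMl ?sqr_ge0 // lern1 leq_b1.
have c0 := coplateau_ge0 d t.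
rewrite (ger0_norm (addr_ge0 S0 c0)) /coplateau.
by have := le_trans Sle s1; lra.
Qed.

(** The sum of the |V_j v|^2 is <T(1) v, v> with T the stretch, so the Kraus inequality follows from
    the bound on the stretch of 1. *)
Lemma kraus_stretch n m : kraus (str d Wd n m).
Proof.
exists (W m + W m)%type, (@stretchV R n m (profile d Wd n) (coplateau d)); split=> // v.
have -> : \sum_j l2norm (@stretchV R n m (profile d Wd n) (coplateau d) j *m v) ^+ 2 =
    rdot (str d Wd n m 1%:M *m v) v.
  rewrite mulmx_suml rdot_suml; apply: eq_bigr => j _.
  by rewrite mulmx1 -mulmxA rdot_adj adjK rdotvv.
rewrite (le_trans (rdot_le _ _)) // expr2 ler_wpM2r ?l2norm_ge0 //.
by rewrite (le_trans (l2norm_mulmx _ _)) // ler_piMl ?l2norm_ge0 ?opnorm_stretch1.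
Qed.

(** A matrix unit is the band whose coefficient lives on the empty word. Its stretch is a band with
    a product of two profiles, read at slightly shifted levels, plus a multiple of 1 - plateau^2. By
    linearity every stretched matrix then lies in the algebra. *)
Lemma approx_unit_stretch n al be :
  (size al <= n)%N -> (size be <= n)%N ->
  approximable (fun m => str d Wd n m (bandmx n al be (fun w => (size w == 0)%N%:R))).
Proof.
move=> aln ben.
set s := band al be (fun w => (size w == 0)%N%:R : C) (top_bseq n) (top_bseq n).
pose f t := profile d Wd n (size al) t * profile d Wd n (size be) t.
have fu : ucb f by apply: ucbM; exact: ucb_profile.
have fi : interior_supp f by apply/interior_suppMl/interior_supp_profile.
pose g t := plateau d t * plateau d t.
have gu : ucb g by apply: ucbM; exact: ucb_plateau.
have gi : interior_supp g by apply/interior_suppMl/interior_supp_plateau.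
have E m : str d Wd n m (bandmx n al be (fun w => (size w == 0)%N%:R)) =
    bandmx m al be (fun w => (profile d Wd n (size al) ((size al + size w)%:R / m%:R) *
      profile d Wd n (size be) ((size be + size w)%:R / m%:R))%:C%C)
    + s *: (1%:M - bandmx m [::] [::] (level m g)).
  rewrite (@stretch_bandmx R n m _ _ al be (fun k => (k == 0)%N%:R)); last exact: coplateau_ge0.
  congr (_ + _ *: _).
    apply: eq_bandmx => w _ _; rewrite big_ord_recl leq0n !mul1r !addn0 big1 ?addr0.
      by rewrite /wt aln ben [RHS]rmorphM.
    by move=> i _; rewrite !mul0r mulr0.
  rewrite -(bandmx1 R m) bandmxB; apply: eq_bandmx => w _ _.
  by rewrite /level /coplateau rmorphB expr2.
apply: approx_ext (fun m => esym (E m)) _.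
apply: approxD; last first.
  apply/symbolic_approx/SymbolicZ.
  have := SymbolicD (Symbolic1 R) (SymbolicZ (-1) (SymbolicBand [::] [::] gu gi)).
  congr symbolic; apply: functional_extensionality_dep => m.
  by rewrite scaleN1r.
have [[B pB] _] := ucb_profile n (size al).
have [[D qD] _] := ucb_profile n (size be).
have B0 : 0 <= B := le_trans (normr_ge0 _) (pB 0).
have D0 : 0 <= D := le_trans (normr_ge0 _) (qD 0).
apply: approx_closed => [e e0|]; last first.
  exists (B * D) => m; apply: opnorm_bandmx => [|w _ _]; first exact: mulr_ge0.
  by rewrite normc_real normrM ler_pM.
exists (fun m => bandmx m al be (level m f)); first exact/symbolic_approx/SymbolicBand.
have BD : 0 < B + D + 1 by rewrite ltr_wpDl // addr_ge0.
have [N1 h1] := ucb_shift (size al) (ucb_profile n (size al)) (divr_gt0 e0 BD).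
have [N2 h2] := ucb_shift (size be) (ucb_profile n (size be)) (divr_gt0 e0 BD).
exists (maxn N1 N2) => m; rewrite geq_max => /andP[m1 m2].
rewrite bandmxB; apply: opnorm_bandmx => [|w _ _]; first exact: ltW.
rewrite /level -rmorphB normc_real /f.
set x := profile _ _ _ _ _; set y := profile _ _ _ _ _.
set x' := profile _ _ _ _ _; set y' := profile _ _ _ _ _.
have -> : x * y - x' * y' = x * (y - y') + (x - x') * y' by ring.
rewrite (le_trans (ler_normD _ _)) // (normrM x) (normrM _ y').
apply: (@le_trans _ _ (B * (e / (B + D + 1)) + (e / (B + D + 1)) * D)).
  apply: lerD.
    by apply: ler_pM (normr_ge0 _) (normr_ge0 _) (pB _) _; exact/ltW/h2.
  by apply: ler_pM (normr_ge0 _) (normr_ge0 _) _ (qD _); exact/ltW/h1.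
rewrite [X in X + _]mulrC -mulrDr mulrAC ler_pdivrMr // ler_pM2l //.
by rewrite lerDl.
Qed.

Lemma approx_sum (I : Type) (r : seq I) (F : I -> forall m, 'M[C]_#|{: W m}|) :
  (forall i, approximable (F i)) -> approximable (fun m => \sum_(i <- r) F i m).
Proof.
move=> FA; elim: r => [|i r IHr].
  apply: approx_ext (approxZ 0 (symbolic_approx (Symbolic1 R))) => m.
  by rewrite big_nil scale0r.
by apply: approx_ext (approxD (FA i) IHr) => m; rewrite big_cons.
Qed.

Lemma stretch_sum n m (I : Type) (r : seq I) (c : I -> C) F :
  str d Wd n m (\sum_(i <- r) c i *: F i) = \sum_(i <- r) c i *: str d Wd n m (F i).
Proof.
elim: r => [|i r IHr]; last by rewrite !big_cons (kraus_linear (kraus_stretch n m)) IHr.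
by rewrite !big_nil (kraus0 (kraus_stretch n m)).
Qed.

Lemma approx_stretch n X : approximable (fun m => str d Wd n m X).
Proof.
have XE : X = \sum_(p : W n * W n) X (enum_rank p.1) (enum_rank p.2) *:
    bandmx n p.1 p.2 (fun w => (size w == 0)%N%:R).
  apply: opmxP => u v; rewrite summxE (bigD1 (u, v)) //= big1 => [|[a b] ab].
    rewrite mxE opmxE addr0 -[X in band _ _ _ X](cats0 (val u)) band_cat cats0.
    by rewrite eqxx !mulr1.
  rewrite mxE opmxE; case: bandP => [w|]; last by rewrite mulr0.
  case: w => [|x w]; last by rewrite mulr0.
  rewrite !cats0 => /val_inj uE /val_inj vE.
  by rewrite uE vE eqxx in ab.
apply: (@approx_ext _ (fun m => \sum_(p : W n * W n) X (enum_rank p.1) (enum_rank p.2) *: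
    str d Wd n m (bandmx n p.1 p.2 (fun w => (size w == 0)%N%:R)))).
  by move=> m; rewrite -stretch_sum -XE.
by apply: approx_sum => p; apply: approxZ; apply: approx_unit_stretch; exact: size_bseq.
Qed.

End fixed.

(* The quantifiers bound [d] above, [Wd] below in terms of [d], and [n] below
   in terms of both, so that finitely many elements share parameters. *)
Definition recovered (a : forall m, 'M[C]_#|{: W m}|) (e : R) : Prop :=
  exists2 d1, 0 < d1 & forall d, 0 < d -> d <= d1 ->
  exists2 W1, 0 < W1 & forall Wd, W1 <= Wd ->
  exists n1 : nat, forall n, (n1 <= n)%N -> forall m, (n <= m)%N ->
    opnorm (str d Wd n m (a n) - a m) <= e.

Lemma recovered1 e : 0 < e -> recovered (fun=> 1%:M) e.
Proof.
move=> e0; exists 1 => // d d0 _; exists 1 => // Wd Wd1.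
have Wd0 : 0 < Wd := lt_le_trans ltr01 Wd1.
(* Where the plateau is nonzero, t > d/2, and n > 2 Wd/d puts the window [t n - Wd, t n] inside
   [0, n]. The unit is then recovered exactly. *)
exists (Num.truncn (2 * Wd / d)).+1 => n nb m nm.
have nW : 2 * Wd / d < n%:R.
  by rewrite (lt_le_trans (truncnS_gt _)) ?ler_nat.
have n0 : (0 < n)%N by rewrite (leq_trans _ nb).
have m0 : 0 < m%:R :> R by rewrite ltr0n (leq_trans n0).
rewrite stretch1 // -(bandmx1 R m) bandmxB.
rewrite (_ : bandmx _ _ _ _ = 0) ?opnorm0 ?(ltW e0) //.
apply/matrixP => i j; rewrite !mxE; case: bandP => // w uE _.
have wm : (size w <= m)%N by rewrite -[w]cat0s -uE size_bseq.
apply/eqP; rewrite subr_eq0; apply/eqP; congr (_%:C)%C.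
set t := _ / _.
have -> : \sum_(i < n.+1) (i <= size w)%N%:R * profile d Wd n i t ^+ 2 =
    plateau d t ^+ 2 * \sum_(i < n.+1) win Wd n (0 + i) t.
  rewrite mulr_sumr; apply: eq_bigr => k _; rewrite exprMn sqr_sqrtr ?win_ge0 //.
  (* Since n <= m, t n = |w| n/m is at most |w|, and lengths above |w| carry no weight anyway. *)
  rewrite add0n; case: leqP => [_|wk]; rewrite ?mul1r // mul0r win_hi ?mulr0 //.
  rewrite /t mulrAC ler_pdivrMr // -!natrM ler_nat leq_mul // ltnW //.
rewrite /coplateau; have [->|c0] := eqVneq (plateau d t) 0.
  by rewrite expr0n mul0r add0r subr0.
have [td|td] := leP t (d / 2); first by rewrite plateau_eq0 ?td ?eqxx in c0.
rewrite sum_win ramp_eq1 // ?ramp_eq0 // ?subr0 ?mulr1; last 2 first.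
- rewrite sub0r lerN2; have : t * n%:R >= d / 2 * (2 * Wd / d).
    by rewrite ler_pM ?divr_ge0 ?mulr_ge0 ?(ltW d0) ?(ltW Wd0) // ltW.
  by have -> : d / 2 * (2 * Wd / d) = Wd by field; rewrite gt_eqF.
- rewrite add0n subr_ge0 -natr1; have t1 : t <= 1 by rewrite ler_pdivrMr // mul1r ler_nat.
  by rewrite (le_trans (ler_piMl _ t1)) // lerDl.
by rewrite addrC subrK.
Qed.

Lemma recoveredD a b e : recovered a (e / 2) -> recovered b (e / 2) ->
  recovered (fun m => a m + b m) e.
Proof.
move=> [da da0 ha] [db db0 hb]; exists (Num.min da db); first by rewrite lt_min da0.
move=> d d0; rewrite le_min => /andP[/(ha d d0)[Wa Wa0 {}ha] /(hb d d0)[Wb Wb0 {}hb]].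
exists (Num.max Wa Wb); first by rewrite lt_max Wa0.
move=> Wd; rewrite ge_max => /andP[WaW WbW].
have Wd0 : 0 < Wd := lt_le_trans Wa0 WaW.
have [na {}ha] := ha Wd WaW; have [nb {}hb] := hb Wd WbW.
exists (maxn na nb) => n; rewrite geq_max => /andP[nan nbn] m nm.
rewrite (krausD (kraus_stretch d Wd0 n m)).
rewrite opprD addrACA (le_trans (ler_opnormD _ _)) // (splitr e).
by apply: lerD; [exact: ha|exact: hb].
Qed.

Lemma recoveredZ c a e : recovered a (e / (normc c + 1)) -> 0 < e ->
  recovered (fun m => c *: a m) e.
Proof.
move=> [d1 d10 ha] e0; have c0 : 0 < normc c + 1 by rewrite ltr_wpDl ?normc_ge0.
exists d1 => // d d0 dd; have [W1 W10 {}ha] := ha d d0 dd.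
exists W1 => // Wd WW; have [n1 {}ha] := ha Wd WW; exists n1 => n nn m nm.
have Wd0 := lt_le_trans W10 WW.
rewrite (krausZ (kraus_stretch d Wd0 n m)).
rewrite -scalerBr opnormZ (le_trans (ler_wpM2l (normc_ge0 c) (ha n nn m nm))) //.
by rewrite mulrCA ger_pMr // ler_pdivrMr // mul1r lerDl.
Qed.

(** The approximation error is paid at level [n], where the contractive stretch does not enlarge it,
    and once more at level [m]. *)
Lemma recovered_asymp a b e e' : asymp a b e' -> 0 < e' -> recovered b e ->
  recovered a (e' + e + e').
Proof.
move=> [N ab] e'0 [d1 d10 hb]; exists d1 => // d d0 dd.
have [W1 W10 {}hb] := hb d d0 dd; exists W1 => // Wd WW.
have Wd0 := lt_le_trans W10 WW.
have [n1 {}hb] := hb Wd WW; exists (maxn n1 N) => n; rewrite geq_max => /andP[n1n Nn] m nm.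
have -> : str d Wd n m (a n) - a m = str d Wd n m (a n - b n) +
    (str d Wd n m (b n) - b m) + (b m - a m).
  by rewrite (krausB (kraus_stretch d Wd0 n m)) subrKA subrKA.
rewrite (le_trans (ler_opnormD _ _)) // lerD //; last first.
  by rewrite opnorm_distC ab // (leq_trans Nn).
rewrite (le_trans (ler_opnormD _ _)) // lerD //; last exact: hb.
by rewrite (le_trans (kraus_opnorm (kraus_stretch d Wd0 n m) _)) // ab.
Qed.

Lemma natr_gt (x : R) : exists N : nat, forall n, (N <= n)%N -> x < n%:R.
Proof.
by exists (Num.truncn x).+1 => n Nn; rewrite (lt_le_trans (truncnS_gt x)) ?ler_nat.
Qed.

(** The stretch averages f(i/n) with weights [P i] over a window ending near |w| n/m. Two errors
    arise: [f] varies over the window, which [n] large against [Wd] controls, and the windows of al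
    w and be w overlap imperfectly, which [Wd] large against |al| + |be| controls. *)
Lemma recovered_band al be f e : ucb f -> interior_supp f -> 0 < e ->
  recovered (fun m => bandmx m al be (level m f)) e.
Proof.
move=> [[B fB] fc] fi e0; have [r r0 fr] := fi.
have B0 : 0 <= B := le_trans (normr_ge0 _) (fB 0).
have e20 : 0 < e / 2 by rewrite divr_gt0.
have [q q0 fq] := fc _ e20.
set a := size al; set b := size be; set L : R := a%:R + b%:R.
have L0 : 0 <= L by rewrite addr_ge0.
(* Half of the margin around the support of [f]; the other half absorbs the shifts |al|/m and
   |be|/m, so that the plateau is 1 wherever f(|w|/m) is nonzero. *)
exists (r / 2); first by rewrite divr_gt0.
(* The three terms ensure Wd > 0, L <= Wd and B L/Wd <= e/2. *)
move=> d d0 dr; exists (1 + L + 2 * B * L / e).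
  by rewrite -addrA ltr_pwDl // addr_ge0 // !mulr_ge0 ?invr_ge0 // ltW.
move=> Wd WW; have Wd0 : 0 < Wd.
  apply: lt_le_trans WW; rewrite -addrA ltr_pwDl // addr_ge0 // !mulr_ge0 ?invr_ge0 //.
  exact: ltW.
have LW : L <= Wd.
  by apply: le_trans WW; rewrite addrAC lerDr addr_ge0 // !mulr_ge0 ?invr_ge0 // ltW.
have BL : B * (L / Wd) <= e / 2.
  rewrite mulrA ler_pdivrMr // -ler_pdivrMl //.
  have -> : (e / 2)^-1 * (B * L) = 2 * B * L / e by field; rewrite gt_eqF.
  by apply: le_trans WW; rewrite lerDr addr_ge0.
(* [N1] keeps i/n within [q] of |w|/m for the indices [i] met by the window; [N2] makes the windows
   start beyond [al] and [be]; [N3] kills the entry at the top word; [N4] bounds the shifts of level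
   by r/2. *)
have [N1 h1] := natr_gt ((Wd + 1 + L) / q).
have [N2 h2] := natr_gt ((Wd + L) / d).
have [N3 h3] := interior_supp_tail a.+1 fi.
have [N4 h4] := natr_gt (2 * L / r).
exists (maxn (maxn N1 N2) (maxn N3 N4)) => n; rewrite !geq_max.
move=> /andP[/andP[/h1{}h1 /h2{}h2] /andP[/h3{}h3 n4]] m nm.
have {}h4 : 2 * L / r < m%:R by apply: h4; exact: leq_trans nm.
have n0 : 0 < n%:R :> R by apply: le_lt_trans h2; rewrite divr_ge0 ?addr_ge0 // ltW.
have m0 : 0 < m%:R :> R by rewrite (lt_le_trans n0) ?ler_nat.
have nm1 : n%:R / m%:R <= 1 :> R by rewrite ler_pdivrMr // mul1r ler_nat.
rewrite (@stretch_bandmx R n m _ _ al be (fun k => (f (k%:R / n%:R))%:C%C)); last first.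
  exact: coplateau_ge0.
rewrite (_ : band _ _ _ _ _ = 0) ?scale0r ?addr0; last first.
  case: bandP => // w /(congr1 size); rewrite /= size_nseq size_cat -/a => nE _.
  by rewrite h3 // addSn ltnS nE.
rewrite bandmxB; apply: opnorm_bandmx => [|w am bm]; first exact: ltW.
pose t : R := (a + size w)%:R / m%:R; pose t' : R := (b + size w)%:R / m%:R.
pose tau : R := (size w)%:R / m%:R.
have t01 : 0 <= t <= 1 by rewrite divr_ge0 //= ler_pdivrMr // mul1r ler_nat.
have t'01 : 0 <= t' <= 1 by rewrite divr_ge0 //= ler_pdivrMr // mul1r ler_nat.
have tE : t = tau + a%:R / m%:R by rewrite /t natrD mulrDl addrC.
have t'E : t' = tau + b%:R / m%:R by rewrite /t' natrD mulrDl addrC.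
pose P i : R := Num.sqrt (win Wd n (a + i) t) * Num.sqrt (win Wd n (b + i) t').
have P0 i : 0 <= P i by rewrite mulr_ge0 ?sqrtr_ge0.
have anm : t * n%:R = tau * n%:R + a%:R * (n%:R / m%:R) :> R.
  by rewrite tE; ring.
have an : a%:R * (n%:R / m%:R) <= a%:R :> R by rewrite ler_piMr.
(* A nonzero overlap already forces the three cut-offs on [i], which can therefore be dropped from
   the sum. *)
have Pne i : P i != 0 -> [/\ (i <= size w)%N, (a + i <= n)%N, (b + i <= n)%N &
    `|i%:R / n%:R - tau| < q].
  move=> Pi.
  have wa : win Wd n (a + i) t != 0.
    by apply: contra_neq Pi => E; rewrite /P E sqrtr0 mul0r.
  have wb : win Wd n (b + i) t' != 0.
    by apply: contra_neq Pi => E; rewrite /P E sqrtr0 mulr0.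
  have ai : (a + i)%:R < t * n%:R.
    by rewrite ltNge; apply: contra wa => /(win_hi Wd0) ->.
  have ai' : t * n%:R - Wd < (a + i).+1%:R.
    by rewrite ltNge; apply: contra wa => /(win_lo Wd0) ->.
  have bi : (b + i)%:R < t' * n%:R.
    by rewrite ltNge; apply: contra wb => /(win_hi Wd0) ->.
  have iw : i%:R < tau * n%:R.
    by move: ai; rewrite anm natrD; lra.
  split.
  - rewrite -(ler_nat R) ltW // (lt_le_trans iw) //.
    by rewrite /tau mulrAC -mulrA ler_piMr.
  - rewrite -(ler_nat R) ltW // (lt_le_trans ai) // ler_piMl //.
    by case/andP: t01.
  - rewrite -(ler_nat R) ltW // (lt_le_trans bi) // ler_piMl //.
    by case/andP: t'01.
  - have -> : i%:R / n%:R - tau = (i%:R - tau * n%:R) / n%:R.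
      by field; rewrite !gt_eqF.
    rewrite normrM normfV (ger0_norm (ltW n0)) ltr_pdivrMr // distrC ger0_norm; last first.
      by rewrite subr_ge0 ltW.
    have : Wd + 1 + L < q * n%:R by rewrite -ltr_pdivrMl // mulrC.
    have a0 : 0 <= a%:R * (n%:R / m%:R) :> R by rewrite mulr_ge0 ?divr_ge0.
    move: ai'; rewrite anm -natr1 natrD /L.
    have : 0 <= b%:R :> R by [].
    lra.
pose eta := plateau d t * plateau d t'.
have eta01 : 0 <= eta <= 1.
  case/andP: (plateau_itv d t) => p0 p1; case/andP: (plateau_itv d t') => p'0 p'1.
  by rewrite mulr_ge0 //= mulr_ile1.
have -> : \sum_(i < n.+1) (i <= size w)%N%:R * ((f (i%:R / n%:R))%:C%C *
      wt n m (profile d Wd n) (size al + i) (size al + size w) *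
      wt n m (profile d Wd n) (size be + i) (size be + size w)) =
    (\sum_(i < n.+1) f (i%:R / n%:R) * (eta * P i))%:C%C.
  rewrite rmorph_sum; apply: eq_bigr => i _; rewrite -/a -/b /wt.
  have PE : eta * P i = profile d Wd n (a + i) t * profile d Wd n (b + i) t'.
    by rewrite /eta /P /profile; ring.
  have [Pi|/Pne[-> -> -> _]] := eqVneq (P i) 0; last first.
    by rewrite mul1r PE -mulrA -!rmorphM.
  case: leqP => _; last by rewrite mul0r Pi !mulr0.
  case: leqP => _; last by rewrite !(mulr0, mul0r) Pi !mulr0.
  case: leqP => _; last by rewrite !(mulr0, mul0r) Pi !mulr0.
  by rewrite mul1r PE -mulrA -!rmorphM.
rewrite /level -rmorphB normc_real -/tau.
have -> : \sum_(i < n.+1) f (i%:R / n%:R) * (eta * P i) - f tau =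
    \sum_(i < n.+1) (f (i%:R / n%:R) - f tau) * (eta * P i) +
    f tau * (eta * \sum_(i < n.+1) P i - 1).
  under [X in _ = X + _]eq_bigr do rewrite mulrBl.
  by rewrite sumrB -!mulr_sumr; ring.
have S1 : \sum_(i < n.+1) P i <= 1 by exact: overlap_le1.
have S0 : 0 <= \sum_(i < n.+1) P i by rewrite sumr_ge0.
case/andP: eta01 => eta0 eta1.
rewrite (le_trans (ler_normD _ _)) // (splitr e) lerD //.
  rewrite (le_trans (ler_norm_sum _ _ _)) //.
  apply: (@le_trans _ _ (\sum_(i < n.+1) e / 2 * P i)).
    apply: ler_sum => i _; rewrite normrM (ger0_norm (mulr_ge0 eta0 (P0 i))).
    have [->|/Pne[_ _ _ /fq/ltW fi']] := eqVneq (P i) 0; first by rewrite !mulr0.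
    exact: ler_pM (normr_ge0 _) (mulr_ge0 eta0 (P0 i)) fi' (ler_piMl (P0 i) eta1).
  by rewrite -mulr_sumr ler_piMr // ltW.
(* The defects of [eta] and of the overlap are weighted by f tau, so they count only on the support
   of [f], where [eta] is 1. *)
have [->|ft] := eqVneq (f tau) 0; first by rewrite mul0r normr0 ltW.
have {ft} : (r < tau) && (tau < 1 - r).
  by rewrite !ltNge -negb_or; apply: contra ft => /fr ->.
move=> /andP[rt tr].
have Lr : L / m%:R <= r / 2.
  rewrite ler_pdivrMr // -ler_pdivrMl ?divr_gt0 //.
  by have -> : (r / 2)^-1 * L = 2 * L / r; [field; rewrite gt_eqF|exact: ltW].
have aL : a%:R / m%:R <= L / m%:R :> R by rewrite ler_pM2r ?invr_gt0 // lerDl.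
have bL : b%:R / m%:R <= L / m%:R :> R by rewrite ler_pM2r ?invr_gt0 // lerDr.
have a0 : 0 <= a%:R / m%:R :> R by rewrite divr_ge0.
have b0 : 0 <= b%:R / m%:R :> R by rewrite divr_ge0.
have Wdn : Wd + L < d * n%:R by rewrite -ltr_pdivrMl // mulrC.
have td : d <= t <= 1 - d.
  by rewrite tE; apply/andP; split; clear - dr r0 Lr aL a0 rt tr; lra.
have t'd : d <= t' <= 1 - d.
  by rewrite t'E; apply/andP; split; clear - dr r0 Lr bL b0 rt tr; lra.
have -> : eta = 1 by rewrite /eta !plateau_eq1 ?mulr1.
rewrite mul1r normrM; apply: le_trans BL; apply: ler_pM => //.
rewrite ler0_norm ?subr_le0 // opprB lerBlDr addrC -lerBlDr.
apply: overlap_ge => //.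
- have aL' : a%:R <= L by rewrite lerDl.
  have dt : d * n%:R <= t * n%:R by rewrite ler_pM2r //; case/andP: td.
  by clear - aL' dt Wdn; lra.
- have bL' : b%:R <= L by rewrite lerDr.
  have dt : d * n%:R <= t' * n%:R by rewrite ler_pM2r //; case/andP: t'd.
  by clear - bL' dt Wdn; lra.
- rewrite ler_norml; have tt : t' * n%:R = tau * n%:R + b%:R * (n%:R / m%:R).
    by rewrite t'E; ring.
  have bn : b%:R * (n%:R / m%:R) <= b%:R :> R by rewrite ler_piMr.
  have an0 : 0 <= a%:R * (n%:R / m%:R) :> R by rewrite mulr_ge0 ?divr_ge0.
  have bn0 : 0 <= b%:R * (n%:R / m%:R) :> R by rewrite mulr_ge0 ?divr_ge0.
  by rewrite anm tt /L; clear - an bn an0 bn0; apply/andP; split; lra.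
Qed.

Lemma recovered_symbolic s : symbolic s -> forall e, 0 < e -> recovered s e.
Proof.
elim=> [e|al be f fu fi e|s1 s2 _ h1 _ h2 e e0|c s1 _ h1 e e0].
- exact: recovered1.
- exact: recovered_band.
- by apply: recoveredD; [apply: h1|apply: h2]; rewrite divr_gt0.
- by apply: recoveredZ => //; apply: h1; rewrite divr_gt0 // ltr_wpDl ?normc_ge0.
Qed.

Lemma recovered_approximable a e : approximable a -> 0 < e -> recovered a e.
Proof.
move=> [_ ha] e0; have e30 : 0 < e / 3 by rewrite divr_gt0.
have [s ss as_] := ha _ e30.
have -> : e = e / 3 + e / 3 + e / 3 by field.
exact: recovered_asymp (recovered_symbolic ss e30).
Qed.

Lemma recovered_seq (F : seq (subalg (fock R))) (e : R) : 0 < e ->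
  exists2 d1, 0 < d1 & forall d, 0 < d -> d <= d1 ->
  exists2 W1, 0 < W1 & forall Wd, W1 <= Wd ->
  exists n1 : nat, forall n, (n1 <= n)%N -> forall a : subalg (fock R), a \in F ->
    forall m, (n <= m)%N -> opnorm (str d Wd n m (slot a n) - slot a m) <= e.
Proof.
move=> e0; elim: F => [|a F [dF dF0 hF]].
  by exists 1 => // d _ _; exists 1 => // Wd _; exists 0%N.
have [da da0 ha] := recovered_approximable (slotP a) e0.
exists (Num.min da dF); first by rewrite lt_min da0.
move=> d d0; rewrite le_min => /andP[/(ha d d0)[Wa Wa0 {}ha] /(hF d d0)[WF WF0 {}hF]].
exists (Num.max Wa WF); first by rewrite lt_max Wa0.
move=> Wd; rewrite ge_max => /andP[/ha[na {}ha] /hF[nF {}hF]].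
exists (maxn na nF) => n; rewrite geq_max => /andP[/ha{}ha /hF{}hF] b.
by rewrite in_cons => /predU1P[-> //|]; exact: hF.
Qed.

(** * Factorization through the first n + 1 blocks *)

Section factorization.
Context (d Wd : R) (n : nat).
Hypothesis Wd0 : 0 < Wd.
Local Notation A := (subalg (fock R)).
Local Notation D := (\sum_(i < n.+1) #|{: W i}|)%N.

Definition compress (a : A) : 'M[C]_D := \mxdiag_(i < n.+1) slot a i.

(** The test is matched together with its proof, from which the ordinal index of the diagonal block
    is built. *)
Definition extend_slot (X : 'M[C]_D) (m : nat) : 'M[C]_#|{: W m}| :=
  match @idP (m < n.+1)%N with
  | ReflectT mn => submxblock X (Ordinal mn) (Ordinal mn)
  | ReflectF _ => str d Wd n m (submxblock X ord_max ord_max)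
  end.

Lemma extend_slot_lt X m (mn : (m < n.+1)%N) :
  extend_slot X m = submxblock X (Ordinal mn) (Ordinal mn).
Proof.
rewrite /extend_slot; destruct (@idP (m < n.+1)%N) as [mn'|] => //.
by rewrite (bool_irrelevance mn mn').
Qed.

Lemma extend_slot_ge X m : ~~ (m < n.+1)%N ->
  extend_slot X m = str d Wd n m (submxblock X ord_max ord_max).
Proof.
by move=> /negP mn; rewrite /extend_slot; destruct (@idP (m < n.+1)%N).
Qed.

Lemma kraus_submxblock (i : 'I_n.+1) :
  kraus (fun X : 'M[C]_D => submxblock X i i).
Proof. by apply: kraus_mxsub; exact: Rank_inj. Qed.

Lemma kraus_ext N p (T T' : 'M[C]_N -> 'M[C]_p) : T =1 T' -> kraus T -> kraus T'.
Proof. by move=> /funext ->. Qed.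

Lemma kraus_extend m : kraus (extend_slot ^~ m).
Proof.
have [mn|mn] := boolP (m < n.+1)%N.
  apply: kraus_ext (kraus_submxblock (Ordinal mn)) => X.
  by rewrite extend_slot_lt.
apply: kraus_ext (kraus_comp (kraus_submxblock ord_max) (kraus_stretch d Wd0 n m)) => X.
by rewrite extend_slot_ge.
Qed.

(** Finitely many blocks do not affect approximability, so only the stretch of the last one
    matters. *)
Lemma approximable_extend X : 0 < d -> approximable (extend_slot X).
Proof.
move=> d0; have [[B XB] hX] :=
  approx_stretch d0 Wd0 (submxblock X ord_max ord_max : 'M[C]_#|{: W n}|).
split; first by exists (opnorm X) => m; exact: kraus_opnorm (kraus_extend m) X.
move=> e e0; have [s ss [N h]] := hX e e0; exists s => //.
exists (maxn N n.+1) => m; rewrite geq_max => /andP[/h{}h nm].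
by rewrite extend_slot_ge // -leqNgt.
Qed.

Lemma extend_compress (a : A) m :
  extend_slot (compress a) m =
  if (m < n.+1)%N then slot a m else str d Wd n m (slot a n).
Proof.
have [mn|mn] := boolP (m < n.+1)%N.
  by rewrite extend_slot_lt (submxblock_diag (fun i : 'I_n.+1 => slot a i)).
by rewrite extend_slot_ge // (submxblock_diag (fun i : 'I_n.+1 => slot a i)).
Qed.

Lemma compressM a b : compress (a * b) = compress a *m compress b.
Proof.
rewrite /compress [in RHS]/mxdiag -/(mxdiag _) mul_mxdiag_mxblock.
apply: eq_mxblock => i j; case: eqP => [<-|_]; last by rewrite mulmx0.
by rewrite !conform_mx_id.
Qed.

Lemma compress_star a : compress (star a) = adj (compress a).
Proof.
rewrite /compress /mxdiag.
transitivity (\mxblock_(i < n.+1, j < n.+1)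
    adj (if j == i then conform_mx 0 (slot a j) else 0 : 'M[C]_(#|{: W j}|, #|{: W i}|))).
  apply: eq_mxblock => i j; rewrite eq_sym; case: eqP => [->|_]; last by rewrite raddf0.
  by rewrite !conform_mx_id.
by apply/matrixP => i j; rewrite !mxE.
Qed.

Lemma compress_linear c a b : compress (c *: a + b) = c *: compress a + compress b.
Proof.
apply/mxblockP => i j; rewrite !mxblockK.
rewrite submxblockD [submxblock (c *: _) _ _](_ : _ = c *: submxblock (compress a) i j).
  rewrite !mxblockK; case: eqP => [<-|_]; last by rewrite scaler0 addr0.
  by rewrite !conform_mx_id.
by apply/matrixP => k l; rewrite !mxE.
Qed.

End factorization.

End nuclearity.

Theorem nuclear_fock (R : realType) : nuclear (subalg (fock R)).
Proof.
move=> F e e0; have e20 : 0 < e / 2 by rewrite divr_gt0.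
(* All three parameters are taken at their thresholds, common to the whole of [F]. *)
have [d d0 /(_ d d0 (lexx d))[Wd Wd0 /(_ Wd (lexx _))[n /(_ n (leqnn n)) hF]]] :=
  recovered_seq F e20.
pose phi : subalg (fock R) -> _ := @compress R n.
pose psi (X : 'M[R[i]]_(\sum_(i < n.+1) #|{: i.-bseq bool}|)) : subalg (fock R) :=
  @Subalg R (fock R) _ (approximable_extend Wd0 X d0).
have phiL : linear phi by move=> c a b; exact: compress_linear.
have psiL : linear psi.
  move=> c X Y; apply: subalg_inj => m.
  exact: kraus_linear (@kraus_extend R d Wd n Wd0 m) c X Y.
pose phiH := GRing.isLinear.Build _ _ _ _ phi phiL.
pose psiH := GRing.isLinear.Build _ _ _ _ psi psiL.
pose Phi : {linear subalg (fock R) -> 'M[R[i]]_(\sum_(i < n.+1) #|{: i.-bseq bool}|)} :=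
  HB.pack phi phiH.
pose Psi : {linear 'M[R[i]]_(\sum_(i < n.+1) #|{: i.-bseq bool}|) -> subalg (fock R)} :=
  HB.pack psi psiH.
exists (\sum_(i < n.+1) #|{: i.-bseq bool}|)%N, Phi, Psi; split.
- split=> [k _ [Y ->]|a].
    (* [phi] is a *-homomorphism, so the image of Y^* Y has the same form. *)
    exists (map_mx phi Y); apply/matrixP => i j; rewrite !mxE raddf_sum.
    by apply: eq_bigr => l _; rewrite !mxE /= /phi compressM compress_star.
  apply: opnorm_mxdiag => [|i]; first exact: cnorm_ge0.
  exact: (@opnorm_le_subnorm R (fock R) a i).
- split=> [k _ [Y ->]|X]; last first.
    apply: subnorm_le => m; exact: kraus_opnorm (@kraus_extend R d Wd n Wd0 m) X.
  (* In every block [psi] is a Kraus map, which gives positive forms; this lemma converts them into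
     a root in M_k(A). *)
  apply: star_positive_mcoord => [|m v].
    have ME i j : (star Y * Y) i j = adj ((star Y * Y) j i).
      by rewrite -[in LHS](starK Y) -starM [LHS]mxE starK.
    apply/matrixP => i j; rewrite [RHS]mxE ME mxE mxE.
    apply: subalg_inj => m; rewrite slot_star.
    exact/esym/(kraus_adj (@kraus_extend R d Wd n Wd0 m)).
  pose T (X : 'M[R[i]]_(\sum_(i < n.+1) #|{: i.-bseq bool}|)) := extend_slot d Wd X m.
  have -> : mcoord m (map_mx Psi (star Y * Y)) = flat (map_mx T (star Y * Y)).
    by congr flat; apply/matrixP => i j; rewrite !mxE.
  exact: (@kraus_pos R _ _ T (@kraus_extend R d Wd n Wd0 m)).
- move=> a aF; apply: (@le_lt_trans _ _ (e / 2)); last first.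
    by rewrite ltr_pdivrMr // ltr_pMr // ltr1n.
  rewrite -[cnorm _]/(subnorm (psi (phi a) - a)); apply: subnorm_le => m; rewrite slotB /= extend_compress.
  case: ltnP => [_|/ltnW nm]; first by rewrite subrr opnorm0 ltW.
  exact: hF.
Qed.

(** * Non-amenability *)

Section trace.
Context (R : realType) (S : closed_subalg R).
Local Notation C := R[i].
Local Notation A := (subalg S).

(** The case of 1 x 1 matrices in [msqrt]. The commutation of [z] with [h] is what makes h + i z
    unitary. *)
Lemma sqrt_contraction (h : A) : star h = h -> cnorm h <= 1 ->
  exists z : A, [/\ star z = z, z * z = 1 - h * h & h * z = z * h].
Proof.
move=> hs h1; pose X : 'M[A]_1 := (h * h)%:M.
have X1 : mbounded X 1.
  move=> m; rewrite (le_trans (opnorm_flat _)) // !big_ord1 !mxE eqxx mulr1n.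
  apply: le_trans (opnorm_le_subnorm (h * h) m) _.
  apply: le_trans (ler_cnormM h h) _.
  by rewrite mulr_ile1 ?cnorm_ge0.
have Xs : star X = X.
  by apply/matrixP => i j; rewrite !ord1 !mxE !eqxx !mulr1n starM hs.
have [Z [Zs ZZ Zh]] := msqrt X1 Xs.
exists (Z 0 0); split.
- by move/matrixP/(_ 0 0): Zs; rewrite mxE.
- by move/matrixP/(_ 0 0): ZZ; rewrite !mxE big_ord1 eqxx !mulr1n.
- have /Zh/matrixP/(_ 0 0) : h%:M * X = X * h%:M.
    apply/matrixP => i j; rewrite !ord1 !mxE !big_ord1 !mxE !eqxx !mulr1n.
    by rewrite mulrA.
  by rewrite !mxE !big_ord1 !mxE eqxx !mulr1n.
Qed.

Lemma addrr_inj (x y : C) : x + x = y + y -> x = y.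
Proof.
move=> xy; apply: (@mulIf _ 2); first by rewrite pnatr_eq0.
by rewrite !mulr_natr !mulr2n.
Qed.

Context (tau : A -> C).
Hypothesis tau_linear : forall c a b, tau (c *: a + b) = c * tau a + tau b.
Hypothesis tau_conj : forall u a, unitary u -> tau (star u * a * u) = tau a.

Lemma tau0 : tau 0 = 0.
Proof.
by have := tau_linear (-1) 0 0; rewrite scaler0 addr0 mulN1r addNr.
Qed.

Lemma tauZ c a : tau (c *: a) = c * tau a.
Proof. by rewrite -[c *: a]addr0 tau_linear tau0 addr0. Qed.

Lemma tauD a b : tau (a + b) = tau a + tau b.
Proof. by rewrite -[a]scale1r tau_linear mul1r scale1r. Qed.

Lemma tauB a b : tau (a - b) = tau a - tau b.
Proof. by rewrite tauD -scaleN1r tauZ mulN1r. Qed.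

Lemma tau_unitary u a : unitary u -> tau (u * a) = tau (a * u).
Proof.
move=> uu; rewrite -(tau_conj (u * a) uu) mulrA.
by case/andP: uu => /eqP -> _; rewrite mul1r.
Qed.

(* A self-adjoint contraction [h] is the mean of the unitaries [h + i z] and
   [h - i z] with [z = sqrt (1 - h^2)]. *)
Lemma tau_contraction h a : star h = h -> cnorm h <= 1 -> tau (h * a) = tau (a * h).
Proof.
move=> hs h1; have [z [zs zz hz]] := sqrt_contraction hs h1.
pose u (s : C) := h + (s * 'i%C) *: z.
have uu (s : C) : conjc s = s -> s * s = 1 -> unitary (u s).
  move=> sr s1; have ci : conjc (s * 'i%C) = - (s * 'i%C).
    rewrite rmorphM /= sr -mulrN; congr (_ * _).
    by apply/eqP; rewrite eq_complex /= oppr0 !eqxx.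
  have ii : s * 'i%C * (s * 'i%C) = -1 :> C.
    by rewrite mulrACA s1 mul1r -expr2 sqr_i.
  rewrite /unitary /u starD starZ hs zs ci.
  apply/andP; split; apply/eqP; rewrite mulrDl !mulrDr -!scalerAl -!scalerAr !scalerA.
    by rewrite mulNr ii opprK scale1r zz hz scaleNr addrA addrK addrC subrK.
  by rewrite mulrN ii opprK scale1r zz hz scaleNr addrA subrK addrC subrK.
have u1 : unitary (u 1) by apply: uu; rewrite ?conjc1 ?mulr1.
have u2 : unitary (u (-1)) by apply: uu; rewrite ?rmorphN1 ?mulrNN ?mulr1.
have hE : h + h = u 1 + u (-1).
  by rewrite /u addrACA mul1r mulN1r -scalerDl addrN scale0r addr0.
apply: addrr_inj; rewrite -(tauD (h * a)) -(tauD (a * h)) -mulrDl -mulrDr hE.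
rewrite mulrDl mulrDr (tauD (u 1 * a)) (tauD (a * u 1)).
by rewrite (tau_unitary a u1) (tau_unitary a u2).
Qed.

Lemma tau_selfadjoint h a : star h = h -> tau (h * a) = tau (a * h).
Proof.
move=> hs; pose c : R := cnorm h + 1.
have c0 : 0 < c by rewrite ltr_wpDl ?cnorm_ge0.
have hE : h = c%:C%C *: ((c^-1)%:C%C *: h).
  by rewrite scalerA -rmorphM /= mulfV ?gt_eqF // scale1r.
rewrite hE -scalerAl -scalerAr !tauZ; congr (_ * _).
apply: tau_contraction; first by rewrite starZ conjc_real hs.
rewrite cnormZ normc_real ger0_norm ?invr_ge0 ?(ltW c0) //.
by rewrite ler_pdivrMl // mulr1 lerDl.
Qed.

(** 2a is the self-adjoint a + a^* plus i times the self-adjoint i(a^* - a); doubling avoids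
    fractions in the algebra. *)
Lemma tau_tracial a b : tau (a * b) = tau (b * a).
Proof.
have aE : (a + star a) + 'i%C *: ('i%C *: (star a - a)) = a + a.
  rewrite scalerA -expr2 sqr_i scaleN1r opprB addrACA.
  by rewrite subrr addr0.
have t1 : tau ((a + star a) * b) = tau (b * (a + star a)).
  by apply: tau_selfadjoint; rewrite starD starK addrC.
have t2 : tau ('i%C *: (star a - a) * b) = tau (b * ('i%C *: (star a - a))).
  apply: tau_selfadjoint.
  rewrite starZ starB starK -(opprB (star a) a) scalerN -scaleNr.
  by congr (_ *: _); apply/eqP; rewrite eq_complex /= opprK oppr0 !eqxx.
apply: addrr_inj; rewrite -(tauD (a * b)) -(tauD (b * a)) -mulrDl -mulrDr -aE.
rewrite mulrDl mulrDr (tauD ((a + star a) * b)) (tauD (b * (a + star a))) t1.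
by rewrite -scalerAl -scalerAr !tauZ t2.
Qed.

End trace.

(** * The limit state at the middle level *)

Section middle_state.
Context (R : realType).
Local Notation C := R[i].
Local Notation W m := (bseq_of m bool).
Local Notation A := (subalg (fock R)).

Definition tends (x : nat -> C) (l : C) : Prop :=
  forall e : R, 0 < e -> exists N : nat, forall n, (N <= n)%N -> normc (x n - l) < e.

Lemma tends_unique x l l' : tends x l -> tends x l' -> l = l'.
Proof.
move=> xl xl'; apply/eqP; rewrite -subr_eq0; apply/eqP/eq0_normc/eqP.
rewrite eq_le normc_ge0 andbT; apply/ler_addgt0Pr => e e0; rewrite add0r.
have [N1 h1] := xl _ (divr_gt0 e0 (ltr0n _ 2)).
have [N2 h2] := xl' _ (divr_gt0 e0 (ltr0n _ 2)).
pose n := maxn N1 N2; rewrite -(subrKA (x n)) (le_trans (le_normcD _ _)) //.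
rewrite (splitr e) lerD //; last by apply/ltW/h2; exact: leq_maxr.
by rewrite -normcN opprB; apply/ltW/h1; exact: leq_maxl.
Qed.

Lemma tends_lin c x y l k : tends x l -> tends y k ->
  tends (fun n => c * x n + y n) (c * l + k).
Proof.
move=> xl yk e e0; have c0 : 0 < normc c + 1 by rewrite ltr_wpDl ?normc_ge0.
have e20 : 0 < e / 2 by rewrite divr_gt0.
have [N1 h1] := xl _ (divr_gt0 e20 c0); have [N2 h2] := yk _ e20.
exists (maxn N1 N2) => n; rewrite geq_max => /andP[n1 n2].
rewrite opprD addrACA -mulrBr (le_lt_trans (le_normcD _ _)) // (splitr e).
rewrite ler_ltD ?h2 // normcM.
rewrite (le_trans (ler_wpM2l (normc_ge0 c) (ltW (h1 n n1)))) //.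
by rewrite mulrCA ger_pMr // ler_pdivrMr // mul1r lerDl.
Qed.

Lemma tends_cst c : tends (fun=> c) c.
Proof. by move=> e e0; exists 0%N => n _; rewrite subrr [normc _]normc0. Qed.

Lemma tends_eventually x l : (exists N : nat, forall n, (N <= n)%N -> x n = l) -> tends x l.
Proof.
by move=> [N h] e e0; exists N => n /h ->; rewrite subrr [normc _]normc0.
Qed.

Lemma normc_tends_le x l B : tends x l -> (forall n, normc (x n) <= B) -> normc l <= B.
Proof.
move=> xl xB; apply/ler_addgt0Pr => e e0; have [N /(_ N (leqnn N)) h] := xl e e0.
rewrite -[l](subrK (x N)) addrC (le_trans (le_normcD _ _)) // lerD //.
by rewrite -normcN opprB ltW.
Qed.

Fact half_le m : (m./2 <= m)%N.
Proof. by rewrite leq_half_double -addnn -addSn leq_addl. Qed.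

Definition mid m : W m := Bseq (leq_trans (eq_leq (size_nseq m./2 false)) (half_le m)).

Definition mid_entry (s : forall m, 'M[C]_#|{: W m}|) (m : nat) : C :=
  s m (enum_rank (mid m)) (enum_rank (mid m)).

Lemma half_level k e : 0 < e -> exists N : nat, forall m, (N <= m)%N ->
  (k <= m./2)%N /\ `|(m./2 - k)%N%:R / m%:R - 2^-1 : R| < e.
Proof.
move=> e0; have [N hN] := natr_gt ((k%:R + 1) / e).
exists (maxn N (k.*2).+1) => m; rewrite geq_max => /andP[/hN{}hN km].
have m0 : 0 < m%:R :> R by rewrite ltr0n; apply: leq_trans km.
have kh : (k <= m./2)%N by rewrite geq_half_double ltnW.
split=> //; rewrite natrB //.
have mE : m%:R = (odd m)%:R + 2 * m./2%:R :> R.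
  by rewrite -{1}(odd_double_half m) natrD -mul2n natrM.
have -> : (m./2%:R - k%:R) / m%:R - 2^-1 = - (k%:R + (odd m)%:R / 2) / m%:R :> R.
  have -> : (odd m)%:R = m%:R - 2 * m./2%:R :> R by rewrite mE addrK.
  by field; rewrite gt_eqF.
have o0 : 0 <= (odd m)%:R :> R by [].
have o1 : (odd m)%:R <= 1 :> R by rewrite lern1 leq_b1.
rewrite normrM normrN (ger0_norm (_ : 0 <= k%:R + _)) ?addr_ge0 ?divr_ge0 //.
rewrite normfV (ger0_norm (ltW m0)) ltr_pdivrMr //.
have : (k%:R + 1) < e * m%:R by rewrite -ltr_pdivrMl // mulrC.
lra.
Qed.

(** The diagonal entry of a band at a word of zeros can be nonzero only if al = be consists of
    zeros, and then it converges to f(1/2). *)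
Lemma symbolic_mid_tends s : symbolic s -> exists l, tends (mid_entry s) l.
Proof.
elim=> [|al be f fu fi|s1 s2 _ [l1 h1] _ [l2 h2]|c s1 _ [l h]].
- exists 1; apply: tends_eventually; exists 0%N => m _.
  by rewrite /mid_entry mxE eqxx.
- have E m : mid_entry (fun m => bandmx m al be (level m f)) m =
      band al be (level m f) (mid m) (mid m) by rewrite /mid_entry opmxE.
  have [alE|alN] := eqVneq al (nseq (size al) false); last first.
    exists 0; apply: tends_eventually; exists 0%N => m _; rewrite E.
    case: bandP => // w midE _.
    have sal : (size al <= m./2)%N.
      by have := congr1 size midE; rewrite /= size_nseq size_cat => ->; rewrite leq_addr.
    move/(congr1 (take (size al))): midE; rewrite take_size_cat // take_nseq // => alE.
    by rewrite alE eqxx in alN.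
  have [bE|abN] := eqVneq be al; last first.
    exists 0; apply: tends_eventually; exists 0%N => m _; rewrite E.
    case: bandP => // w aE; rewrite {1}aE => abE.
    have /eqP := congr1 size abE; rewrite !size_cat eqn_add2r => /eqP sab.
    by move/eqP: abE; rewrite eqseq_cat // eq_sym (negPf abN).
  exists (f 2^-1)%:C%C => e e0; have [_ /(_ e e0)[r r0 fr]] := fu.
  have [N hN] := half_level (size al) r0; exists N => m /hN[km {}hN].
  have midE : mid m = al ++ nseq (m./2 - size al) false :> seq bool.
    by rewrite {1}alE -nseqD subnKC.
  rewrite E bE midE band_cat eqxx mul1r.
  by rewrite /level -rmorphB normc_real size_nseq; exact: fr.
- exists (1 * l1 + l2) => e e0; have [N h] := tends_lin 1 h1 h2 e0.
  by exists N => m /h; rewrite mul1r /mid_entry mxE.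
- exists (c * l + 0) => e e0; have [N h'] := tends_lin c h (tends_cst 0) e0.
  by exists N => m /h'; rewrite addr0 /mid_entry mxE.
Qed.

Lemma mid_tends (a : A) : exists l, tends (mid_entry (slot a)) l.
Proof.
apply: cauchy_complex => e e0; have e30 : 0 < e / 3 by rewrite divr_gt0.
have [_ /(_ _ (divr_gt0 e30 (ltr0n _ 2)))[s ss [N1 h1]]] := slotP a.
have [l /(_ _ (divr_gt0 e30 (ltr0n _ 2)))[N2 h2]] := symbolic_mid_tends ss.
exists (maxn N1 N2) => m n; rewrite !geq_max => /andP[m1 m2] /andP[n1 n2].
have close k : (N1 <= k)%N -> (N2 <= k)%N -> normc (mid_entry (slot a) k - l) < e / 3.
  move=> k1 k2; rewrite -(subrKA (mid_entry s k)) (le_lt_trans (le_normcD _ _)) //.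
  rewrite (splitr (e / 3)) ler_ltD ?h2 //.
  apply: le_trans (h1 k k1); apply: le_trans (normc_le_opnorm _ (enum_rank (mid k)) (enum_rank (mid k))).
  by rewrite !mxE.
rewrite -(subrKA l) (le_lt_trans (le_normcD _ _)) //.
have := close m m1 m2; have := close n n1 n2.
by rewrite -[normc (l - _)]normcN opprB; lra.
Qed.

Definition mid_state (a : A) : C := sval (cid (mid_tends a)).

Lemma mid_stateP (a : A) : tends (mid_entry (slot a)) (mid_state a).
Proof. exact: svalP (cid (mid_tends a)). Qed.

Lemma mid_state_linear c (a b : A) : mid_state (c *: a + b) = c * mid_state a + mid_state b.
Proof.
apply: tends_unique (mid_stateP _) _ => e e0.
have [N h] := tends_lin c (mid_stateP a) (mid_stateP b) e0.
by exists N => m /h; rewrite /mid_entry !mxE.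
Qed.

Lemma mid_state1 : mid_state 1 = 1.
Proof.
apply: tends_unique (mid_stateP _) _; apply: tends_eventually.
by exists 0%N => m _; rewrite /mid_entry mxE eqxx.
Qed.

Lemma mid_state0 : mid_state 0 = 0.
Proof.
apply: tends_unique (mid_stateP _) _; apply: tends_eventually.
by exists 0%N => m _; rewrite /mid_entry mxE.
Qed.

Lemma normc_mid_state (a : A) : normc (mid_state a) <= cnorm a.
Proof.
apply: normc_tends_le (mid_stateP a) _ => m.
exact: le_trans (normc_le_opnorm _ _ _) (opnorm_le_subnorm a m).
Qed.

(** Levels between 3/8 and 5/8, around the level 1/2 of [mid]; the integer form suits [lia]. *)
Definition in_middle (m k : nat) : bool := (3 * m <= 8 * k <= 5 * m)%N.

(** Columns at middle levels vanish exactly, not just asymptotically. The Cuntz relations hold in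
    the algebra up to such elements. *)
Definition middle_null (x : A) : Prop :=
  exists N : nat, forall m, (N <= m)%N -> forall u : W m, in_middle m (size u) ->
    forall v, slot x m (enum_rank v) (enum_rank u) = 0.

(** A symbolic sequence changes the length of a word by a bounded amount, eventually too small to
    leave the middle range from m/2. *)
Lemma symbolic_middle (s : forall m, 'M[C]_#|{: W m}|) : symbolic s -> exists N : nat, forall m, (N <= m)%N ->
  forall u : W m, ~~ in_middle m (size u) -> s m (enum_rank u) (enum_rank (mid m)) = 0.
Proof.
elim=> [|al be f fu fi|s1 s2 _ [N1 h1] _ [N2 h2]|c s1 _ [N h]].
- exists 4%N => m m4 u; rewrite mxE (inj_eq enum_rank_inj); case: eqP => // ->.
  rewrite /in_middle /= size_nseq => /negP[]; have := odd_double_half m.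
  by case: (odd m); lia.
- exists (8 * (size al + size be).+1)%N => m ab u uN; rewrite opmxE.
  case: bandP => // w uE /(congr1 size); rewrite /= size_nseq size_cat => mE.
  case/negP: uN; rewrite /in_middle uE size_cat; have := odd_double_half m.
  by case: (odd m); lia.
- exists (maxn N1 N2) => m; rewrite geq_max => /andP[m1 m2] u uN.
  by rewrite mxE h1 // h2 // addr0.
- by exists N => m Nm u uN; rewrite mxE h // mulr0.
Qed.

(** [b] sends the middle basis vector close to the span of the middle levels, where [x] vanishes. As
    [b] is arbitrary, this holds along whole unitary orbits. *)
Lemma mid_state_null (x b : A) : middle_null x -> mid_state (star b * x * b) = 0.
Proof.
move=> [N xN]; apply: tends_unique (mid_stateP _) _ => e e0.
pose K := cnorm b * cnorm x + 1.
have K0 : 0 < K by rewrite ltr_wpDl // mulr_ge0 ?cnorm_ge0.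
have [_ /(_ _ (divr_gt0 e0 K0))[s ss [N1 h1]]] := slotP b.
have [N2 h2] := symbolic_middle ss.
exists (maxn N (maxn N1 N2)) => m; rewrite !geq_max => /andP[/xN{}xN /andP[/h1{}h1 /h2{}h2]].
rewrite subr0 /mid_entry; set i := enum_rank (mid m).
have xs0 k : (slot x m *m s m) k i = 0.
  rewrite mulmx_enum big1 // => u _; rewrite -(enum_valK k).
  have [um|um] := boolP (in_middle m (size u)); first by rewrite xN // mul0r.
  by rewrite h2 // mulr0.
(* The product x s kills the middle vector, so [s] may be subtracted from the right factor, leaving
   only a small remainder. *)
have -> : slot (star b * x * b) m i i =
    (adj (slot b m) *m slot x m *m (slot b m - s m)) i i.
  rewrite mulmxBr [RHS]mxE [X in _ = _ + X]mxE -[adj _ *m _ *m s m]mulmxA.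
  rewrite [X in _ = _ - X]mxE big1 ?subr0 // => k _.
  by rewrite xs0 mulr0.
rewrite (le_lt_trans (normc_le_opnorm _ i i)) // (le_lt_trans (ler_opnormM _ _)) //.
apply: (@le_lt_trans _ _ (cnorm b * cnorm x * (e / K))).
  rewrite ler_pM ?opnorm_ge0 // (le_trans (ler_opnormM _ _)) // opnorm_adj.
  by apply: ler_pM; rewrite ?opnorm_ge0 //;
    [exact: (opnorm_le_subnorm b m)|exact: (opnorm_le_subnorm x m)].
by rewrite mulrA ltr_pdivrMr // mulrC ltr_pM2l // ltrDl.
Qed.

End middle_state.

(** * Cuntz relations in the middle and averaging over the unitary group *)

Section nonamenability.
Context (R : realType).
Local Notation C := R[i].
Local Notation W m := (bseq_of m bool).
Local Notation A := (subalg (fock R)).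

(** With d = 1/4 the cut-off is 1 on [1/4, 3/4], a neighbourhood of the middle range [3/8, 5/8]. *)
Let bump := plateau (4^-1 : R).

Let bump_ucb : ucb bump.
Proof. by apply: ucb_plateau; rewrite invr_gt0. Qed.

Let bump_supp : interior_supp bump.
Proof. by apply: interior_supp_plateau; rewrite invr_gt0. Qed.

(** The creation operator of the letter [x], damped near both ends. *)
Definition shift (x : bool) : A :=
  @Subalg R (fock R) _ (symbolic_approx (SymbolicBand [:: x] [::] bump_ucb bump_supp)).

Let bump_middle m k : (8 <= m)%N -> (2 * m <= 8 * k <= 6 * m)%N -> bump (k%:R / m%:R) = 1.
Proof.
move=> m8 /andP[k1 k2]; rewrite /bump plateau_eq1 ?invr_gt0 //.
have m0 : 0 < m%:R :> R by rewrite ltr0n; apply: leq_trans m8.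
rewrite ler_pdivlMr // ler_pdivrMr //.
move: k1 k2; rewrite -!(ler_nat R) !natrM => k1 k2; apply/andP; split; lra.
Qed.

Let middle_range m k : in_middle m k -> (2 * m <= 8 * k <= 6 * m)%N.
Proof. by rewrite /in_middle; lia. Qed.

(** Removing one letter lowers the level by at most the margin 1/8 once m >= 8. *)
Let middle_range_pred m k : (8 <= m)%N -> in_middle m k.+1 -> (2 * m <= 8 * k <= 6 * m)%N.
Proof. by rewrite /in_middle; lia. Qed.

Lemma slot_shift x m : slot (shift x) m = bandmx m [:: x] [::] (level m bump).
Proof. by []. Qed.

Lemma shift_isometry x : middle_null (1 - star (shift x) * shift x).
Proof.
have [N hN] := interior_supp_tail 1 bump_supp.
exists (maxn N 8) => m; rewrite geq_max => /andP[Nm m8] u um v.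
rewrite slotB slotM slot_star slot1 slot_shift adj_bandmx.
have -> : bandmx m [::] [:: x] (fun w => conjc (level m bump w)) *m
    bandmx m [:: x] [::] (level m bump) =
    bandmx m [::] [::] (fun w => conjc (level m bump w) * level m bump w).
  by apply: (@bandmx_mul R m [::] [:: x] [::] [::]) => w /= mw; rewrite /level hN.
rewrite -(bandmx1 R m) bandmxB opmxE bandC (band_cat [::] [::] _ (val u)).
rewrite /level conjc_real bump_middle //; last exact: middle_range um.
by rewrite rmorph1 mulr1 subrr mulr0.
Qed.

(** A nonempty word has exactly one first letter, and the empty word is not at a middle level. *)
Lemma shift_ranges :
  middle_null (1 - \sum_(x : bool) shift x * star (shift x)).
Proof.
have [N hN] := interior_supp_tail 0 bump_supp.
exists (maxn N 8) => m; rewrite geq_max => /andP[Nm m8] u um v.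
rewrite slotB slot_sum slot1.
have E x : slot (shift x * star (shift x)) m =
    bandmx m [:: x] [:: x] (level m (fun t => bump t * bump t)).
  rewrite slotM slot_star slot_shift adj_bandmx.
  transitivity (bandmx m [:: x] [:: x] (fun w => level m bump w * conjc (level m bump w))).
    apply: (@bandmx_mul R m [:: x] [::] [::] [:: x]) => w mw.
    by rewrite -[LHS]/(conjc (level m bump w)) /level conjc_real hN.
  by apply: eq_bandmx => w _ _; rewrite /level conjc_real -rmorphM.
under eq_bigr do rewrite E.
case: u um => -[|x w] uw um.
  by move: (middle_range um) => /=; lia.
rewrite mxE [X in _ + X]mxE summxE [X in X - _]mxE (inj_eq enum_rank_inj).
rewrite (bigD1 x) //= big1 ?addr0 => [|y yx].
  rewrite opmxE bandC (band_cat [:: x] [:: x] _ w) /level bump_middle //; last first.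
    exact: middle_range_pred m8 um.
  by rewrite mulr1 rmorph1 mulr1 -(inj_eq val_inj) /= subrr.
rewrite opmxE; case: bandP => // z _ /= [xy].
by rewrite xy eqxx in yx.
Qed.

Section amenable.
Local Notation U := (unitary_group A).

Definition orbit_fun (a : A) (u : U) : C := mid_state (star (val u) * a * val u).

Lemma unitary_norm (u : U) : cnorm (val u) = 1.
Proof. by apply: cnorm_unitary; case/andP: (valP u) => /eqP. Qed.

Lemma cnorm_conj_unitary (a : A) (u : U) : cnorm (star (val u) * a * val u) <= cnorm a.
Proof.
rewrite (le_trans (ler_cnormM _ _)) // unitary_norm mulr1.
by rewrite (le_trans (ler_cnormM _ _)) // cnorm_star unitary_norm mul1r.
Qed.

Lemma normc_orbit_fun (a : A) (u : U) : normc (orbit_fun a u) <= cnorm a.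
Proof. exact: le_trans (normc_mid_state _) (cnorm_conj_unitary a u). Qed.

Lemma orbit_fun_linear c (a b : A) (u : U) :
  orbit_fun (c *: a + b) u = c * orbit_fun a u + orbit_fun b u.
Proof.
by rewrite /orbit_fun mulrDr mulrDl -scalerAr -scalerAl mid_state_linear.
Qed.

Lemma orbit_funB (a b : A) (u : U) :
  orbit_fun (a - b) u = orbit_fun a u - orbit_fun b u.
Proof. by rewrite addrC -scaleN1r orbit_fun_linear mulN1r addrC. Qed.

(** (x u)^* a (x u) = u^* (x^* a x) u, so left invariance of the mean becomes invariance of the
    averaged functional under conjugation. *)
Lemma translate_orbit_fun (a : A) (x : U) :
  translate x (orbit_fun a) = orbit_fun (star (val x) * a * val x).
Proof.
by apply/funext => u; rewrite /translate /orbit_fun /= starM !mulrA.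
Qed.

Let sum_le (p q r s t : R) : p <= q * s -> q * s <= t * s -> r <= s * t ->
  p + r <= 2 * t * s.
Proof. by move=> pq qt rs; rewrite -mulrA mulr_natl mulr2n lerD ?(le_trans pq) // mulrC. Qed.

Lemma cnorm_conj_sub (a : A) (x : U) :
  cnorm (star (val x) * a * val x - a) <= 2 * cnorm a * unitary_dist x 1%g.
Proof.
have -> : star (val x) * a * val x - a =
    star (val x) * a * (val x - 1) + star (val x - 1) * a.
  by rewrite starB star1 mulrBr mulrBl mulr1 mul1r addrA subrK.
apply: le_trans (ler_cnormD _ _) _.
have h1 := ler_cnormM (star (val x) * a) (val x - 1).
have h2 := ler_cnormM (star (val x - 1)) a.
have h3 := ler_cnormM (star (val x)) a.
rewrite cnorm_star unitary_norm mul1r in h3; rewrite cnorm_star in h2.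
have h4 := ler_wpM2r (cnorm_ge0 (val x - 1)) h3.
exact: sum_le h1 h4 h2.
Qed.

(** The norm topology enters here: |x^* a x - a| <= 2 |a| |x - 1| bounds the change of the orbit
    function uniformly over the group. *)
Lemma orbit_fun_RUCB (a : A) : RUCB (orbit_fun a).
Proof.
split.
  apply: (@le_lt_trans _ _ (cnorm a)%:E); last exact: ltry.
  by apply: ge_ereal_sup => _ [u _ <-]; rewrite lee_fin normc_orbit_fun.
pose K : R := 2 * cnorm a.
have K0 : 0 <= K by rewrite mulr_ge0 ?cnorm_ge0.
have FF : Filter (nbhs (1%g : U)) := nbhs_filter _.
apply: (@squeeze_cvge U (nbhs (1%g : U)) FF R (fun=> 0%E) _
  (fun x : U => (K * unitary_dist x 1%g)%:E)).
- near=> x; apply/andP; split.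
    (* The supremum is nonnegative because it dominates the value at the neutral element. *)
    apply: le_trans (_ : ((normc (translate x (orbit_fun a) 1%g - orbit_fun a 1%g))%:E <= _)%E).
      by rewrite lee_fin normc_ge0.
    by apply: ereal_sup_ubound; exists 1%g.
  apply: ge_ereal_sup => _ [u _ <-]; rewrite lee_fin translate_orbit_fun -orbit_funB.
  exact: le_trans (normc_orbit_fun _ _) (cnorm_conj_sub a x).
- exact: cvg_cst.
- apply: cvg_EFin; first by near=> x.
  apply/cvgrPdist_lt => e e0; near=> x; rewrite /= sub0r normrN.
  rewrite ger0_norm ?mulr_ge0 ?cnorm_ge0 //.
  have : ball (1%g : U) (e / (K + 1)) x.
    by near: x; apply: nbhsx_ballx; rewrite divr_gt0 // ltr_wpDl.
  rewrite ballEmdist /= -[mdist _ _]/(unitary_dist 1%g x) unitary_distC => dx.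
  have K1 : 0 < K + 1 by rewrite ltr_wpDl.
  rewrite ltr_pdivlMr // in dx; apply: le_lt_trans dx.
  by rewrite mulrC ler_wpM2l ?cnorm_ge0 // lerDl.
Unshelve. all: by end_near. Qed.

Theorem fock_unitary_group_not_amenable : ~ amenable R U.
Proof.
move=> [mu [mu_lin mu1 _ mu_inv]].
pose tau (a : A) := mu (orbit_fun a).
have tau_lin c a b : tau (c *: a + b) = c * tau a + tau b.
  rewrite /tau -(mu_lin c) ?mu1; try exact: orbit_fun_RUCB.
  by congr mu; apply/funext => u; rewrite orbit_fun_linear.
have tau_conj u a : unitary u -> tau (star u * a * u) = tau a.
  move=> uu; pose x : U := exist _ u uu.
  by rewrite /tau -(mu_inv x (orbit_fun a)) ?translate_orbit_fun //; exact: orbit_fun_RUCB.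
have tauD' := tauD tau_lin; have tauB' := tauB tau_lin.
have tau1 : tau 1 = 1.
  rewrite /tau -[RHS]mu1; congr mu; apply/funext => u.
  rewrite /orbit_fun mulr1; case/andP: (valP u) => /eqP -> _.
  exact: mid_state1.
(* By [mid_state_null] the whole orbit function of such an element is zero. *)
have tau_null d : middle_null d -> tau d = 0.
  move=> dn; rewrite -(tau0 tau_lin) /tau; congr mu; apply/funext => u.
  rewrite /orbit_fun mid_state_null // mulr0 mul0r.
  by rewrite mid_state0.
have tau_iso x : tau (shift x * star (shift x)) = 1.
  rewrite (tau_tracial tau_lin tau_conj); apply/eqP; rewrite eq_sym -subr_eq0.
  by rewrite -tau1 -tauB' tau_null //; exact: shift_isometry.
have := tau_null _ shift_ranges; rewrite tauB' tau1 big_bool tauD' !tau_iso.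
by move/eqP; rewrite opprD addrA subrr add0r oppr_eq0 oner_eq0.
Qed.

End amenable.
End nonamenability.

Theorem theorem4p1 (R : realType) :
  exists A : cstarAlgType R,
    [/\ stably_finite A, nuclear A & ~ amenable R (unitary_group A)].
Proof.
exists (subalg (fock R)); split.
- exact: stably_finite_subalg.
- exact: nuclear_fock.
- exact: fock_unitary_group_not_amenable.
Qed.
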